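(* Let $d\ge1$, $R\ge0$, $\lambda\in[0,\infty)$, let $B\subset\mathbb{R}^d$ be a bounded Borel set and $C\in\mathcal{C}_{B^c}$. The dependent thinning $\mathcal{P}^{\mathrm{thin}}_{B,C}$ on $(\mathcal{C}_B^2,\mathcal{F}_B^{\otimes2})$ is a dominating coupling between a Poisson point process and a hard-sphere point process; that is, under $\mathcal{P}^{\mathrm{thin}}_{B,C}$: (a) $\xi^1$ has law $\mathcal{P}^{\mathrm{hs}}_{B,C,\lambda}$; (b) $\xi^2$ has law $\mathcal{P}^{\mathrm{poi}}_{B,\lambda}$; (c) $\mathcal{P}^{\mathrm{thin}}_{B,C}(\xi^1\subseteq\xi^2)=1$. Moreover, the boundary condition may be restricted to the ring $\mathcal{R}(B)$, i.e. $\mathcal{P}^{\mathrm{thin}}_{B,C}=\mathcal{P}^{\mathrm{thin}}_{B,C\cap\mathcal{R}(B)}$, and $\mathcal{P}^{\mathrm{thin}}_{B,C}$ is measurable in $C$, i.e. for every $E\in\mathcal{F}_B^{\otimes 2}$ the map $\mathcal{C}_{B^c}\to[0,1]$, $C\mapsto\mathcal{P}^{\mathrm{thin}}_{B,C}(E)$, is $\mathcal{F}_{B^c}$-measurable.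
   Context: Space and configurations. Fix $d\ge1$, a radius $R\in[0,\infty)$ and an activity $\lambda\in[0,\infty)$. $\|\cdot\|$ is the Euclidean norm, $\mathcal{L}$ Lebesgue measure, $B^c$ the complement in $\mathbb{R}^d$. For a set $B$, $\mathcal{S}(B)=\{y:\exists x\in B,\ \|x-y\|\le R\}$ and $\mathcal{R}(B)=\mathcal{S}(B)\setminus B$. For Borel $B$, $\mathcal{C}_B$ is the set of locally finite subsets of $B$, and $\mathcal{F}_B$ is the $\sigma$-algebra on $\mathcal{C}_B$ generated by the sets $\{C\in\mathcal{C}_B: C\cap A=\emptyset\}$, $A\subseteq B$ Borel. On $\mathcal{C}_B^2$ use the product $\sigma$-algebra $\mathcal{F}_B^{\otimes2}$ with canonical variables $(\xi^1,\xi^2)$. Poisson and hard-sphere laws. $\mathcal{P}^{\mathrm{poi}}_{B,\lambda}$ is the Poisson point process law on $B$ with intensity measure $\lambda\mathcal{L}$ and canonical variable $\xi$. For disjoint configurations $Y,C$, $\mathcal{H}(Y|C)\in\{0,1\}$ equals $1$ iff all distinct $x,y\in Y$ satisfy $\|x-y\|>R$ and all $y\in Y$, $x\in C$ satisfy $\|x-y\|>R$. For bounded Borel $B$ and $C\in\mathcal{C}_{B^c}$, $\mathcal{P}^{\mathrm{hs}}_{B,C,\lambda}:=\mathcal{P}^{\mathrm{poi}}_{B,\lambda}(\cdot\mid\mathcal{H}(\xi|C)=1)$ and the partition function is $\mathcal{Z}(B,C):=e^{\lambda\mathcal{L}(B)}\,\mathcal{P}^{\mathrm{poi}}_{B,\lambda}(\mathcal{H}(\xi|C)=1)$.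 Ordering. For $u\in[0,\infty)$ and $n\in\mathbb{Z}$ let $u_n\in\{0,1\}$ be the $n$-th binary digit $u_n=\lfloor 2^{-n}u\rfloor \bmod 2$ (so the expansion not ending in infinitely many $1$s is used). Define the injective measurable map $\hat b:[0,\infty)^d\to[0,\infty)$, $\hat b(x_1,\dots,x_d)=\sum_{n\in\mathbb{Z}}(x_{(n\bmod d)+1})_{\lfloor n/d\rfloor}\,2^n$ (interleaving binary digits). Given the bounded set $B$, fix a vector $v\in\mathbb{R}^d$ with $B\subseteq v+[0,\infty)^d$ and order $v+[0,\infty)^d$ totally by $x\prec y$ iff $\hat b(x-v)<\hat b(y-v)$. Intervals are with respect to $\prec$ and restricted to $B$: $]-\infty,x[\,=\{y\in B:y\prec x\}$, $]x,\infty[\,=\{y\in B:x\prec y\}$. Dependent thinning. For $x\in B$ and $Y\in\mathcal{C}_{]-\infty,x[}$ put $$p_Y(x):=\mathcal{H}(\{x\}|C\cup Y)\,\frac{\mathcal{Z}(]x,\infty[,\,C\cup Y\cup\{x\})}{\mathcal{Z}(]x,\infty[,\,C\cup Y)}\in[0,1].$$ For $x\in B$, $Y_1\in\mathcal{C}_B$ let $p(x\mid Y_1):=p_{Y_1\cap]-\infty,x[}(x)$, and let $c(x,Y_1):=p(x\mid Y_1)$ if $x\in Y_1$, $c(x,Y_1):=1-p(x\mid Y_1)$ if $x\notin Y_1$. The law $\mathcal{P}^{\mathrm{thin}}_{B,C}$ on $\mathcal{C}_B^2$ is defined, for $E\in\mathcal{F}_B^{\otimes2}$, by $$\mathcal{P}^{\mathrm{thin}}_{B,C}(E):=\int_{\mathcal{C}_B}\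 \sum_{Y_1\subseteq Y_2}1_{(Y_1,Y_2)\in E}\prod_{x\in Y_2}c(x,Y_1)\ \mathcal{P}^{\mathrm{poi}}_{B,\lambda}(\mathrm{d}Y_2).$$ *)

(* Defs.v *)
From HB Require Import structures.
From mathcomp Require Import all_boot all_order all_algebra.
From mathcomp Require Import all_classical all_reals all_analysis.
From mathcomp Require Import measurable_realfun.
From mathcomp Require Import ring lra.

Set Implicit Arguments.
Unset Strict Implicit.
Unset Printing Implicit Defensive.
Import Order.TTheory GRing.Theory Num.Theory.

Local Open Scope classical_set_scope.
Local Open Scope ring_scope.

Section power_measure.
Context {disp : measure_display} {T : measurableType disp} {R : realType}.
Variable mu : set T -> \bar R.

(* The n-fold product measure, on the product sigma-algebra of n.-tuple T. *)
Fixpoint power_measure (n : nat) : set (n.-tuple T) -> \bar R :=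
  match n with
  | 0 => fun A => \d_([tuple] : 0.-tuple T) A
  | m.+1 => fun A =>
      ((mu \x @power_measure m) [set p : T * m.-tuple T | A [tuple of p.1 :: p.2]])%E
  end.

End power_measure.

Section space.
Context {R : realType} {d : nat}.
Local Notation E := (d.-tuple R).
Implicit Types (x y : E) (B Y C : set E).

Definition lebesgue : set E -> \bar R := power_measure lebesgue_measure (n := d).

Definition dist x y : R :=
  Num.sqrt (\sum_(i < d) (tnth x i - tnth y i) ^+ 2).

Definition bounded B : Prop := exists x, exists M : R, forall y, B y -> dist x y <= M.

Definition locally_finite Y : Prop :=
  forall A, bounded A -> finite_set (Y `&` A).

Record config B := Config {
  points :> set E ;
  config_sub : points `<=` B ;
  config_locally_finite : locally_finite points }.

Lemma config_set0 B : set0 `<=` B /\ locally_finite set0.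
Proof. by split=> [//|A _]; rewrite set0I; exact: finite_set0. Qed.

Definition config0 B : config B :=
  Config (proj1 (config_set0 B)) (proj2 (config_set0 B)).

HB.instance Definition _ B := gen_eqMixin (config B).
HB.instance Definition _ B := gen_choiceMixin (config B).
HB.instance Definition _ B := isPointed.Build (config B) (config0 B).

Definition void_event B (A : set E) : set (config B) :=
  [set Y | points Y `&` A = set0].
Arguments void_event B A : clear implicits.

Definition void_events B : set (set (config B)) :=
  [set void_event B A | A in [set A | measurable A /\ A `<=` B]].
Arguments void_events B : clear implicits.

HB.instance Definition _ B :=
  @isMeasurable.Build (sigma_display (void_events B)) (config B)
    <<s void_events B >>
    (@sigma_algebra0 _ setT (void_events B))
    (@sigma_algebraC (config B) (void_events B))
    (@sigma_algebra_bigcup _ setT (void_events B)).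

Definition sphere_union (r : R) B : set E :=
  [set y | exists2 x, B x & dist x y <= r].

Definition collar (r : R) B : set E := sphere_union r B `\` B.

End space.
Arguments config {R d} B.
Arguments void_event {R d} B A.
Arguments void_events {R d} B.

(* Poisson law of intensity lambda on a set B of finite volume: a Poisson
   number of points, which given their number are i.i.d. uniform on B.  The
   condition [points Y = [set` t]] forces all the coordinates of t into B. *)
Section poisson.
Context {R : realType} {d : nat}.
Local Notation E := (d.-tuple R).
Variables (lambda : R) (B : set E).

Definition config_tuples (n : nat) (F : set (config B)) : set (n.-tuple E) :=
  [set t : n.-tuple E | exists2 Y, F Y & points Y = [set x | x \in t]].

Definition poisson_law (F : set (config B)) : \bar R :=
  (\sum_(0 <= n <oo)
     (expR (- (lambda * fine (lebesgue B))) * lambda ^+ n / n`!%:R)%:E *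
     power_measure lebesgue (config_tuples (n := n) F))%E.

End poisson.

Section hard_sphere.
Context {R : realType} {d : nat}.
Local Notation E := (d.-tuple R).
Variables r lambda : R.
Implicit Types (B Y C : set E) (x : E).

Definition hard_core Y C : Prop :=
  (forall x y, Y x -> Y y -> x != y -> r < dist x y) /\
  (forall x y, C x -> Y y -> r < dist x y).

Definition hard_coreR Y C : R := (`[< hard_core Y C >])%:R.

Definition hard_core_event B C : set (config B) :=
  [set Y | hard_core (points Y) C].
Arguments hard_core_event B C : clear implicits.

Definition hard_sphere_law B C (F : set (config B)) : \bar R :=
  (fine (poisson_law lambda (F `&` hard_core_event B C)) /
   fine (poisson_law lambda (hard_core_event B C)))%:E.

Definition partition_function B C : R :=
  expR (lambda * fine (lebesgue B)) *
  fine (poisson_law lambda (hard_core_event B C)).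

End hard_sphere.
Arguments hard_core_event {R d} r B C.

Section order.
Context {R : realType} {d : nat}.
Local Notation E := (d.-tuple R).

Definition digit (u : R) (n : int) : nat :=
  `|(Num.floor ((2%:R : R) ^ (- n) * u) %% 2)%Z|%N.

(* Coordinates are numbered from 0. *)
Definition interleave (x : E) : R :=
  fine (\esum_(n in [set: int])
    ((digit (nth 0 x `|(n %% d%:Z)%Z|%N) (n %/ d%:Z)%Z)%:R * 2%:R ^ n)%:E).

Variable v : E.

Definition translate (x : E) : E := [tuple tnth x i - tnth v i | i < d].

Definition precedes (x y : E) : Prop :=
  interleave (translate x) < interleave (translate y).

Definition before (B : set E) (x : E) : set E := [set y | B y /\ precedes y x].

Definition after (B : set E) (x : E) : set E := [set y | B y /\ precedes x y].

End order.

Section thinning.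
Context {R : realType} {d : nat}.
Local Notation E := (d.-tuple R).
Variables (r lambda : R) (v : E) (B C : set E).

Definition retention (Y : set E) (x : E) : R :=
  hard_coreR r [set x] (C `|` Y) *
  (partition_function r lambda (after v B x) (C `|` Y `|` [set x]) /
   partition_function r lambda (after v B x) (C `|` Y)).

Definition retention_given (Y1 : set E) (x : E) : R :=
  retention (Y1 `&` before v B x) x.

Definition thin_weight (Y1 : set E) (x : E) : R :=
  if `[< Y1 x >] then retention_given Y1 x else 1 - retention_given Y1 x.

Definition thin_law (F : set (config B * config B)) : \bar R :=
  (\int[@poisson_law R d lambda B]_Y2
    \esum_(Y1 in [set Y1 : config B | points Y1 `<=` points Y2])
      (\1_F (Y1, Y2) * \big[*%R/1]_(x \in points Y2) thin_weight (points Y1) x)%:E)%E.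

End thinning.

(* Main.v *)
(* Up to the factor exp(- lambda |B|), the Poisson process on B is the image of the measure
   Lam = sum_n lambda^n / n! (volume on B)^n on finite sequences, for which
   int sum_((u, w) split of s) f(u, w) Lam(ds) = int int f(u, w) Lam(du) Lam(dw).
   Hence under the thinning the retained points u and the deleted points w have density
   prod_(x in u) p(x|u) prod_(x in w) (1 - p(x|u)) with respect to Lam x Lam.
   Peeling off the last point, the sum of these weights over the splits of a given
   configuration is 1, which gives the second marginal.
   For the first one, integrating w out leaves
   prod_(x in u) p(x|u) exp(- lambda int p(x|u) dx).  Decomposing according to the first point,
   z(t) = Z(]t, oo[, C) satisfies z(t) = 1 + lambda int_(x > t) p(x) z(x) dx, hence
   z(t) = exp(lambda int_(x > t) p(x) dx); by induction along u the product telescopes to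
   H(u|C) / Z(B, C), the hard-sphere density.
   Only the finitely many points of C in a box around B matter; they can be listed measurably,
   which gives the measurability in C. *)

Require Import Defs.
From HB Require Import structures.
From mathcomp Require Import all_boot all_order all_algebra finmap.
From mathcomp Require Import all_classical all_reals all_analysis.
From mathcomp Require Import measurable_realfun.
From mathcomp Require Import ring lra zify.

Import Order.TTheory GRing.Theory Num.Theory.
Local Open Scope classical_set_scope.
Local Open Scope ring_scope.
Set Implicit Arguments.
Unset Strict Implicit.
Unset Printing Implicit Defensive.

(** * Finite sequences as a measurable type *)

(** Configurations are an awkward domain: their sigma-algebra is generated by void events,
    [poisson_law] is a bare set function, and the sum over subconfigurations in [thin_law] is not
    visibly measurable. On finite sequences all of this is explicit, length by length. The way back
    is a measurable section of the map from sequences to configurations: interleaving digits is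
    injective on B, so a configuration can be listed in increasing order, and rational levels
    separating the first point from the others make this listing measurable. The two descriptions
    then differ only on sequences that leave B or repeat a point, a null set because volume has no
    atoms when d is positive. The equation for z involves a function p with no regularity beyond
    measurability and an order given by digits, so no differential equation is at hand. It is solved
    by Picard iteration: the iterates of 1 are the terms of an exponential series, again by
    decomposing at the first point, and boundedness of z makes the remainder vanish. *)

Lemma measurable_bool_set d (T : measurableType d) (b : T -> bool) :
  measurable_fun setT b -> measurable [set x | b x].
Proof.
move=> mb; rewrite (_ : [set _ | _] = setT `&` b @^-1` [set true]).
  exact: mb.
by rewrite setTI; apply/seteqP; split.
Qed.

Lemma measurable_setP d (T : measurableType d) (A : set T) :
  measurable A <-> measurable_fun setT (fun x => x \in A).
Proof.
split=> [mA|/measurable_bool_set].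
  apply: (measurable_fun_bool true); rewrite setTI (_ : _ @^-1` _ = A)//.
  by apply/seteqP; split=> x /= => [/set_mem|/mem_set].
by rewrite (_ : [set x | _] = A)//; apply/seteqP; split=> x /= => [/set_mem|/mem_set].
Qed.

Lemma measurable_b2r d (T : measurableType d) (R : realType) (b : T -> bool) :
  measurable_fun setT b -> measurable_fun setT (fun x => (b x)%:R : R).
Proof.
move=> mb; rewrite (_ : (fun _ => _) = fun x => if b x then 1%R else 0%R).
  exact: measurable_fun_ifT.
by apply/funext => x; case: (b x).
Qed.

Lemma measurable_b2e d (T : measurableType d) (R : realType) (b : T -> bool) :
  measurable_fun setT b -> measurable_fun setT (fun x => ((b x)%:R : R)%:E).
Proof. by move=> mb; apply/measurable_EFinP; exact: measurable_b2r. Qed.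

(** Opaque on purpose: the display of [seq T] must be a symbol distinct from that of [T]. *)
Definition seq_display : measure_display -> measure_display.
Proof. exact. Qed.

HB.instance Definition _ (T : choiceType) := isPointed.Build (seq T) [::].

Section measurable_seq.
Context {disp : measure_display} {T : measurableType disp}.

(** The sigma-algebra of the disjoint union of the powers of T, so that measurability is a question
    about each length separately. *)
Definition seq_measurable : set (set (seq T)) :=
  [set A : set (seq T) | forall n, measurable [set t : n.-tuple T | A t]].

Let seq_measurable0 : seq_measurable set0.
Proof. by move=> n; rewrite (_ : [set t | _] = set0). Qed.

Let seq_measurableC A : seq_measurable A -> seq_measurable (~` A).
Proof. by move=> mA n; exact: measurableC (mA n). Qed.

Let seq_measurable_bigcup (F : (set (seq T))^nat) :
  (forall i, seq_measurable (F i)) -> seq_measurable (\bigcup_i F i).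
Proof. by move=> mF n; apply: bigcupT_measurable => i; exact: mF. Qed.

HB.instance Definition _ := @isMeasurable.Build (seq_display disp) (seq T)
  seq_measurable seq_measurable0 seq_measurableC seq_measurable_bigcup.

Lemma measurable_seqE (A : set (seq T)) :
  measurable A = forall n, measurable [set t : n.-tuple T | A t].
Proof. by []. Qed.

Lemma measurable_tval n : measurable_fun [set: n.-tuple T] (@tval n T).
Proof. by move=> _ A mA; rewrite setTI; exact: mA. Qed.

(** Left inverse of [tval]. Sequences of another length go to a constant tuple, which keeps the map
    measurable on all of [seq T]. *)
Definition to_tuple n (s : seq T) : n.-tuple T := insubd (nseq_tuple n point) s.

Lemma to_tupleK n (t : n.-tuple T) : to_tuple n t = t.
Proof. by apply: val_inj; rewrite val_insubd size_tuple eqxx. Qed.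

Lemma tval_to_tuple (s : seq T) : to_tuple (size s) s = s :> seq T.
Proof. by rewrite val_insubd eqxx. Qed.

Lemma measurable_to_tuple n : measurable_fun [set: seq T] (to_tuple n).
Proof.
move=> _ A mA; rewrite setTI measurable_seqE => m; have [<-|nm] := eqVneq n m.
  by rewrite (_ : [set t | _] = A)//; apply/seteqP; split=> t /=; rewrite to_tupleK.
have E (t : m.-tuple T) : to_tuple n t = nseq_tuple n point.
  by apply: val_inj; rewrite val_insubd size_tuple eq_sym (negbTE nm).
have [An|An] := pselect (A (nseq_tuple n point)).
  by rewrite (_ : [set t | _] = setT)//; apply/seteqP; split=> t //= _; rewrite E.
by rewrite (_ : [set t | _] = set0)//; apply/seteqP; split=> t //=; rewrite E.
Qed.

Lemma measurable_size : measurable_fun [set: seq T] (@size T).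
Proof.
move=> _ A mA; rewrite setTI measurable_seqE => n.
have [An|An] := pselect (A n).
  by rewrite (_ : [set t | _] = setT)//; apply/seteqP; split=> t //= _; rewrite size_tuple.
by rewrite (_ : [set t | _] = set0)//; apply/seteqP; split=> t //=; rewrite size_tuple.
Qed.

Context d' (X : measurableType d') d'' (U : measurableType d'').

(** The product sigma-algebra on [X * seq T] is not defined slice by slice. The preimage is
    therefore cut by the size of the second component, and each slice is pulled back along
    [to_tuple]. *)
Lemma measurable_fun_seq (f : X * seq T -> U) :
  (forall n, measurable_fun [set: X * n.-tuple T] (fun p => f (p.1, tval p.2))) ->
  measurable_fun [set: X * seq T] f.
Proof.
move=> mf _ A mA; rewrite setTI.
rewrite (_ : _ @^-1` _ = \bigcup_n ((fun p : X * seq T => size p.2) @^-1` [set n] `&`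
   (fun p : X * seq T => (p.1, to_tuple n p.2)) @^-1`
   ((fun p : X * n.-tuple T => f (p.1, tval p.2)) @^-1` A))); last first.
  apply/seteqP; split=> [[x s] /= Afs|[x s] [n _ /= [<-]]].
    by exists (size s) => //=; split=> //; rewrite tval_to_tuple.
  by rewrite tval_to_tuple.
apply: bigcupT_measurable => n; apply: measurableI.
  rewrite -[X in measurable X]setTI.
  exact: (measurableT_comp measurable_size measurable_snd).
rewrite -[X in measurable X]setTI.
have : measurable_fun [set: X * seq T] (fun p : X * seq T => (p.1, to_tuple n p.2)).
  apply: measurable_fun_pair => //.
  exact: (measurableT_comp (@measurable_to_tuple n) measurable_snd).
by apply=> //; rewrite -[X in measurable X]setTI; exact: mf.
Qed.

End measurable_seq.

Section measurable_seq_fun.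
Context {disp : measure_display} {T : measurableType disp}.

Lemma measurable_thead n : measurable_fun [set: n.+1.-tuple T] (@thead n T).
Proof. exact: measurable_tnth. Qed.

(** The list operations below are rewritten as folds, so this one induction on the length serves
    them all. The parameter in X lets the folded operation depend on outer data. *)
Lemma measurable_foldr d' (X : measurableType d') d'' (U : measurableType d'')
    (f : X * T * U -> U) (z : X -> U) :
  measurable_fun setT f -> measurable_fun setT z ->
  measurable_fun setT (fun p : X * seq T => foldr (fun y u => f (p.1, y, u)) (z p.1) p.2).
Proof.
move=> mf mz; apply: measurable_fun_seq; elim=> [|n IH].
  rewrite (_ : (fun _ => _) = z \o fst); first exact: measurableT_comp.
  by apply/funext => -[x t]; rewrite (tuple0 t).
rewrite (_ : (fun _ => _) = fun p : X * n.+1.-tuple T => f (p.1, thead p.2,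
   foldr (fun y u => f (p.1, y, u)) (z p.1) [tuple of behead p.2])); last first.
  by apply/funext => -[x t]; rewrite [in LHS](tuple_eta t).
apply: (measurableT_comp mf); apply: measurable_fun_pair.
  by apply: measurable_fun_pair => //; exact: (measurableT_comp (@measurable_thead n)).
apply: (measurableT_comp IH (g := fun p : X * n.+1.-tuple T => (p.1, [tuple of behead p.2]))).
apply: measurable_fun_pair => //.
exact: (measurableT_comp (@measurable_behead _ T n)).
Qed.

Lemma measurable_seq_cons d' (X : measurableType d') (x : X -> T) (s : X -> seq T) :
  measurable_fun setT x -> measurable_fun setT s ->
  measurable_fun setT (fun a => x a :: s a).
Proof.
move=> mx ms.
have : measurable_fun setT (fun p : T * seq T => p.1 :: p.2).
  apply: measurable_fun_seq => n.
  apply: (measurableT_comp (@measurable_tval _ T n.+1)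
    (g := fun p : T * n.-tuple T => [tuple of p.1 :: p.2])).
  exact: measurable_cons.
by move=> H; exact: (measurableT_comp H (measurable_fun_pair mx ms)).
Qed.

Context {d' : measure_display} {X : measurableType d'}.
Implicit Type s : X -> seq T.

Lemma measurable_seq_all (P : X -> T -> bool) s :
  measurable_fun setT (fun q : X * T => P q.1 q.2) -> measurable_fun setT s ->
  measurable_fun setT (fun a => all (P a) (s a)).
Proof.
move=> mP ms.
have := @measurable_foldr _ X _ bool (fun q => P q.1.1 q.1.2 && q.2) (fun=> true).
move=> H; apply: (measurableT_comp (H _ _) (g := fun a => (a, s a))) => //.
  by apply: measurable_and => //; exact: (measurableT_comp mP).
exact: measurable_fun_pair.
Qed.

Lemma measurable_seq_filter (P : X -> T -> bool) s :
  measurable_fun setT (fun q : X * T => P q.1 q.2) -> measurable_fun setT s ->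
  measurable_fun setT (fun a => [seq y <- s a | P a y]).
Proof.
move=> mP ms.
have := @measurable_foldr _ X _ (seq T)
  (fun q => if P q.1.1 q.1.2 then q.1.2 :: q.2 else q.2) (fun=> [::]).
move=> H; apply: (measurableT_comp (H _ _) (g := fun a => (a, s a))) => //.
  apply: measurable_fun_ifT => //; first exact: (measurableT_comp mP).
  by apply: measurable_seq_cons => //; exact: measurableT_comp.
exact: measurable_fun_pair.
Qed.

Lemma measurable_seq_cat s s' : measurable_fun setT s -> measurable_fun setT s' ->
  measurable_fun setT (fun a => s a ++ s' a).
Proof.
move=> ms ms'.
rewrite (_ : (fun _ => _) = fun a => foldr cons (s' a) (s a)); last first.
  by apply/funext => a; elim: (s a) => //= x t ->.
have := @measurable_foldr _ X _ (seq T) (fun q => q.1.2 :: q.2) s'.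
move=> H; apply: (measurableT_comp (H _ ms') (g := fun a => (a, s a))) => //.
  by apply: measurable_seq_cons => //; exact: measurableT_comp.
exact: measurable_fun_pair.
Qed.

Lemma measurable_seq_prod (R : realType) (f : X -> T -> R) s :
  measurable_fun setT (fun q : X * T => f q.1 q.2) -> measurable_fun setT s ->
  measurable_fun setT (fun a => \prod_(y <- s a) f a y).
Proof.
move=> mf ms.
have H := @measurable_foldr _ X _ R (fun q => f q.1.1 q.1.2 * q.2) (fun=> 1).
rewrite (_ : (fun _ => _) = fun a => foldr (fun y u => f a y * u) 1 (s a)); last first.
  by apply/funext => a; elim: (s a) => [|y t IH]; rewrite ?big_nil// big_cons IH.
apply: (measurableT_comp (H _ _) (g := fun a => (a, s a))) => //.
  by apply: measurable_funM => //; exact: (measurableT_comp mf).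
exact: measurable_fun_pair.
Qed.

Hypothesis measurable_eq : measurable_fun setT (fun p : T * T => p.1 == p.2).

Lemma measurable_mem_seq (x : X -> T) s : measurable_fun setT x ->
  measurable_fun setT s -> measurable_fun setT (fun a => x a \in s a).
Proof.
move=> mx ms.
rewrite (_ : (fun _ => _) = fun a => ~~ all (fun y => ~~ (x a == y)) (s a)).
  apply: measurable_neg; apply: measurable_seq_all => //; apply: measurable_neg.
  apply: (measurableT_comp measurable_eq (g := fun q : X * T => (x q.1, q.2))).
  by apply: measurable_fun_pair => //; exact: measurableT_comp.
by apply/funext => a; rewrite -has_predC -has_pred1; apply: eq_has => y /=; rewrite negbK eq_sym.
Qed.

End measurable_seq_fun.

Section measurable_uniq_splits.
Context {disp : measure_display} {T : measurableType disp}.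

Lemma measurable_uniq : measurable_fun setT (fun p : T * T => p.1 == p.2) ->
  measurable_fun setT (@uniq T).
Proof.
move=> meq.
(* The recursion of [uniq] inspects the tail itself, so the fold carries the tail along with the
   verdict. *)
have H := @measurable_foldr _ T _ unit _ (bool * seq T)%type
  (fun q : unit * T * (bool * seq T) => ((q.1.2 \notin q.2.2) && q.2.1, q.1.2 :: q.2.2))
  (fun=> (true, [::])).
have E (s : seq T) : foldr (fun y u => ((y \notin u.2) && u.1, y :: u.2)) (true, [::]) s =
    (uniq s, s) by elim: s => //= x s ->.
rewrite (_ : @uniq T = fst \o
    (fun s => foldr (fun y u => ((y \notin u.2) && u.1, y :: u.2)) (true, [::]) s)).
  apply: measurableT_comp => //.
  apply: (measurableT_comp (H _ _) (g := fun s => (tt, s))) => //.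
    apply: measurable_fun_pair; last first.
      by apply: measurable_seq_cons; exact: measurableT_comp.
    apply: measurable_and; last exact: (measurableT_comp measurable_fst).
    by apply: measurable_neg; apply: measurable_mem_seq => //; exact: measurableT_comp.
  exact: measurable_fun_pair.
by apply/funext => s /=; rewrite E.
Qed.

End measurable_uniq_splits.

(** * Poisson measures on finite sequences *)

Section tuple_measure.
Local Open Scope ereal_scope.
Context {disp : measure_display} {T : measurableType disp} {R : realType}.
Variable mu : {sigma_finite_measure set T -> \bar R}.

Definition cons_tuple n (p : T * n.-tuple T) : n.+1.-tuple T := [tuple of p.1 :: p.2].

Lemma measurable_cons_tuple n : measurable_fun setT (@cons_tuple n).
Proof. exact: measurable_cons. Qed.

Lemma behead_cons_tuple n (p : T * n.-tuple T) : [tuple of behead (cons_tuple p)] = p.2.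
Proof. exact: val_inj. Qed.

Lemma measurable_uncons n :
  measurable_fun setT (fun t : n.+1.-tuple T => (thead t, [tuple of behead t])).
Proof.
by apply: measurable_fun_pair; [exact: measurable_thead|exact: measurable_behead].
Qed.

Section cons_measure.
Variables (n : nat) (nu : {sigma_finite_measure set (n.-tuple T) -> \bar R}).

Definition cons_measure := pushforward (mu \x nu) (@cons_tuple n).

Let mcons := @measurable_cons_tuple n.

Let cons_measure0 : cons_measure set0 = 0.
Proof. exact: measure0. Qed.

Let cons_measure_ge0 A : 0 <= cons_measure A.
Proof. exact: measure_ge0. Qed.

Let cons_measure_sigma_additive : semi_sigma_additive cons_measure.
Proof. exact: measure_semi_sigma_additive. Qed.

HB.instance Definition _ := isMeasure.Build _ _ _ cons_measure
  cons_measure0 cons_measure_ge0 cons_measure_sigma_additive.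

Let cons_measure_sigma_finite : sigma_finite setT cons_measure.
Proof.
have /sigma_finiteP[F [FT ndF Foo]] := sigma_finiteT mu.
have /sigma_finiteP[G [GT ndG Goo]] := sigma_finiteT nu.
exists (fun i => (fun t : n.+1.-tuple T => (thead t, [tuple of behead t])) @^-1`
   (F i `*` G i)).
  apply/esym/seteqP; split=> // t _.
  have : [set: T] (thead t) by [].
  have : [set: n.-tuple T] [tuple of behead t] by [].
  rewrite FT GT => -[k _ Gk] [m _ Fm]; exists (maxn m k) => //=; split.
    by apply: (subsetPset _ _ (ndF _ _ (leq_maxl m k))).
  by apply: (subsetPset _ _ (ndG _ _ (leq_maxr m k))).
move=> i; have [mFi Fioo] := Foo i; have [mGi Gioo] := Goo i; split.
  by rewrite -[X in measurable X]setTI; apply: measurable_uncons => //; exact: measurableX.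
rewrite /cons_measure /pushforward (_ : _ @^-1` _ = F i `*` G i).
  by rewrite product_measure1E// lte_mul_pinfty// ge0_fin_numE.
by apply/seteqP; split=> -[x t] /=; rewrite theadE behead_cons_tuple.
Qed.

HB.instance Definition _ := Measure_isSigmaFinite.Build _ _ _ cons_measure
  cons_measure_sigma_finite.

End cons_measure.

(** The recursion of [power_measure] carried out among sigma-finite measures, as Fubini requires. *)
Fixpoint tuple_measure n : {sigma_finite_measure set (n.-tuple T) -> \bar R} :=
  match n with
  | 0 => \d_([tuple] : 0.-tuple T)
  | m.+1 => cons_measure (tuple_measure m)
  end.

Lemma power_measureE n : power_measure mu (n := n) = tuple_measure n.
Proof. by elim: n => //= n ->. Qed.

Lemma integral_tuple_measure0 (f : 0.-tuple T -> \bar R) :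
  (forall t, 0 <= f t) -> measurable_fun setT f ->
  \int[tuple_measure 0]_t f t = f [tuple].
Proof. by move=> f0 mf; rewrite integral_dirac// diracT mul1e. Qed.

Lemma integral_tuple_measureS n (f : n.+1.-tuple T -> \bar R) :
  (forall t, 0 <= f t) -> measurable_fun setT f ->
  \int[tuple_measure n.+1]_t f t =
  \int[mu]_x \int[tuple_measure n]_t f [tuple of x :: t].
Proof.
move=> f0 mf; rewrite ge0_integral_pushforward//=; last exact: measurable_cons_tuple.
rewrite preimage_setT fubini_tonelli1//.
by apply: (measurableT_comp mf); exact: measurable_cons_tuple.
Qed.

End tuple_measure.

(** The set A is arbitrary, because [poisson_law] will be identified as a set function on all sets.
    The comparison is made section by section. *)
Lemma tuple_measure_mrestr disp (T : measurableType disp) (R : realType)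
    (mu nu : {sigma_finite_measure set T -> \bar R}) (D : set T) :
  (forall A, measurable A -> A `<=` D -> nu A = mu A) ->
  forall n (A : set (n.-tuple T)), (forall t, A t -> forall x, x \in t -> D x) ->
  tuple_measure nu n A = tuple_measure mu n A.
Proof.
move=> numu; elim=> [//|n IH] A AD /=.
rewrite /cons_measure /pushforward /product_measure1.
have secE x : ~ D x -> xsection (@cons_tuple _ T n @^-1` A) x = set0.
  move=> Dx; rewrite -subset0 => t /xsectionP /= /AD; apply: contra_not Dx; apply.
  by rewrite inE eqxx.
pose g (m : {sigma_finite_measure set T -> \bar R}) x :=
  tuple_measure m n (xsection (@cons_tuple _ T n @^-1` A) x).
(* Sections over points outside D are empty, so both integrals live on D, where the two measures
   agree. *)
have gE m : g m = (g m) \_ D.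
  apply/funext => x; rewrite /patch; case: ifPn => //.
  by rewrite notin_setE /g => /secE ->; rewrite measure0.
rewrite -/(g nu) -/(g mu).
have -> : g nu = g mu.
  apply/funext => x; rewrite /g; apply: IH => t /xsectionP /= /AD H y yt.
  by apply: H; rewrite inE yt orbT.
rewrite gE -!integral_mkcond.
exact: eq_measure_integral.
Qed.

Section seq_measure.
Local Open Scope ereal_scope.
Context {disp : measure_display} {T : measurableType disp} {R : realType}.
Variables (lambda : {nonneg R}) (mu : {finite_measure set T -> \bar R}).

Definition poisson_weight n : {nonneg R} := ((lambda%:num ^+ n / n`!%:R)%:nng)%R.

Definition seq_level n := pushforward (tuple_measure mu n) (@tval n T).

Let seq_level0 n : seq_level n set0 = 0.
Proof. by have mf := @measurable_tval _ T n; exact: measure0. Qed.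

Let seq_level_ge0 n A : 0 <= seq_level n A.
Proof. by have mf := @measurable_tval _ T n; exact: measure_ge0. Qed.

Let seq_level_sigma_additive n : semi_sigma_additive (seq_level n).
Proof. by have mf := @measurable_tval _ T n; exact: measure_semi_sigma_additive. Qed.

HB.instance Definition _ n := isMeasure.Build _ _ _ (seq_level n)
  (seq_level0 n) (@seq_level_ge0 n) (@seq_level_sigma_additive n).

(* Up to normalisation, the Poisson process with its points listed in random order. *)
Definition seq_measure := mseries (fun n => mscale (poisson_weight n) (seq_level n)) 0.

HB.instance Definition _ := Measure.on seq_measure.

Lemma integral_seq_measure (f : seq T -> \bar R) :
  (forall s, 0 <= f s) -> measurable_fun setT f ->
  \int[seq_measure]_s f s =
  \sum_(n <oo) (poisson_weight n)%:num%:E * \int[tuple_measure mu n]_t f t.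
Proof.
move=> f0 mf; rewrite ge0_integral_measure_series//.
apply: eq_eseriesr => n _; rewrite ge0_integral_mscale//=; congr *%E.
by rewrite ge0_integral_pushforward//; exact: measurable_tval.
Qed.

Lemma seq_measureE (A : set (seq T)) : seq_measure A =
  \sum_(n <oo) (poisson_weight n)%:num%:E * tuple_measure mu n [set t | A (tval t)].
Proof. by []. Qed.

Lemma integral_tuple_measure_prod n (h : T -> R) (I : R) :
  (forall x, 0 <= h x)%R -> measurable_fun setT h -> \int[mu]_x (h x)%:E = I%:E ->
  \int[tuple_measure mu n]_t (\prod_(x <- t) h x)%:E = (I ^+ n)%:E.
Proof.
move=> h0 mh hI.
have mprod m : measurable_fun setT (fun t : m.-tuple T => (\prod_(x <- t) h x)%:E).
  apply/measurable_EFinP.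
  apply: (@measurable_seq_prod _ T _ _ R (fun=> h) (@tval m T)).
    exact: measurableT_comp.
  exact: measurable_tval.
have prod_ge0 m (t : m.-tuple T) : 0 <= (\prod_(x <- t) h x)%:E.
  by rewrite lee_fin prodr_ge0.
elim: n => [|n IH]; first by rewrite integral_tuple_measure0// big_nil expr0.
rewrite integral_tuple_measureS//.
under eq_integral do under eq_integral do rewrite big_cons EFinM.
transitivity (\int[mu]_x ((h x)%:E * (I ^+ n)%:E)).
  apply: eq_integral => x _; rewrite ge0_integralZl ?lee_fin//; last exact: mprod.
  by congr *%E; exact: IH.
rewrite ge0_integralZr//.
- by rewrite hI -EFinM exprS.
- exact/measurable_EFinP.
- by move=> x _; rewrite lee_fin.
- rewrite lee_fin exprn_ge0// -lee_fin -hI integral_ge0// => x _.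
  by rewrite lee_fin.
Qed.

Lemma nneseries_exp (x : R) :
  \sum_(n <oo) ((x ^+ n / n`!%:R)%:E) = (expR x)%:E.
Proof.
rewrite /expR -EFin_lim; last exact: is_cvg_series_exp_coeff.
by apply/congr_lim/funext => n; rewrite /= seriesEnat sumEFin.
Qed.

(** The generating functional of the Poisson process: on length n the product integrates to I^n, and
    the weights turn these powers into an exponential series. This is what integrates out the
    deleted points. *)
Lemma integral_seq_measure_prod (h : T -> R) (I : R) :
  (forall x, 0 <= h x)%R -> measurable_fun setT h -> \int[mu]_x (h x)%:E = I%:E ->
  \int[seq_measure]_s (\prod_(x <- s) h x)%:E = (expR (lambda%:num * I))%:E.
Proof.
move=> h0 mh hI.
rewrite integral_seq_measure//; last 2 first.
- by move=> s; rewrite lee_fin prodr_ge0.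
- apply/measurable_EFinP.
  apply: (@measurable_seq_prod _ T _ _ R (fun=> h) id) => //.
  exact: measurableT_comp.
have I0 : (0 <= I)%R.
  by rewrite -lee_fin -hI integral_ge0// => x _; rewrite lee_fin.
rewrite -nneseries_exp; apply: eq_eseriesr => n _.
by rewrite (integral_tuple_measure_prod n h0 mh hI) -EFinM exprMn mulrAC.
Qed.

Lemma seq_measure_setT : seq_measure setT = (expR (lambda%:num * fine (mu setT)))%:E.
Proof.
rewrite -[LHS]mul1e -integral_cst//.
rewrite -(@integral_seq_measure_prod (fun=> 1%R))//.
  by apply: eq_integral => s _; rewrite big1.
by rewrite integral_cst// mul1e fineK// fin_num_measure.
Qed.

Let seq_measure_fin : fin_num_fun seq_measure.
Proof.
suff : seq_measure setT < +oo by exact: lty_fin_num_fun.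
by rewrite seq_measure_setT ltry.
Qed.

HB.instance Definition _ := @Measure_isFinite.Build _ _ _ seq_measure seq_measure_fin.

End seq_measure.

(** * Splitting a sequence in two *)

Section splits.
Context {T : eqType}.
Implicit Types s u w : seq T.

(** One entry per set of positions, 2^n in all: repeated points are counted separately. *)
Fixpoint splits s : seq (seq T * seq T) :=
  if s is x :: s' then
    [seq (x :: p.1, p.2) | p <- splits s'] ++ [seq (p.1, x :: p.2) | p <- splits s']
  else [:: ([::], [::])].

Fixpoint picks s : seq (T * seq T) :=
  if s is x :: s' then (x, s') :: [seq (p.1, x :: p.2) | p <- picks s'] else [::].

Lemma perm_splits s p : p \in splits s -> perm_eq (p.1 ++ p.2) s.
Proof.
elim: s p => [|x s IH] p /=; first by rewrite inE => /eqP ->.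
rewrite mem_cat => /orP[] /mapP[q /IH qs ->] /=; first by rewrite perm_cons.
by rewrite perm_catC cat_cons perm_cons perm_catC.
Qed.

Lemma splits_subseq s p : p \in splits s -> subseq p.1 s.
Proof.
elim: s p => [|x s IH] p /=; first by rewrite inE => /eqP ->.
rewrite mem_cat => /orP[] /mapP[q /IH qs ->] /=; first by rewrite eqxx.
exact: subseq_trans qs (subseq_cons s x).
Qed.

Lemma filter_in_splits s (P : pred T) :
  ([seq x <- s | P x], [seq x <- s | ~~ P x]) \in splits s.
Proof.
elim: s => [|x s IH] //=; rewrite mem_cat; case: (P x) => /=.
  by apply/orP; left; exact: map_f IH.
by apply/orP; right; exact: map_f IH.
Qed.

(** Splits whose left part contains the head differ from those whose left part does not, since the
    head does not recur in the tail. *)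
Lemma uniq_splits1 s : uniq s -> uniq [seq p.1 | p <- splits s].
Proof.
elim: s => //= x s IH /andP[xs us]; rewrite map_cat -!map_comp.
rewrite (_ : map _ _ = map (cons x) (map fst (splits s))); last by rewrite -map_comp.
rewrite [X in _ ++ X](_ : _ = map fst (splits s)); last exact: eq_map.
rewrite cat_uniq map_inj_uniq ?IH//=; last by move=> ? ? [].
rewrite andbT; apply/hasPn => u /mapP[p /splits_subseq/mem_subseq p1s ->] /=.
apply/mapP => -[w _ E]; move: (p1s x).
by rewrite E inE eqxx (negbTE xs) => /(_ isT).
Qed.

Lemma uniq_splits s : uniq s -> uniq (splits s).
Proof. by move/uniq_splits1/map_uniq. Qed.

Lemma perm_picks s p : p \in picks s -> perm_eq (p.1 :: p.2) s.
Proof.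
elim: s p => [|x s IH] p //=; rewrite inE => /orP[/eqP ->//|/mapP[q /IH qs ->]] /=.
by rewrite (perm_catCA [:: q.1] [:: x] q.2) perm_cons.
Qed.

Lemma map_fst_picks s : [seq p.1 | p <- picks s] = s.
Proof. by elim: s => //= x s IH; rewrite -map_comp IH. Qed.

Lemma picks_nuniq s : ~~ uniq s -> exists2 p, p \in picks s & p.1 \in p.2.
Proof.
elim: s => //= x s IH; rewrite negb_and negbK => /orP[xs|/IH[p ps p12]].
  by exists (x, s); rewrite ?inE ?eqxx.
by exists (p.1, x :: p.2); rewrite inE ?p12 ?orbT//= map_f ?orbT.
Qed.

End splits.

Lemma sum_splits_cons (T : eqType) (V : nmodType) (f : seq T -> seq T -> V) x s :
  \sum_(p <- splits (x :: s)) f p.1 p.2 =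
  \sum_(p <- splits s) f (x :: p.1) p.2 + \sum_(p <- splits s) f p.1 (x :: p.2).
Proof. by rewrite /= big_cat !big_map. Qed.

(** A pick is a split with a single point on the left; this reduces the Mecke formula to
    superposition. *)
Lemma sum_splits_picks (T : eqType) (V : nmodType) (g : T -> seq T -> V) s :
  \sum_(p <- splits s) (if p.1 is [:: x] then g x p.2 else 0) =
  \sum_(p <- picks s) g p.1 p.2.
Proof.
elim: s g => [|x s IH] g; first by rewrite /= big_seq1 big_nil.
(* Exactly one split has an empty left part. The prefix w is there for the induction. *)
have E w s0 (h : seq T -> V) :
    \sum_(p <- splits s0) (if p.1 is [::] then h (w ++ p.2) else 0) = h (w ++ s0).
  elim: s0 w => [|y s0 IHs] w; first by rewrite /= big_seq1.
  rewrite /= big_cat !big_map/= big1// add0r -cat1s catA -IHs.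
  by apply: eq_bigr => p _; rewrite -catA.
rewrite /= big_cons big_cat !big_map/=; congr (_ + _).
  by rewrite -[in RHS](cat0s s) -(E [::]); apply: eq_bigr => -[[|]].
by rewrite -(IH (fun y w => g y (x :: w))).
Qed.

(** The head of a sequence goes to the left part or to the right part: this is Pascal's rule for the
    number of splits with k points on the left. *)
Lemma pascal_sum (V : nmodType) n (B : nat -> V) :
  \sum_(k < n.+1) B k.+1 *+ 'C(n, k) + \sum_(k < n.+1) B k *+ 'C(n, k) =
  \sum_(k < n.+2) B k *+ 'C(n.+1, k).
Proof.
rewrite [RHS]big_ord_recl/= [X in _ + X]big_ord_recl/= !bin0 addrCA; congr (_ + _).
rewrite addrC (_ : \sum_(i < n) _ = \sum_(k < n.+1) B k.+1 *+ 'C(n, k.+1)); last first.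
  by rewrite [RHS]big_ord_recr/= bin_small// mulr0n addr0.
by rewrite -big_split/=; apply: eq_bigr => k _; rewrite binS mulrnDr.
Qed.

Lemma nneseries_diag (R : realType) (c : nat -> nat -> \bar R) :
  (forall k l, 0 <= c k l)%E ->
  (\sum_(n <oo) \sum_(k < n.+1) c k (n - k)%N =
   \sum_(k <oo) \sum_(l <oo) c k l)%E.
Proof.
move=> c0; pose d k n : \bar R := if (k <= n)%N then c k (n - k)%N else 0%E.
have d0 k n : (0 <= d k n)%E by rewrite /d; case: ifPn.
transitivity (\sum_(n <oo) \sum_(k <oo) d k n)%E.
  apply: eq_eseriesr => n _; rewrite (nneseries_split 0 n.+1)// add0n.
  rewrite [X in (_ + X)%E]eseries0 ?adde0 => [|k nk _].
    rewrite big_mkord; apply: eq_bigr => k _; rewrite /d ifT//.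
    by rewrite -ltnS.
  by rewrite /d leqNgt nk.
rewrite nneseries_interchange//; apply: eq_eseriesr => k _.
rewrite (nneseries_split 0 k)// add0n big_mkord big1 ?add0e => [|i _].
  rewrite -nneseries_addn//; apply: eq_eseriesr => l _.
  by rewrite /d leq_addl addnK.
by rewrite /d leqNgt ltn_ord.
Qed.

Section measurable_splits.
Context {disp : measure_display} {T : measurableType disp} {R : realType}.

Lemma measurable_sum_splits d' (X : measurableType d')
    (f : X * (seq T * seq T) -> \bar R) :
  measurable_fun setT f ->
  measurable_fun setT (fun q : X * seq T => \sum_(p <- splits q.2) f (q.1, p))%E.
Proof.
move=> mf; apply: measurable_fun_seq => n.
(* The parameter space is generalised because the head of the tuple is moved into it at each
   step. *)
elim: n d' X f mf => [|n IH] d' X f mf.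
  rewrite (_ : (fun _ => _) = fun q => f (q.1, ([::], [::]))).
    by apply: (measurableT_comp mf); exact: measurable_fun_pair.
  by apply/funext => -[x t]; rewrite (tuple0 t)/= big_seq1.
rewrite (_ : (fun _ => _) = fun q : X * n.+1.-tuple T =>
    \sum_(p <- splits [tuple of behead q.2]) f (q.1, (thead q.2 :: p.1, p.2)) +
    \sum_(p <- splits [tuple of behead q.2]) f (q.1, (p.1, thead q.2 :: p.2)))%E; last first.
  apply/funext => -[x t]; rewrite [in LHS](tuple_eta t) /=.
  by rewrite big_cat !big_map/=.
have mbeh : measurable_fun setT (fun q : X * n.+1.-tuple T =>
    ((q.1, thead q.2), [tuple of behead q.2])).
  apply: measurable_fun_pair.
    by apply: measurable_fun_pair => //; exact: (measurableT_comp (@measurable_thead _ T n)).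
  exact: (measurableT_comp (@measurable_behead _ T n)).
apply: emeasurable_funD.
  have H := IH _ (X * T)%type (fun q => f (q.1.1, (q.1.2 :: q.2.1, q.2.2))).
  apply: (measurableT_comp (H _) mbeh); apply: (measurableT_comp mf).
  apply: measurable_fun_pair; first exact: measurableT_comp.
  apply: measurable_fun_pair; last exact: measurableT_comp.
  by apply: measurable_seq_cons; exact: measurableT_comp.
have H := IH _ (X * T)%type (fun q => f (q.1.1, (q.2.1, q.1.2 :: q.2.2))).
apply: (measurableT_comp (H _) mbeh); apply: (measurableT_comp mf).
apply: measurable_fun_pair; first exact: measurableT_comp.
apply: measurable_fun_pair; first exact: measurableT_comp.
by apply: measurable_seq_cons; exact: measurableT_comp.
Qed.

End measurable_splits.

Lemma poisson_weight_bin (R : realType) (lambda : {nonneg R}) n k : (k <= n)%N ->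
  (poisson_weight lambda n)%:num * 'C(n, k)%:R =
  (poisson_weight lambda k)%:num * (poisson_weight lambda (n - k))%:num.
Proof.
move=> kn /=; rewrite -(bin_fact kn) !natrM -{1}(subnKC kn) exprD.
have fn0 m : m`!%:R != 0 :> R by rewrite pnatr_eq0 -lt0n fact_gt0.
have : 'C(n, k)%:R != 0 :> R by rewrite pnatr_eq0 -lt0n bin_gt0.
move: (fn0 k) (fn0 (n - k)%N) => a b c.
by field; rewrite a b c.
Qed.

(** * Superposition of two independent Poisson processes *)

Section superposition.
Local Open Scope ereal_scope.
Context {disp : measure_display} {T : measurableType disp} {R : realType}.
Variables (lambda : {nonneg R}) (mu : {finite_measure set T -> \bar R}).
Implicit Type f : seq T * seq T -> \bar R.

Let pair_integral f k l := \int[tuple_measure mu k]_u \int[tuple_measure mu l]_w f (tval u, tval w).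

Let measurable_pair_tval f k l : measurable_fun setT f ->
  measurable_fun setT (fun q : k.-tuple T * l.-tuple T => f (tval q.1, tval q.2)).
Proof.
move=> mf; apply: (measurableT_comp mf); apply: measurable_fun_pair.
  exact: (measurableT_comp (@measurable_tval _ T k)).
exact: (measurableT_comp (@measurable_tval _ T l)).
Qed.

Let measurable_inner f k l : (forall q, 0 <= f q) -> measurable_fun setT f ->
  measurable_fun setT (fun u : k.-tuple T => \int[tuple_measure mu l]_w f (tval u, tval w)).
Proof.
move=> f0 mf.
have H := @measurable_fun_fubini_tonelli_F _ _ (k.-tuple T) (l.-tuple T) R
  (tuple_measure mu l) _ (@measurable_pair_tval f k l mf).
by apply: H => -[u w].
Qed.

Let measurable_consl f x : measurable_fun setT f ->
  measurable_fun setT (fun p => f (x :: p.1, p.2)).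
Proof.
move=> mf; apply: (measurableT_comp mf); apply: measurable_fun_pair => //.
exact: measurable_seq_cons.
Qed.

Let measurable_consr f x : measurable_fun setT f ->
  measurable_fun setT (fun p => f (p.1, x :: p.2)).
Proof.
move=> mf; apply: (measurableT_comp mf); apply: measurable_fun_pair => //.
exact: measurable_seq_cons.
Qed.

Let sum_splits_ge0 f s : (forall q, 0 <= f q) -> 0 <= \sum_(p <- splits s) f p.
Proof. by move=> f0; rewrite sume_ge0. Qed.

Let measurable_splits_tuple f n : measurable_fun setT f ->
  measurable_fun setT (fun t : n.-tuple T => \sum_(p <- splits t) f p).
Proof.
move=> mf.
have H := @measurable_sum_splits _ T R _ unit (fun q => f q.2) _.
apply: (measurableT_comp (H _) (g := fun t : n.-tuple T => (tt, tval t))).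
  exact: measurableT_comp.
by apply: measurable_fun_pair => //; exact: measurable_tval.
Qed.

(** By exchangeability of the coordinates, all splits with k points on the left have the same
    integral. *)
Lemma integral_tuple_splits n f : (forall q, 0 <= f q) -> measurable_fun setT f ->
  \int[tuple_measure mu n]_t (\sum_(p <- splits t) f p) =
  \sum_(k < n.+1) pair_integral f k (n - k) *+ 'C(n, k).
Proof.
elim: n f => [|n IH] f f0 mf.
  rewrite integral_tuple_measure0 => [|t|]; last 2 first.
  - exact: sum_splits_ge0.
  - exact: measurable_splits_tuple.
  rewrite /= big_seq1 big_ord1 bin0 /pair_integral integral_tuple_measure0.
  - rewrite integral_tuple_measure0//.
    apply: (measurableT_comp mf); apply: measurable_fun_pair => //.
    exact: measurable_tval.
  - by move=> u; apply: integral_ge0.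
  - exact: measurable_inner.
rewrite integral_tuple_measureS; last 2 first.
- by move=> t; exact: sum_splits_ge0.
- exact: measurable_splits_tuple.
pose fl x p := f (x :: p.1, p.2); pose fr x p := f (p.1, x :: p.2).
transitivity (\int[mu]_x (\sum_(k < n.+1) pair_integral (fl x) k (n - k) *+ 'C(n, k) +
                          \sum_(k < n.+1) pair_integral (fr x) k (n - k) *+ 'C(n, k))).
  apply: eq_integral => x _.
  under eq_integral do rewrite /= big_cat !big_map/=.
  rewrite ge0_integralD//=; last 4 first.
  - by move=> t _; apply: sum_splits_ge0 => -[u w]; exact: f0.
  - by apply: measurable_splits_tuple; exact: measurable_consl.
  - by move=> t _; apply: sum_splits_ge0 => -[u w]; exact: f0.
  - by apply: measurable_splits_tuple; exact: measurable_consr.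
  have mfl : measurable_fun setT (fl x) by exact: measurable_consl.
  have mfr : measurable_fun setT (fr x) by exact: measurable_consr.
  by rewrite -(IH _ _ mfl) -?(IH _ _ mfr)// => q; exact: f0.
have mconsl k l : measurable_fun setT (fun q : (T * k.-tuple T) * l.-tuple T =>
    f (q.1.1 :: tval q.1.2, tval q.2)).
  apply: (measurableT_comp mf); apply: measurable_fun_pair.
    apply: measurable_seq_cons; first exact: measurableT_comp.
    by apply: (measurableT_comp (@measurable_tval _ T k)); exact: measurableT_comp.
  exact: (measurableT_comp (@measurable_tval _ T l)).
have mconsr k l : measurable_fun setT (fun q : (T * k.-tuple T) * l.-tuple T =>
    f (tval q.1.2, q.1.1 :: tval q.2)).
  apply: (measurableT_comp mf); apply: measurable_fun_pair.
    by apply: (measurableT_comp (@measurable_tval _ T k)); exact: measurableT_comp.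
  apply: measurable_seq_cons; first exact: measurableT_comp.
  exact: (measurableT_comp (@measurable_tval _ T l)).
have mIl k l : measurable_fun setT (fun q : T * k.-tuple T =>
    \int[tuple_measure mu l]_w f (q.1 :: tval q.2, tval w)).
  by apply: (@measurable_fun_fubini_tonelli_F _ _ _ _ _ (tuple_measure mu l) _ (mconsl k l)).
have mIr k l : measurable_fun setT (fun q : T * k.-tuple T =>
    \int[tuple_measure mu l]_w f (tval q.2, q.1 :: tval w)).
  by apply: (@measurable_fun_fubini_tonelli_F _ _ _ _ _ (tuple_measure mu l) _ (mconsr k l)).
have mJl k l : measurable_fun setT (fun x => pair_integral (fl x) k l).
  have H := @measurable_fun_fubini_tonelli_F _ _ _ _ _ (tuple_measure mu k) _ (mIl k l).
  by apply: H => q; exact: integral_ge0.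
have mJr k l : measurable_fun setT (fun x => pair_integral (fr x) k l).
  have H := @measurable_fun_fubini_tonelli_F _ _ _ _ _ (tuple_measure mu k) _ (mIr k l).
  by apply: H => q; exact: integral_ge0.
have J0 g k l : (forall q, 0 <= g q) -> 0 <= pair_integral g k l.
  by move=> g0; apply: integral_ge0 => u _; exact: integral_ge0.
have mmuln (g : T -> \bar R) m : measurable_fun setT g ->
    measurable_fun setT (fun x => g x *+ m).
  move=> mg; rewrite (_ : (fun _ => _) = fun x => m%:R%:E * g x).
    exact: measurable_funeM.
  by apply/funext => x; rewrite muleC -mule_natr.
have intmuln (g : T -> \bar R) m : (forall x, 0 <= g x) -> measurable_fun setT g ->
    \int[mu]_x (g x *+ m) = (\int[mu]_x g x) *+ m.
  move=> g0 mg; under eq_integral do rewrite -mule_natr.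
  by rewrite ge0_integralZr// mule_natr.
have intsum (g : T -> nat -> \bar R) : (forall x k, 0 <= g x k) ->
    (forall k, measurable_fun setT (g ^~ k)) ->
    \int[mu]_x (\sum_(k < n.+1) g x k *+ 'C(n, k)) =
    \sum_(k < n.+1) (\int[mu]_x g x k) *+ 'C(n, k).
  move=> g0 mg; rewrite ge0_integral_sum//.
  - by apply: eq_bigr => k _; exact: intmuln.
  - by move=> k; exact: mmuln.
  - by move=> k x _; rewrite -mule_natr mule_ge0.
rewrite ge0_integralD//; last 4 first.
- move=> x _; apply: sume_ge0 => k _; rewrite -mule_natr mule_ge0// J0// => q.
  exact: f0.
- by apply: emeasurable_sum => k; exact: mmuln.
- move=> x _; apply: sume_ge0 => k _; rewrite -mule_natr mule_ge0// J0// => q.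
  exact: f0.
- by apply: emeasurable_sum => k; exact: mmuln.
rewrite (intsum (fun x k => pair_integral (fl x) k (n - k)%N))//; last first.
  by move=> x k; apply: J0 => q; exact: f0.
rewrite (intsum (fun x k => pair_integral (fr x) k (n - k)%N))//; last first.
  by move=> x k; apply: J0 => q; exact: f0.
rewrite -(pascal_sum n (fun k => pair_integral f k (n.+1 - k)%N)); congr (_ + _).
  apply: eq_bigr => k _; congr (_ *+ _); rewrite subSS /pair_integral.
  rewrite [in RHS]integral_tuple_measureS//.
  - by move=> u; exact: integral_ge0.
  - exact: measurable_inner.
apply: eq_bigr => k _; congr (_ *+ _); rewrite subSn -1?ltnS// /pair_integral.
(* Here the head joins the right part, so its integral has to be moved inside that over the left
   part. *)
rewrite (fubini_tonelli (m1 := mu) (m2 := tuple_measure mu k) _ (mIr k (n - k)%N))/=; last first.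
  by move=> q; exact: integral_ge0.
apply: eq_integral => u _; rewrite [in RHS]integral_tuple_measureS//.
apply: (measurableT_comp mf); apply: measurable_fun_pair => //.
exact: measurable_tval.
Qed.

Local Notation Lam := (seq_measure lambda mu).

Let measurable_fun1 f u : measurable_fun setT f -> measurable_fun setT (fun w => f (u, w)).
Proof. by move=> mf; apply: (measurableT_comp mf); exact: measurable_fun_pair. Qed.

(* A Poisson process cut in two at random is a pair of independent Poisson processes. *)
Lemma superposition f : (forall q, 0 <= f q) -> measurable_fun setT f ->
  \int[Lam]_s (\sum_(p <- splits s) f p) = \int[Lam]_u \int[Lam]_w f (u, w).
Proof.
move=> f0 mf; rewrite [LHS]integral_seq_measure; last 2 first.
- by move=> s; exact: sum_splits_ge0.
- have H := @measurable_sum_splits _ T R _ unit (fun q => f q.2) _.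
  apply: (measurableT_comp (H _) (g := fun t : seq T => (tt, t))).
    exact: measurableT_comp.
  exact: measurable_fun_pair.
under eq_eseriesr do rewrite integral_tuple_splits//.
have J0 k l : 0 <= pair_integral f k l.
  by apply: integral_ge0 => u _; exact: integral_ge0.
pose w n : \bar R := (poisson_weight lambda n)%:num%:E.
have w0 n : 0 <= w n by rewrite lee_fin.
transitivity (\sum_(n <oo) \sum_(k < n.+1) (w k * (w (n - k)%N * pair_integral f k (n - k)))).
  apply: eq_eseriesr => n _; rewrite ge0_sume_distrr; last first.
    by move=> k _; rewrite -mule_natr mule_ge0// lee_fin.
  apply: eq_bigr => k _; rewrite -mule_natr [X in _ * X]muleC !muleA.
  congr (_ * _); rewrite /w -!EFinM; congr EFin => /=.
  by rewrite poisson_weight_bin// -ltnS.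
(* The binomial coefficient has split the weight of n into those of k and n - k, leaving a Cauchy
   product. *)
rewrite (nneseries_diag (c := fun k l => w k * (w l * pair_integral f k l))); last first.
  by move=> k l; rewrite mule_ge0 ?mule_ge0.
rewrite integral_seq_measure; last 2 first.
- by move=> u; exact: integral_ge0.
- by apply: (@measurable_fun_fubini_tonelli_F _ _ _ _ _ Lam _ mf).
apply: eq_eseriesr => k _; rewrite nneseriesZl//; last first.
  by move=> l _; apply: mule_ge0; [exact: w0|exact: J0].
congr *%E.
transitivity (\int[tuple_measure mu k]_u
    \sum_(l <oo) w l * \int[tuple_measure mu l]_t f (tval u, tval t)); last first.
  apply: eq_integral => u _; rewrite integral_seq_measure//.
  exact: measurable_fun1.
rewrite integral_nneseries//.
- apply: eq_eseriesr => l _; rewrite ge0_integralZl//.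
  + exact: measurable_inner.
  + by move=> u _; exact: integral_ge0.
- by move=> l; apply: measurable_funeM; exact: measurable_inner.
- by move=> l u _; apply: mule_ge0; [exact: w0|exact: integral_ge0].
Qed.

End superposition.

(** * The Mecke formula and null events *)

Section mecke.
Local Open Scope ereal_scope.
Context {disp : measure_display} {T : measurableType disp} {R : realType}.
Variables (lambda : {nonneg R}) (mu : {finite_measure set T -> \bar R}).
Local Notation Lam := (seq_measure lambda mu).

Lemma measurable_head x0 : measurable_fun setT (@head T x0).
Proof.
have H : measurable_fun setT (fun p : unit * seq T => head x0 p.2).
  apply: measurable_fun_seq => -[|n].
    rewrite (_ : (fun _ => _) = cst x0)//.
    by apply/funext => -[u t]; rewrite (tuple0 t).
  rewrite (_ : (fun _ => _) = fun p : unit * n.+1.-tuple T => thead p.2).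
    exact: (measurableT_comp (@measurable_thead _ T n)).
  by apply/funext => -[u t]; rewrite [in LHS](tuple_eta t).
apply: (measurableT_comp H (g := fun t : seq T => (tt, t))).
exact: measurable_fun_pair.
Qed.

Lemma measurable_if_seq1 d' (X : measurableType d') (s : X -> seq T)
    (g : X * T -> \bar R) : measurable_fun setT s -> measurable_fun setT g ->
  measurable_fun setT (fun a => if s a is [:: x] then g (a, x) else 0).
Proof.
move=> ms mg.
rewrite (_ : (fun _ => _) = fun a =>
    if size (s a) == 1%N then g (a, head point (s a)) else 0).
  apply: measurable_fun_ifT => //.
    apply: (measurableT_comp (f := fun n : nat => n == 1%N)) => //.
    exact: (measurableT_comp (@measurable_size _ T)).
  apply: (measurableT_comp mg); apply: measurable_fun_pair => //.
  exact: (measurableT_comp (@measurable_head point)).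
by apply/funext => a; case: (s a) => [|x [|]].
Qed.

Lemma integral_seq_measure1 (h : T -> \bar R) :
  (forall x, 0 <= h x) -> measurable_fun setT h ->
  \int[Lam]_u (if u is [:: x] then h x else 0) = lambda%:num%:E * \int[mu]_x h x.
Proof.
move=> h0 mh.
have mf : measurable_fun setT (fun u : seq T => if u is [:: x] then h x else 0).
  apply: (@measurable_if_seq1 _ (seq T) id (h \o snd)) => //.
  exact: measurableT_comp.
have f0 (u : seq T) : 0 <= if u is [:: x] then h x else 0.
  by case: u => [|x [|]].
rewrite integral_seq_measure// (nneseries_split 0 2)//; last first.
  by move=> k _; rewrite mule_ge0 ?lee_fin// integral_ge0.
rewrite add0n [X in _ + X]eseries0 ?adde0; last first.
  move=> [|[|k]]// _ _; rewrite integral0_eq ?mule0// => t _.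
  by case: t => -[|a [|b s]].
have mfn n : measurable_fun setT (fun t : n.-tuple T =>
    if tval t is [:: x] then h x else 0).
  exact: (measurableT_comp mf (@measurable_tval _ T n)).
rewrite big_mkord big_ord_recr big_ord1 integral_tuple_measure0 ?mule0 ?add0e//.
rewrite [LHS]add0e [X in X%:E * _]/= expr1 divr1; congr *%E; rewrite integral_tuple_measureS//.
apply: eq_integral => x _; rewrite integral_tuple_measure0//.
  by move=> t; case: (tval t).
by rewrite (_ : (fun _ => _) = cst (h x))//; apply/funext => -[[]].
Qed.

Lemma measurable_sum_picks (g : T * seq T -> \bar R) : measurable_fun setT g ->
  measurable_fun setT (fun s => \sum_(p <- picks s) g p).
Proof.
move=> mg; rewrite (_ : (fun _ => _) = fun s : seq T =>
    \sum_(p <- splits s) (if p.1 is [:: x] then g (x, p.2) else 0)); last first.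
  apply/funext => s; rewrite (sum_splits_picks (fun x w => g (x, w))).
  by apply: eq_bigr => -[].
have H := @measurable_sum_splits _ T R _ unit
  (fun q => if q.2.1 is [:: x] then g (x, q.2.2) else 0) _.
apply: (measurableT_comp (H _) (g := fun t : seq T => (tt, t))); last first.
  exact: measurable_fun_pair.
apply: (@measurable_if_seq1 _ (unit * (seq T * seq T))%type (fun q => q.2.1)
  (fun q => g (q.2, q.1.2.2))).
  exact: measurableT_comp.
apply: (measurableT_comp mg); apply: measurable_fun_pair => //.
exact: (measurableT_comp measurable_snd (measurableT_comp measurable_snd measurable_fst)).
Qed.

(** Superposition applied to a function that vanishes unless the left part is a single point; on the
    left only length 1 survives, with weight lambda. *)
Lemma mecke (g : T * seq T -> \bar R) : (forall q, 0 <= g q) ->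
  measurable_fun setT g ->
  \int[Lam]_s (\sum_(p <- picks s) g p) =
  lambda%:num%:E * \int[mu]_x \int[Lam]_w g (x, w).
Proof.
move=> g0 mg.
pose f (q : seq T * seq T) := if q.1 is [:: x] then g (x, q.2) else 0.
have f0 q : 0 <= f q by rewrite /f; case: q.1 => [|x [|y u]].
have mf : measurable_fun setT f.
  apply: (@measurable_if_seq1 _ (seq T * seq T)%type fst (fun q => g (q.2, q.1.2))) => //.
  apply: (measurableT_comp mg); apply: measurable_fun_pair => //.
  exact: measurableT_comp.
have mh : measurable_fun setT (fun x => \int[Lam]_w g (x, w)).
  by apply: (@measurable_fun_fubini_tonelli_F _ _ _ _ _ Lam _ mg).
transitivity (\int[Lam]_s (\sum_(p <- splits s) f p)).
  apply: eq_integral => s _.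
  transitivity (\sum_(p <- picks s) g (p.1, p.2)); first by apply: eq_bigr => -[].
  exact/esym/(sum_splits_picks (fun x w => g (x, w))).
rewrite superposition// -integral_seq_measure1//; last first.
  by move=> x; exact: integral_ge0.
by apply: eq_integral => -[|x [|y s]] _ //=; rewrite integral0_eq.
Qed.

Hypothesis measurable_eq : measurable_fun setT (fun p : T * T => p.1 == p.2).
Hypothesis mu_atomless : forall x, mu [set x] = 0.

Lemma measurable_mem_cst (s : seq T) : measurable [set x | x \in s].
Proof. by apply: measurable_bool_set; exact: measurable_mem_seq. Qed.

Lemma mu_mem_seq (s : seq T) : mu [set x | x \in s] = 0.
Proof.
elim: s => [|x s IH].
  by rewrite (_ : [set _ | _] = set0)//; apply/seteqP; split.
apply/eqP; rewrite eq_le measure_ge0 andbT.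
rewrite (_ : [set _ | _] = [set x] `|` [set x | x \in s]); last first.
  by apply/seteqP; split=> y /=; rewrite inE => /predU1P.
have mx : measurable [set x].
  rewrite (_ : [set x] = [set y | y \in [:: x]]); first exact: measurable_mem_cst.
  by apply/seteqP; split=> y /=; rewrite inE => /eqP.
apply: le_trans (measureU2 _ mx (measurable_mem_cst s)) _.
by rewrite [X in X + _](_ : _ = 0) ?[X in _ + X](_ : _ = 0) ?adde0//; exact: mu_atomless.
Qed.

(** A first-moment bound: the indicator is at most the number of picks whose point recurs in the
    rest. By Mecke and Fubini its integral involves only the mu-mass of finite sets, which is
    zero. *)
Lemma seq_measure_not_uniq : Lam [set s | ~~ uniq s] = 0.
Proof.
have mN : measurable [set s : seq T | ~~ uniq s].
  by apply: measurable_bool_set; apply: measurable_neg; exact: (measurable_uniq measurable_eq).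
pose g (q : T * seq T) := ((q.1 \in q.2)%:R : R)%:E.
have mg : measurable_fun setT g.
  by apply: measurable_b2e; exact: measurable_mem_seq.
have g0 q : 0 <= g q by rewrite lee_fin.
apply/eqP; rewrite eq_le measure_ge0 andbT.
rewrite (_ : Lam _ = \int[Lam]_s (\1_[set s | ~~ uniq s] s)%:E); last by rewrite integral_indic// setIT.
apply: (@le_trans _ _ (\int[Lam]_s (\sum_(p <- picks s) g p))).
  apply: ge0_le_integral => //.
  - exact/measurable_EFinP.
  - exact: measurable_sum_picks.
  - move=> s _; rewrite indicE; case: (boolP (s \in _)) => [|_]; last exact: sume_ge0.
    rewrite inE /= => /picks_nuniq[p ps p12].
    rewrite (big_rem p)//= /g p12 -[leLHS]adde0 leeD//.
    exact: sume_ge0.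
rewrite mecke// [X in _ * X](_ : _ = 0) ?mule0//.
rewrite (fubini_tonelli (m1 := mu) (m2 := Lam) g)// integral0_eq// => w _.
rewrite /fubini_G (_ : (fun _ => _) = EFin \o \1_[set x | x \in w]).
  rewrite integral_indic//; last exact: measurable_mem_cst.
  by rewrite setIT; exact: mu_mem_seq.
by apply/funext => x; rewrite /g /= indicE; congr ((nat_of_bool _)%:R)%:E; apply/idP/idP; rewrite inE.
Qed.

(** The same first-moment bound, counting the points that violate P. *)
Lemma seq_measure_not_all (P : T -> bool) : measurable_fun setT P ->
  mu [set x | ~~ P x] = 0 -> Lam [set s | ~~ all P s] = 0.
Proof.
move=> mP P0.
have mall : measurable_fun setT (all P).
  apply: (@measurable_seq_all _ T _ (seq T) (fun=> P) id) => //.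
  exact: measurableT_comp.
have mN : measurable [set s : seq T | ~~ all P s].
  by apply: measurable_bool_set; apply: measurable_neg; exact: mall.
pose g (q : T * seq T) := ((~~ P q.1)%:R : R)%:E.
have mg : measurable_fun setT g.
  apply: measurable_b2e; apply: measurable_neg; exact: measurableT_comp.
have g0 q : 0 <= g q by rewrite lee_fin.
apply/eqP; rewrite eq_le measure_ge0 andbT.
rewrite (_ : Lam _ = \int[Lam]_s (\1_[set s | ~~ all P s] s)%:E); last by rewrite integral_indic// setIT.
apply: (@le_trans _ _ (\int[Lam]_s (\sum_(p <- picks s) g p))).
  apply: ge0_le_integral => //.
  - exact/measurable_EFinP.
  - exact: measurable_sum_picks.
  - move=> s _; rewrite indicE; case: (boolP (s \in _)) => [|_]; last exact: sume_ge0.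
    rewrite inE /= => /allPn[x xs Px].
    move: xs; rewrite -{1}(map_fst_picks s) => /mapP[p ps E].
    rewrite (big_rem p)//= /g -E Px -[leLHS]adde0 leeD//.
    exact: sume_ge0.
rewrite mecke// [X in _ * X](_ : _ = 0) ?mule0//.
rewrite (fubini_tonelli (m1 := mu) (m2 := Lam) g)// integral0_eq// => w _.
have mNP : measurable [set x | ~~ P x].
  by apply: measurable_bool_set; apply: measurable_neg; exact: mP.
rewrite (_ : (fun _ => _) = EFin \o \1_[set x | ~~ P x]).
  by rewrite integral_indic// setIT; exact: P0.
by apply/funext => x; rewrite /g /= indicE; congr ((nat_of_bool _)%:R)%:E; apply/idP/idP; rewrite inE.
Qed.

Lemma seq_measure_ae_eq (P : T -> bool) (f g : seq T -> \bar R) :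
  measurable_fun setT P -> mu [set x | ~~ P x] = 0 ->
  (forall s, 0 <= f s) -> (forall s, 0 <= g s) ->
  measurable_fun setT f -> measurable_fun setT g ->
  (forall s, uniq s -> all P s -> f s = g s) ->
  \int[Lam]_s f s = \int[Lam]_s g s.
Proof.
move=> mP P0 f0 g0 mf mg fg.
have mall : measurable_fun setT (all P).
  apply: (@measurable_seq_all _ T _ (seq T) (fun=> P) id) => //.
  exact: measurableT_comp.
have mA : measurable [set s : seq T | ~~ all P s].
  by apply: measurable_bool_set; apply: measurable_neg; exact: mall.
have mU : measurable [set s : seq T | ~~ uniq s].
  by apply: measurable_bool_set; apply: measurable_neg; exact: (measurable_uniq measurable_eq).
apply: ge0_ae_eq_integral => //.
exists ([set s | ~~ all P s] `|` [set s | ~~ uniq s]); split.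
- exact: measurableU.
- apply/eqP; rewrite eq_le measure_ge0 andbT.
  apply: le_trans (measureU2 _ mA mU) _.
  by rewrite [X in X + _]seq_measure_not_all// [X in _ + X]seq_measure_not_uniq adde0.
- move=> s /= /not_implyP[_ fgs]; apply: contrapT => /not_orP[/negP + /negP].
  by rewrite !negbK => alls us; apply: fgs; exact: fg.
Qed.

End mecke.

(** * Euclidean space *)

Lemma tuple_measure_box disp (T : measurableType disp) (R : realType)
    (mu : {sigma_finite_measure set T -> \bar R}) (A : set T) n :
  measurable A -> (mu A < +oo)%E ->
  (tuple_measure mu n [set t : n.-tuple T | forall x, x \in (t : seq T) -> A x] < +oo)%E.
Proof.
move=> mA Aoo; set box := fun n => [set t : n.-tuple T | forall x, x \in (t : seq T) -> A x].
suff : measurable (box n) /\ (tuple_measure mu n (box n) < +oo)%E by case.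
elim: n => [|n [mbox IH]].
  rewrite (_ : box 0%N = setT); first by split=> //=; rewrite diracT ltry.
  by apply/seteqP; split=> // t _ x; rewrite (tuple0 t).
have E : box n.+1 = (fun t => (thead t, [tuple of behead t])) @^-1` (A `*` box n).
  apply/seteqP; split=> [t bt|t [At bt]] /=.
    split; first by apply: bt; exact: mem_tnth.
    by move=> x xt; apply: bt; exact: mem_behead.
  by move=> x; rewrite {1}(tuple_eta t) inE => /predU1P[->//|]; exact: bt.
split.
  rewrite E -[X in measurable X]setTI.
  by apply: measurable_uncons => //; exact: measurableX.
rewrite /= /cons_measure /pushforward.
rewrite (_ : _ @^-1` _ = A `*` box n); last first.
  by rewrite E; apply/seteqP; split=> -[x t] /=; rewrite theadE behead_cons_tuple.
by rewrite product_measure1E// lte_mul_pinfty// ge0_fin_numE.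
Qed.

Section euclidean.
Context {R : realType} {d : nat}.
Local Notation E := (d.-tuple R).
Implicit Types (x y : E) (B : set E).

Lemma measurable_tuple_eq : measurable_fun setT (fun p : E * E => p.1 == p.2).
Proof.
rewrite (_ : (fun _ => _) = fun p => all (fun i => tnth p.1 i == tnth p.2 i) (enum 'I_d)).
  elim: (enum 'I_d) => [|i s IH]; first exact: measurable_cst.
  apply: measurable_and => //; apply: measurable_fun_eqr.
    by apply: (measurableT_comp (@measurable_tnth _ R d i)).
  by apply: (measurableT_comp (@measurable_tnth _ R d i)).
apply/funext => -[x y] /=; apply/eqP/allP => [->//|H].
by apply: eq_from_tnth => i; apply/eqP/H; rewrite mem_enum.
Qed.

Lemma measurable_dist : measurable_fun setT (fun p : E * E => dist p.1 p.2).
Proof.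
apply: measurableT_comp.
  by apply: continuous_measurable_fun; exact: sqrt_continuous.
apply: measurable_sum => i.
apply: measurable_funX; apply: measurable_funB.
  exact: (measurableT_comp (@measurable_tnth _ R d i)).
exact: (measurableT_comp (@measurable_tnth _ R d i)).
Qed.

Lemma dist_ge_coord x y i : `|tnth x i - tnth y i| <= dist x y.
Proof.
rewrite -sqrtr_sqr ler_wsqrtr// (bigD1 i)//= lerDl.
by rewrite sumr_ge0// => j _; rewrite sqr_ge0.
Qed.

(* [lebesgue] is a measure for the product of the sigma-algebra of
   [measurableTypeR R], whose display differs from that of the canonical
   structure on [R]: it has to be repackaged. *)
Definition volume : set E -> \bar R := tuple_measure (@lebesgue_measure R) d.

Let volume0 : volume set0 = 0%E.
Proof. exact: (measure0 (tuple_measure (@lebesgue_measure R) d)). Qed.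

Let volume_ge0 A : (0 <= volume A)%E.
Proof. exact: (measure_ge0 (tuple_measure (@lebesgue_measure R) d)). Qed.

Let volume_sigma_additive : semi_sigma_additive volume.
Proof.
exact: (@measure_semi_sigma_additive _ _ _ (tuple_measure (@lebesgue_measure R) d)).
Qed.

HB.instance Definition _ := isMeasure.Build _ _ _ volume
  volume0 volume_ge0 volume_sigma_additive.

Let volume_sigma_finite : sigma_finite setT volume.
Proof. exact: (sigma_finiteT (tuple_measure (@lebesgue_measure R) d)). Qed.

HB.instance Definition _ := Measure_isSigmaFinite.Build _ _ _ volume volume_sigma_finite.

Lemma lebesgueE : @lebesgue R d = volume.
Proof. by rewrite /lebesgue power_measureE. Qed.

Lemma lebesgue_bounded B : measurable B -> bounded B -> (lebesgue B < +oo)%E.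
Proof.
move=> mB [x [M xM]]; rewrite lebesgueE.
(* A coordinate of a point of B is at most [|tnth x i| + M] in absolute value; the sum makes the
   bound uniform in i. *)
pose K := M + \sum_i `|tnth x i|.
pose A : set R := `[- K, K]%classic.
have mA : measurable A by exact: measurable_itv.
have Aoo : (lebesgue_measure A < +oo)%E.
  by rewrite /A lebesgue_measure_itv/=; case: ifPn => _; rewrite -?EFinB ltry.
have mbox : measurable [set t : E | forall z, z \in (t : seq R) -> A z].
  rewrite (_ : [set _ | _] = [set t : E | all (fun z => z \in A) t]).
    apply: measurable_bool_set.
    apply: (@measurable_seq_all _ R _ E (fun _ z => z \in A) (@tval d R)).
      by apply: measurableT_comp => //; exact/measurable_setP.
    exact: measurable_tval.
  apply/seteqP; split=> t /= H; first by apply/allP => z /H/mem_set.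
  by move=> z zt; apply/set_mem; exact: (allP H).
apply: (@le_lt_trans _ _ (volume [set t : E | forall z, z \in (t : seq R) -> A z])).
  2: exact: (@tuple_measure_box _ (measurableTypeR R) R (@lebesgue_measure R) A d mA Aoo).
apply: le_measure; rewrite ?inE// => y /xM xy z /tnthP[i ->].
have := le_trans (dist_ge_coord x y i) xy.
have : `|tnth x i| <= \sum_j `|tnth x j|.
  by rewrite (bigD1 i)//= lerDl sumr_ge0.
rewrite /A /= in_itv/= /K !ler_norml => /andP[a b] /andP[e f].
by apply/andP; split; lra.
Qed.

Lemma volume_set1 x : (0 < d)%N -> volume [set x] = 0%E.
Proof.
rewrite /volume; case: d x => // n x _.
rewrite /= /cons_measure /pushforward.
rewrite (_ : _ @^-1` _ = [set thead x] `*` [set [tuple of behead x]]); last first.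
  apply/seteqP; split=> -[y t] /=.
    by move=> <-; rewrite theadE behead_cons_tuple.
  by move=> [-> ->]; rewrite /cons_tuple/= -tuple_eta.
have mset1 m (y : m.-tuple R) : measurable [set y].
  rewrite (_ : [set y] = [set z | all (fun i => tnth z i == tnth y i) (enum 'I_m)]); last first.
    apply/seteqP; split=> z /= => [->|H]; first exact/allP.
    by apply: eq_from_tnth => i; apply/eqP/(allP H); rewrite mem_enum.
  apply: measurable_bool_set; elim: (enum 'I_m) => [|i s IH].
    exact: measurable_cst.
  apply: measurable_and => //; apply: measurable_fun_eqr => //.
  exact: measurable_tnth.
rewrite product_measure1E//; last exact: mset1.
by rewrite [X in (X * _)%E](_ : _ = 0%E) ?mul0e//; exact: lebesgue_measure_set1.
Qed.

End euclidean.

(** * Interleaved binary digits *)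

Section digits.
Context {R : realType}.
Implicit Types (u : R) (n m : int) (k : nat).

Lemma exprn2_unbounded (C e : R) : 0 < e -> exists k, C < 2%:R ^+ k * e.
Proof.
move=> e0; exists (Num.bound `|C / e|); rewrite -ltr_pdivrMr//.
apply: le_lt_trans (ler_norm _) _.
apply: lt_trans (archi_boundP (normr_ge0 _)) _.
by rewrite -natrX ltr_nat ltn_expl.
Qed.

(** The integer formed by all digits from position n upwards. Its parity is the digit at n. *)
Definition digit_floor u n : int := Num.floor ((2%:R : R) ^ (- n) * u).

Lemma dfloor_pred u n : digit_floor u (n - 1) = digit_floor u n * 2 + (digit u (n - 1))%:Z.
Proof.
rewrite /digit -/(digit_floor u (n - 1)) gez0_abs ?modz_ge0//.
have -> : digit_floor u n = (digit_floor u (n - 1) %/ 2)%Z; last exact: divz_eq.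
set z := 2%:R ^ (- n) * u.
have E : 2%:R ^ (- (n - 1)) * u = z * 2%:R.
  by rewrite opprB addrC expfzDr ?pnatr_eq0// expr1z mulrAC.
apply: floor_def; rewrite -/z /digit_floor E.
have := floor_itv (z * 2); have := divz_eq (Num.floor (z * 2)) 2.
have := ltz_mod (Num.floor (z * 2)) (isT : (2 : int) != 0).
have : (0 <= Num.floor (z * 2) %% 2)%Z by rewrite modz_ge0.
set f := Num.floor _; set q := (f %/ 2)%Z; set r := (f %% 2)%Z.
move=> r0 r2 fE /andP[fz partition_above].
have h1 : (q * 2)%:~R <= z * 2 :> R.
  by apply: le_trans fz; rewrite ler_int fE lerDl.
have h2 : z * 2 < ((q + 1) * 2)%:~R :> R.
  by apply: lt_le_trans partition_above _; rewrite ler_int; lia.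
by move: h1 h2; rewrite !rmorphM/= => h1 h2; apply/andP; split; lra.
Qed.

Lemma digit_lt2 u n : (digit u n < 2)%N.
Proof.
rewrite -ltz_nat /digit gez0_abs ?modz_ge0//.
exact: ltz_mod.
Qed.

Lemma dfloor_large u n : 0 <= u -> u < 2%:R ^ n -> digit_floor u n = 0.
Proof.
move=> u0 un; apply: floor_def; rewrite mulr_ge0 ?exprz_ge0//= add0r.
by rewrite -invr_expz mulrC ltr_pdivrMr ?exprz_gt0// mul1r.
Qed.

Lemma digit_large u n : 0 <= u -> u < 2%:R ^ n -> digit u n = 0%N.
Proof. by move=> u0 un; rewrite /digit -/(digit_floor u n) dfloor_large. Qed.

Lemma exprz2_gt u : exists k : nat, forall n, (k%:Z <= n) -> u < 2%:R ^ n.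
Proof.
have [k] := exprn2_unbounded u (ltr01 : 0 < 1 :> R); rewrite mulr1 => uk.
exists k => n kn; apply: lt_le_trans uk _.
by rewrite -[2%:R ^+ k]/(2%:R ^ k%:Z) ler_weXz2l// ler1n.
Qed.

(** From a position where both floors vanish, equal digits propagate equality of the floors
    downwards. Two distinct reals are separated by more than 1 after enough scaling, so their floors
    would differ. *)
Lemma digit_inj u u' : 0 <= u -> 0 <= u' ->
  (forall n, digit u n = digit u' n) -> u = u'.
Proof.
move=> u0 u'0 uu'; have [k1 uk1] := exprz2_gt u; have [k2 uk2] := exprz2_gt u'.
pose K : int := (maxn k1 k2)%:Z.
have E k : digit_floor u (K - k%:Z) = digit_floor u' (K - k%:Z).
  elim: k => [|k IH].
    by rewrite subr0 !dfloor_large// ?uk1 ?uk2// /K lez_nat ?leq_maxl ?leq_maxr.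
  have -> : K - k.+1%:Z = K - k%:Z - 1 by lia.
  by rewrite !dfloor_pred IH uu'.
apply/eqP; rewrite -subr_eq0 -normr_eq0; apply: contraT.
rewrite normr_eq0 -normr_gt0 => d0.
have e0 : 0 < 2%:R ^ (- K) * `|u - u'| by rewrite mulr_gt0// exprz_gt0.
have [k] := exprn2_unbounded 1 e0.
rewrite mulrA -[2%:R ^+ k]/(2%:R ^ k%:Z) -expfzDr ?pnatr_eq0//.
rewrite (_ : k%:Z - K = - (K - k%:Z)); last by lia.
set c := 2%:R ^ _ => H.
have c0 : 0 <= c by rewrite exprz_ge0.
have := floor_itv (c * u'); have := floor_itv (c * u).
have := E k; rewrite /digit_floor -/c => ->.
rewrite rmorphD/= => /andP[a1 a2] /andP[b1 b2].
suff : c * `|u - u'| < 1 by lra.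
rewrite -{1}(ger0_norm c0) -normrM mulrBr ltr_norml.
by apply/andP; split; lra.
Qed.

(** If all digits below m were 1, the floor plus one would exactly double at each step down. The
    positive gap between [2^(-m) * u] and the next integer, scaled by 2^k, would then stay at most 1
    for all k. *)
Lemma digit_eq0_below u m : exists2 n, n < m & digit u n = 0%N.
Proof.
apply: contrapT => H.
have d1 n : n < m -> digit u n = 1%N.
  move=> nm; have := digit_lt2 u n; case E : (digit u n) => [|[|]]// _.
  by exfalso; apply: H; exists n.
have E k : digit_floor u (m - k%:Z) + 1 = 2 ^+ k * (digit_floor u m + 1).
  elim: k => [|k IH]; first by rewrite subr0 mul1r.
  have -> : m - k.+1%:Z = m - k%:Z - 1 by lia.
  rewrite dfloor_pred d1; last by lia.
  by rewrite exprS -mulrA -IH; lia.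
have e0 : 0 < (digit_floor u m + 1)%:~R - 2%:R ^ (- m) * u.
  by rewrite subr_gt0; have /andP[] := floor_itv (2%:R ^ (- m) * u).
have [k] := exprn2_unbounded 1 e0.
have h2 : (digit_floor u (m - k%:Z))%:~R <= 2%:R ^+ k * (2%:R ^ (- m) * u) :> R.
  have /andP[+ _] := floor_itv (2%:R ^ (- (m - k%:Z)) * u).
  by rewrite -/(digit_floor _ _) opprB expfzDr ?pnatr_eq0// mulrA.
have h1 : (digit_floor u (m - k%:Z))%:~R + 1 = 2%:R ^+ k * (digit_floor u m + 1)%:~R :> R.
  by rewrite -(rmorph1 (intmul (1 : R))) -rmorphD E rmorphM rmorphXn.
by rewrite mulrBr -h1; lra.
Qed.

Lemma measurable_digit n : measurable_fun setT (fun u => (digit u n)%:R : R).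
Proof.
(* A digit is a combination of two floors, each monotone in u. *)
rewrite (_ : (fun _ => _) = fun u => (digit_floor u n)%:~R - (digit_floor u (n + 1))%:~R * 2).
  have mfl m : measurable_fun setT (fun u => (digit_floor u m)%:~R : R).
    apply: nondecreasing_measurable; first exact: measurableT.
    move=> u u' uu'.
    by rewrite ler_int; apply: le_floor; rewrite ler_wpM2l// exprz_ge0.
  by apply: measurable_funB => //; exact: measurable_funM.
apply/funext => u; have := dfloor_pred u (n + 1); rewrite addrK => ->.
by rewrite rmorphD rmorphM/=; lra.
Qed.

End digits.

(** * Measurability and injectivity of the interleaving *)

Section interleave.
Context {R : realType} {d : nat}.
Local Notation E := (d.-tuple R).
Implicit Types (x y : E) (n m N : int).
Local Open Scope ereal_scope.

Definition interleaved_digit x n : nat :=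
  digit (nth 0%R x `|(n %% d%:Z)%Z|%N) (n %/ d%:Z)%Z.

Let term x n : \bar R := ((interleaved_digit x n)%:R * 2%:R ^ n)%:E.

Let term_ge0 x n : 0 <= term x n.
Proof. by rewrite lee_fin mulr_ge0// exprz_ge0. Qed.

Lemma interleave_ge0 x : (0 <= interleave x)%R.
Proof. by rewrite fine_ge0// esum_ge0// => n _; exact: term_ge0. Qed.

Lemma measurable_interleave : measurable_fun setT (@interleave R d).
Proof.
apply: measurableT_comp; first exact: fine_measurable.
have mterm n : measurable_fun setT (term^~ n).
  apply/measurable_EFinP; apply: measurable_funM => //.
  have [dn|dn] := ltnP `|(n %% d%:Z)%Z|%N d.
    rewrite (_ : (fun _ => _) = fun x : E => (digit (tnth x (Ordinal dn)) (n %/ d%:Z)%Z)%:R).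
      apply: (measurableT_comp (measurable_digit (R := R) (n %/ d%:Z)%Z)).
      exact: measurable_tnth.
    by apply/funext => x; rewrite (tnth_nth 0%R).
  rewrite (_ : (fun _ => _) = cst ((digit (0 : R)%R (n %/ d%:Z)%Z)%:R : R)); first exact: measurable_cst.
  by apply/funext => x; rewrite /interleaved_digit nth_default// size_tuple.
have E : (fun x => \esum_(n in [set: int]) term x n) =
    (fun x => \sum_(k <oo) term x k%:Z + \sum_(k <oo) term x (Negz k)).
  apply/funext => x; rewrite (esumID (range Posz)); last by move=> n _; exact: term_ge0.
  rewrite setTI (esum_image setT Posz); last by move=> a b _ _ [].
  rewrite (_ : _ `&` _ = range Negz).
    rewrite (esum_image setT Negz); last by move=> a b _ _ [].
    by congr (_ + _); rewrite nneseries_esumT.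
  rewrite setTI; apply/seteqP; split=> [[k|k]|_ [k _ <-]] //=.
  - by move=> H; exfalso; apply: H; exists k.
  - by move=> _; exists k.
  - by move=> [j].
rewrite -/(fun x => \esum_(n in [set: int]) term x n) E.
by apply: emeasurable_funD; apply: ge0_emeasurable_sum => // k x _ _; exact: term_ge0.
Qed.

Lemma esum_pow2_le N : \esum_(n in [set n | (n < N)%R]) ((2%:R : R) ^ n)%:E <= (2%:R ^ N)%:E.
Proof.
rewrite (reindex_esum setT _ (fun k : nat => (N - k.+1%:Z)%R)); last first.
  split=> [k _|j k _ _|n /= nN]; first by rewrite /=; lia.
    by move=> H; lia.
  by exists `|(N - n - 1)%R|%N => //; lia.
rewrite -nneseries_esumT; last by move=> k; rewrite lee_fin exprz_ge0.
apply: lime_le.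
  by apply: is_cvg_nneseries => k _ _; rewrite lee_fin exprz_ge0.
apply: nearW => m; rewrite /= sumEFin lee_fin.
(* The geometric sum telescopes. *)
suff -> : (\sum_(0 <= k < m) (2%:R : R) ^ (N - k.+1%:Z) = 2%:R ^ N - 2%:R ^ (N - m%:Z))%R.
  by rewrite gerBl exprz_ge0.
elim: m => [|m IH]; first by rewrite big_geq// subr0 subrr.
rewrite big_nat_recr//= IH.
have -> : (N - m%:Z = (N - m.+1%:Z) + 1)%R by lia.
by rewrite expfzDr ?pnatr_eq0// expr1z; lra.
Qed.

End interleave.

Section interleave_inj.
Context {R : realType} {d : nat}.
Local Notation E := (d.-tuple R).
Implicit Types (x y : E) (n m N : int).
Hypothesis d_gt0 : (0 < d)%N.

Lemma interleaved_digit_lt2 x n : (interleaved_digit x n < 2)%N.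
Proof. exact: digit_lt2. Qed.

Lemma interleaved_digit_coord x (i : 'I_d) m :
  interleaved_digit x (m * d%:Z + i%:Z) = digit (tnth x i) m.
Proof.
rewrite /interleaved_digit modzMDl divzMDl; last by lia.
rewrite modz_small; last by have := ltn_ord i; lia.
rewrite divz_small ?addr0; last by have := ltn_ord i; lia.
by rewrite (tnth_nth 0).
Qed.

Lemma interleaved_digit_eq0_below x N : exists2 n, n < N & interleaved_digit x n = 0%N.
Proof.
(* The digit of coordinate 0 at m sits at position m * d. Taking m negative as well gives m * d <= m
   < N. *)
have [m mN m0] := digit_eq0_below (tnth x (Ordinal d_gt0)) (Num.min N 0).
exists (m * d%:Z + (Ordinal d_gt0)%:Z); last by rewrite interleaved_digit_coord.
rewrite /= addr0; move: mN; rewrite lt_min => /andP[mN m0'].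
by nia.
Qed.

Lemma interleaved_digit_large x : (forall i, 0 <= tnth x i) ->
  exists M : nat, forall n, M%:Z <= n -> interleaved_digit x n = 0%N.
Proof.
move=> x0.
have [K HK] : exists K : nat, forall (i : 'I_d) n, K%:Z <= n -> digit (tnth x i) n = 0%N.
  have /choice[f fP] : forall i : 'I_d, exists k : nat, forall n, k%:Z <= n -> tnth x i < 2%:R ^ n.
    by move=> i; exact: exprz2_gt.
  exists (\max_i f i)%N => i n Kn; apply: digit_large => //; apply: fP.
  by apply: le_trans Kn; rewrite lez_nat (leq_bigmax i).
exists (K * d)%N => n Kn.
have nd : (0 <= n %% d%:Z)%Z by rewrite modz_ge0//; lia.
have nd' : (n %% d%:Z)%Z < d%:Z by rewrite ltz_mod//; lia.
have id : (`|(n %% d%:Z)%Z| < d)%N by lia.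
rewrite (divz_eq n d%:Z) (_ : (n %% d%:Z)%Z = (Ordinal id)%:Z); last by rewrite /= gez0_abs.
rewrite interleaved_digit_coord HK//.
by rewrite lez_divRL//; lia.
Qed.

Local Open Scope ereal_scope.

Let term x n : \bar R := ((interleaved_digit x n)%:R * 2%:R ^ n)%:E.

Let term_ge0 x n : 0 <= term x n.
Proof. by rewrite lee_fin mulr_ge0// exprz_ge0. Qed.

(** [interleave] applies [fine], which would send an infinite sum to 0; finiteness is what makes its
    values comparable. *)
Lemma esum_interleaved_lty x : (forall i, (0 <= tnth x i)%R) ->
  \esum_(n in [set: int]) term x n < +oo.
Proof.
move=> /interleaved_digit_large[M xM].
apply: le_lt_trans (ltry (2%:R ^ M%:Z)); apply: le_trans (esum_pow2_le M%:Z).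
rewrite [leRHS]esum_mkcond; apply: le_esum => n _.
case: ifPn => [_|]; rewrite ?notin_setE /term.
  rewrite lee_fin ler_piMl ?exprz_ge0//.
  by rewrite -[leRHS]/(1%:R) ler_nat -ltnS interleaved_digit_lt2.
by move=> /= /negP; rewrite -leNgt => /xM ->; rewrite mul0r.
Qed.

(** Strictness is the point: some digit below N is 0, and its missing power of two separates the
    tail from the full geometric sum. *)
Let term_tail_lt x N : \esum_(n in [set n | (n < N)%R]) term x n < (2%:R ^ N)%:E.
Proof.
have [m mN m0] := interleaved_digit_eq0_below x N.
pose c n : \bar R := ((1 - (interleaved_digit x n)%:R) * 2%:R ^ n)%:E.
have c0 n : 0 <= c n.
  rewrite lee_fin mulr_ge0 ?exprz_ge0// subr_ge0 -[leRHS]/(1%:R) ler_nat -ltnS.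
  exact: interleaved_digit_lt2.
have : \esum_(n in [set n | (n < N)%R]) term x n + \esum_(n in [set n | (n < N)%R]) c n
    <= (2%:R ^ N)%:E.
  apply: le_trans (esum_pow2_le N); rewrite -esumD//; apply: le_esum => n _.
  by rewrite /term /c -EFinD lee_fin; lra.
have mc : (2%:R ^ m)%:E <= \esum_(n in [set n | (n < N)%R]) c n.
  apply: esum_ge; exists [set m]; first by split=> // ? ->.
  by rewrite fsbig_set1 /c m0 subr0 mul1r.
move=> H; have {H mc} : \esum_(n in [set n | (n < N)%R]) term x n + (2%:R ^ m)%:E
    <= (2%:R ^ N)%:E.
  by apply: le_trans H; rewrite leeD2l.
have : 0 <= \esum_(n in [set n | (n < N)%R]) term x n.
  by apply: esum_ge0 => n _; exact: term_ge0.
case: (\esum_(n in _) _) => [r| |]//=.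
by rewrite -EFinD !lee_fin lte_fin => r0; apply: lt_le_trans; rewrite ltrDl exprz_gt0.
Qed.

(** The highest position where the digits differ decides, because everything below it in x adds up
    to less than 2^N. *)
Let term_lt x y N : (forall i, (0 <= tnth x i)%R) -> (forall i, (0 <= tnth y i)%R) ->
  (forall n, (N < n)%R -> interleaved_digit x n = interleaved_digit y n) ->
  interleaved_digit x N = 0%N -> interleaved_digit y N = 1%N ->
  (interleave x < interleave y)%R.
Proof.
move=> x0 y0 xy xN yN.
have splitN z : \esum_(n in [set: int]) term z n =
    \esum_(n in [set n | (N < n)%R]) term z n + (term z N +
    \esum_(n in [set n | (n < N)%R]) term z n).
  rewrite (esumID [set n | (N < n)%R] setT)// !setTI; congr (_ + _).
  rewrite (esumID [set N] (~` [set n | (N < n)%R]))//; congr (_ + _).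
    rewrite (_ : _ `&` _ = [set N]); first by rewrite esum_set1.
    by apply/seteqP; split=> n /= => [[]//|->]; split=> //; rewrite ltxx.
  congr (esum _ _); apply/seteqP; split=> n /=.
    move=> [/negP + /eqP]; rewrite -leNgt => nN n'; lia.
  by move=> nN; split; [apply/negP; lia|apply/eqP; lia].
have xoo := esum_interleaved_lty x0; have yoo := esum_interleaved_lty y0.
have fin z : \esum_(n in [set: int]) term z n < +oo ->
    \esum_(n in [set: int]) term z n \is a fin_num.
  by move=> zoo; rewrite ge0_fin_numE// esum_ge0// => n _; exact: term_ge0.
rewrite /interleave -lte_fin !fineK ?fin// -!/(term _ _).
rewrite (splitN x) (splitN y).
have -> : \esum_(n in [set n | (N < n)%R]) term x n = \esum_(n in [set n | (N < n)%R]) term y n.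
  by apply: eq_esum => n /= /xy E; rewrite /term E.
have Hfin : \esum_(n in [set n | (N < n)%R]) term y n \is a fin_num.
  rewrite ge0_fin_numE ?esum_ge0//; apply: le_lt_trans yoo.
  rewrite (splitN y) leeDl// adde_ge0// esum_ge0// => n _; exact: term_ge0.
have -> : term x N = 0 by rewrite /term xN mul0r.
have -> : term y N = (2%:R ^ N)%:E by rewrite /term yN mul1r.
rewrite lteD2lE// add0e.
apply: lt_le_trans (term_tail_lt x N) _.
by rewrite leeDl// esum_ge0// => n _; exact: term_ge0.
Qed.

Lemma interleave_inj x y : (forall i, (0 <= tnth x i)%R) -> (forall i, (0 <= tnth y i)%R) ->
  interleave x = interleave y -> x = y.
Proof.
move=> x0 y0 xy.
suff H n : interleaved_digit x n = interleaved_digit y n.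
  apply: eq_from_tnth => i; apply: digit_inj => // m.
  by rewrite -!interleaved_digit_coord.
have [Mx HMx] := interleaved_digit_large x0.
have [My HMy] := interleaved_digit_large y0.
apply: contrapT => xyn; pose M : int := (maxn Mx My)%:Z.
(* All digits vanish from M upwards, so the highest difference is found as the least depth k below
   M. *)
pose P k := interleaved_digit x (M - k%:Z) != interleaved_digit y (M - k%:Z).
have large m : (M < m)%R -> interleaved_digit x m = interleaved_digit y m.
  by move=> mM; rewrite HMx ?HMy//; lia.
have exP : exists k, P k.
  exists `|(M - n)%R|%N; rewrite /P.
  have nM : (n <= M)%R by rewrite leNgt; apply/negP => /large.
  by rewrite gez0_abs ?subr_ge0// opprB addrC subrK; apply/eqP.
case: (ex_minnP exP) => k Pk kmin.
have above m : (M - k%:Z < m)%R -> interleaved_digit x m = interleaved_digit y m.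
  move=> km; have [mM|mM] := leP m M; last exact: large.
  apply/eqP; apply: contraT => Pm.
  have := kmin `|(M - m)%R|%N; rewrite /P gez0_abs ?subr_ge0// opprB addrC subrK.
  by move=> /(_ Pm); lia.
move: Pk; rewrite /P; have := interleaved_digit_lt2 x (M - k%:Z)%R.
have := interleaved_digit_lt2 y (M - k%:Z)%R.
case E1 : (interleaved_digit x _) => [|[|]]//; case E2 : (interleaved_digit y _) => [|[|]]// _ _ _.
  by have := term_lt x0 y0 above E1 E2; rewrite xy ltxx.
by have := term_lt y0 x0 (fun m km => esym (above m km)) E2 E1; rewrite xy ltxx.
Qed.

End interleave_inj.

(** * Configurations and sequences *)

Section config_seq.
Context {R : realType} {d : nat}.
Local Notation E := (d.-tuple R).
Variable B : set E.
Implicit Type Y : config B.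

Lemma config_eq Y Y' : points Y = points Y' -> Y = Y'.
Proof.
case: Y Y' => [P PB Pf] [P' PB' Pf'] /= E; subst P'.
by congr Config; exact: Prop_irrelevance.
Qed.

Lemma locally_finite_finite (P : set E) : finite_set P -> locally_finite P.
Proof. by move=> fP A _; exact: finite_setIl. Qed.

(** Total by default: a set that is not a configuration in B is sent to the empty one. *)
Definition config_of (P : set E) : config B :=
  match pselect (P `<=` B /\ locally_finite P) with
  | left H => Config (proj1 H) (proj2 H)
  | right _ => config0 B
  end.

Definition config_seq (s : seq E) : config B := config_of [set` s].

Lemma points_config_of P : P `<=` B -> locally_finite P -> points (config_of P) = P.
Proof. by move=> PB fP; rewrite /config_of; case: pselect => // -[]. Qed.

Lemma points_config_seq s : (forall x, x \in s -> B x) -> points (config_seq s) = [set` s].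
Proof.
move=> sB; rewrite points_config_of//.
by apply: locally_finite_finite; exact: finite_seq.
Qed.

Lemma measurable_void_event A : measurable A -> A `<=` B -> measurable (void_event B A).
Proof. by move=> mA AB; apply: sub_sigma_algebra; exists A. Qed.

Lemma measurable_void_event_setI A : measurable B -> measurable A ->
  measurable [set Y : config B | points Y `&` A = set0].
Proof.
move=> mB mA; rewrite (_ : [set Y : config B | _] = void_event B (A `&` B)).
  by apply: measurable_void_event; [exact: measurableI|exact: subIsetr].
apply/seteqP; split=> Y /=; rewrite /void_event /= => H; apply/seteqP; split=> // x [Yx Ax].
  by rewrite -H; case: Ax.
by rewrite -H; do 2?split=> //; exact: (@config_sub _ _ B Y).
Qed.

Lemma measurable_config_fun d' (X : measurableType d') (f : X -> config B) :
  (forall A, measurable A -> A `<=` B -> measurable [set x | points (f x) `&` A = set0]) ->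
  measurable_fun setT f.
Proof.
move=> mf; apply: (measurability (void_events B)) => // _ [_ [A [mA AB] <-] <-].
by rewrite setTI; exact: mf.
Qed.

Lemma measurable_config_seq : measurable B -> measurable_fun setT config_seq.
Proof.
move=> mB; apply: measurable_config_fun => A mA AB.
(* A sequence leaving B gives the empty configuration, which avoids every A: hence the first
   disjunct. *)
rewrite (_ : [set _ | _] =
    [set s : seq E | ~~ all (fun x => x \in B) s || all (fun x => x \notin A) s]).
  apply: measurable_bool_set; apply: measurable_or.
    apply: measurable_neg.
    apply: (@measurable_seq_all _ E _ (seq E) (fun _ x => x \in B) id) => //.
    by apply: (measurableT_comp (f := fun x => x \in B)) => //; exact/measurable_setP.
  apply: (@measurable_seq_all _ E _ (seq E) (fun _ x => x \notin A) id) => //.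
  apply: measurable_neg; apply: (measurableT_comp (f := fun x => x \in A)) => //.
  exact/measurable_setP.
apply/seteqP; split=> s /=; case: (boolP (all (fun x => x \in B) s)) => /= [/allP sB|sB].
- have sB' x : x \in s -> B x by move=> /sB/set_mem.
  rewrite points_config_seq// => H; apply/allP => x xs.
  by apply/negP => /set_mem Ax; have : set0 x by rewrite -H.
- by [].
- have sB' x : x \in s -> B x by move=> /sB/set_mem.
  rewrite points_config_seq// => /allP H.
  by apply/seteqP; split=> // x [/H/negP + Ax]; apply; exact/mem_set.
- move=> _; rewrite /config_seq /config_of; case: pselect => [H|_].
    by move/negP: sB; case; apply/allP => x xs; apply/mem_set; exact: H.1.
  by rewrite set0I.
Qed.

End config_seq.
Arguments config_of {R d} B.
Arguments config_seq {R d} B.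

(** * Measurable enumeration of a configuration *)

Section sort_config.
Context {R : realType} {d : nat}.
Local Notation E := (d.-tuple R).
Variables (B : set E) (b : E -> R).
Hypotheses (mB : measurable B) (bB : bounded B).
Hypotheses (mb : measurable_fun setT b).
Hypothesis b_inj : forall x y, B x -> B y -> b x = b y -> x = y.
Implicit Type Y : config B.

Lemma config_finite Y : finite_set (points Y).
Proof.
have := @config_locally_finite _ _ B Y _ bB.
by rewrite setIidl//; exact: (@config_sub _ _ B Y).
Qed.

Definition first_point Y : E :=
  xget (nseq_tuple d 0) [set x : E | points Y x /\ forall y, points Y y -> b x <= b y].

Definition remaining Y : config B := config_of B (points Y `\ first_point Y).

Definition config_empty Y : bool := `[< points Y = set0 >].

Lemma first_pointP Y : ~~ config_empty Y ->
  points Y (first_point Y) /\ forall y, points Y y -> b (first_point Y) <= b y.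
Proof.
move=> /asboolPn Y0; rewrite /first_point; case: xgetP => [_ _ //|H].
exfalso; have fY := config_finite Y.
have /finite_seqP[s Ys] := fY.
move: H Y0; rewrite Ys => {fY Ys} H; apply; apply/seteqP; split=> // x xs.
have : exists2 m, m \in s & forall y, y \in s -> b m <= b y.
  elim: s x xs {H} => // y s IH x xs; case: (s =P [::]) => [->|].
    by exists y => [|z]; rewrite inE// => /eqP ->.
  case: s IH {xs} => // z s IH _; have [|m ms mmin] := IH z; first exact: mem_head.
  have [ym|my] := leP (b y) (b m).
    exists y => [|w]; first exact: mem_head.
    by rewrite inE => /predU1P[->//|/mmin]; exact: le_trans.
  exists m => [|w]; first by rewrite inE ms orbT.
  by rewrite inE => /predU1P[->|/mmin//]; exact: ltW.
by move=> [m ms mmin]; exact: (H m).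
Qed.

Lemma points_remaining Y : points (remaining Y) = points Y `\ first_point Y.
Proof.
rewrite points_config_of//.
  by apply: (subset_trans _ (@config_sub _ _ B Y)); exact: subDsetl.
by apply: locally_finite_finite; apply: finite_setD; exact: config_finite.
Qed.

Lemma measurable_config_empty : measurable_fun setT config_empty.
Proof.
apply: (measurable_fun_bool true); rewrite setTI.
rewrite (_ : _ @^-1` _ = [set Y : config B | points Y `&` setT = set0]).
  exact: measurable_void_event_setI.
by apply/seteqP; split=> Y /=; rewrite setIT => /asboolP.
Qed.

Let le_set q : set E := [set x | b x <= q].

Let mle_set q : measurable (le_set q).
Proof.
by apply: measurable_bool_set; apply: measurable_fun_ler => //; exact: measurable_cst.
Qed.

Let rat_between (x y : R) : x < y -> exists q : rat, x <= ratr q < y.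
Proof.
move=> xy; have [q] := rat_in_itvoo xy; rewrite in_itv/= => /andP[xq qy].
by exists q; rewrite (ltW xq).
Qed.

(* A rational level separates the value of [b] at the first point from its
   values at the others. *)
Let first_level Y : ~~ config_empty Y -> exists q : rat,
  points Y `&` le_set (ratr q) = [set first_point Y].
Proof.
move=> Y0; have [Yf fmin] := first_pointP Y0.
have [u fu Yu] : exists2 u, b (first_point Y) < u &
    forall y, points Y y -> y <> first_point Y -> u <= b y.
  have [/asboolP Z0|Z0] := boolP (config_empty (remaining Y)).
    exists (b (first_point Y) + 1); first by rewrite ltrDl.
    move=> y Yy yf; have : points (remaining Y) y by rewrite points_remaining.
    by rewrite Z0.
  have [] := first_pointP Z0; rewrite points_remaining => -[Ys sf] smin.
  exists (b (first_point (remaining Y))) => [|y Yy yf]; last exact: smin.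
  rewrite lt_neqAle fmin// andbT; apply/eqP => /b_inj E; apply: sf => /=.
  by rewrite E//; exact: (@config_sub _ _ B Y).
have [q /andP[fq qu]] := rat_between fu; exists q.
apply/seteqP; split=> [y [Yy yq]|_ ->]; last by split.
apply: contrapT => yf; have := Yu _ Yy yf.
by rewrite leNgt (le_lt_trans yq).
Qed.

(** For nonempty Y, the first point is in A iff for some rational q, Y has a point of A at level at
    most q and none outside A at level at most q. These are void events and complements. The empty
    configuration takes the default value. *)
Lemma measurable_first_point : measurable_fun setT first_point.
Proof.
move=> _ A mA; rewrite setTI.
rewrite (_ : _ @^-1` _ =
    ([set Y : config B | config_empty Y] `&` [set _ : config B | A (nseq_tuple d 0)]) `|`
    \bigcup_(q : rat) (~` [set Y : config B | points Y `&` (le_set (ratr q) `&` A) = set0] `&`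
       [set Y : config B | points Y `&` (le_set (ratr q) `\` A) = set0])).
  apply: measurableU.
    apply: measurableI; first exact: measurable_bool_set measurable_config_empty.
    have [Ap|Ap] := pselect (A (nseq_tuple d 0)).
      by rewrite (_ : [set _ | _] = setT)//; apply/seteqP; split.
    by rewrite (_ : [set _ | _] = set0)//; apply/seteqP; split.
  apply: bigcupT_measurable_rat => q; apply: measurableI.
    apply: measurableC; apply: measurable_void_event_setI => //.
    exact: measurableI.
  apply: measurable_void_event_setI => //; exact: measurableD.
apply/seteqP; split=> Y /=.
  move=> AY; have [Y0|Y0] := boolP (config_empty Y); [left|right].
    split=> //; move: AY; rewrite /first_point; case: xgetP => // x _ [Yx _].
    by move/asboolP: Y0 Yx => ->.
  have [q qY] := first_level Y0; exists q => //; split=> /=.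
    rewrite setIA qY => H; have : set0 (first_point Y) by rewrite -H.
    by [].
  by rewrite setDE setIA qY; apply/seteqP; split=> // y [-> ].
case=> [[/asboolP Y0 Ap]|[q _ [Y1 Y2]]].
  by rewrite /first_point; case: xgetP => // x _ []; rewrite Y0.
have [y [Yy [yq Ay]]] : (points Y `&` (le_set (ratr q) `&` A)) !=set0.
  by apply/set0P/eqP.
have Y0 : ~~ config_empty Y by apply/asboolPn => Y0; move: Yy; rewrite Y0.
have [Yf fmin] := first_pointP Y0.
apply: contrapT => nA; suff : set0 (first_point Y) by [].
by rewrite -Y2; split=> //; split=> //; exact: le_trans (fmin _ Yy) yq.
Qed.

(** A point of A remains iff some rational q has a point of Y at or below it and a point of Y in A
    above it. *)
Lemma measurable_remaining : measurable_fun setT remaining.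
Proof.
apply: measurable_config_fun => A mA AB.
rewrite (_ : [set Y | _] = ~` \bigcup_(q : rat)
    (~` [set Y : config B | points Y `&` le_set (ratr q) = set0] `&`
     ~` [set Y : config B | points Y `&` (A `\` le_set (ratr q)) = set0])).
  apply: measurableC; apply: bigcupT_measurable_rat => q; apply: measurableI.
    by apply: measurableC; exact: measurable_void_event_setI.
  apply: measurableC; apply: measurable_void_event_setI => //.
  exact: measurableD.
apply/seteqP; split=> Y /=; rewrite points_remaining.
  move=> H [q _ [/eqP/set0P[x [Yx xq]] /eqP/set0P[y [Yy [Ay yq]]]]].
  suff : set0 y by [].
  rewrite -H; split=> //; split=> //= yf.
  have Y0 : ~~ config_empty Y by apply/asboolPn => Y0; move: Yy; rewrite Y0.
  have [_ fmin] := first_pointP Y0.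
  by apply: yq; rewrite /le_set /= yf; apply: le_trans (fmin _ Yx) xq.
move=> H; apply/seteqP; split=> // y [[Yy yf] Ay]; apply: H.
have Y0 : ~~ config_empty Y by apply/asboolPn => Y0; move: Yy; rewrite Y0.
have [q qY] := first_level Y0; exists q => //; split=> /=.
  by rewrite qY; apply/eqP/set0P; exists (first_point Y).
apply/eqP/set0P; exists y; split=> //; split=> // yq; apply: yf.
suff : [set first_point Y] y by [].
by rewrite -qY.
Qed.

(** Selection sort with fuel n. *)
Fixpoint sort_upto n Y : seq E :=
  if n is m.+1 then
    if config_empty Y then [::] else first_point Y :: sort_upto m (remaining Y)
  else [::].

Lemma measurable_sort_upto n : measurable_fun setT (sort_upto n).
Proof.
elim: n => [|n IH]; first exact: measurable_cst.
apply: measurable_fun_ifT; first exact: measurable_config_empty.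
  exact: measurable_cst.
apply: measurable_seq_cons; first exact: measurable_first_point.
exact: (measurableT_comp IH measurable_remaining).
Qed.

Lemma sort_uptoP n Y : config_empty (iter n remaining Y) ->
  [set` sort_upto n Y] = points Y /\ uniq (sort_upto n Y).
Proof.
elim: n Y => [|n IH] Y /=; first by move=> /asboolP ->; split=> //; apply/seteqP; split.
have [/asboolP -> _|Y0] := boolP (config_empty Y).
  by split=> //; apply/seteqP; split.
rewrite -iterS iterSr => /IH[E u].
have [Yf _] := first_pointP Y0; split.
  rewrite -(setD1K Yf) -points_remaining -E.
  by apply/seteqP; split=> x /=; rewrite inE => /predU1P.
rewrite /= u andbT; apply/negP => fr.
have : points (remaining Y) (first_point Y) by rewrite -E.
by rewrite points_remaining => -[_]; apply.
Qed.

Lemma sort_upto_terminates Y : exists n, config_empty (iter n remaining Y).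
Proof.
have [k] := ubnP (#|` fset_set (points Y)|); elim: k Y => // k IH Y Yk.
have [Y0|Y0] := boolP (config_empty Y); first by exists 0%N.
have [|n nY] := IH (remaining Y); last by exists n.+1; rewrite iterSr.
apply: leq_trans (_ : (_ <= #|` fset_set (points Y)|)%N) _; last by rewrite -ltnS.
rewrite points_remaining fset_setD1; last exact: config_finite.
rewrite [X in (_ < X)%N](cardfsD1 (first_point Y)) in_fset_set; last exact: config_finite.
by rewrite mem_set ?add1n//; have [] := first_pointP Y0.
Qed.

Lemma sort_upto_stable n m Y : config_empty (iter n remaining Y) ->
  config_empty (iter m remaining Y) -> sort_upto n Y = sort_upto m Y.
Proof.
elim: n m Y => [|n IH] [|m] Y //=; do 1?by [move=> -> | move=> _ ->].
case: ifPn => // _; rewrite -!iterS !iterSr => nY mY.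
by rewrite (IH m).
Qed.

(** Any sufficient fuel gives the same list, so measurability is checked for each fixed n on the
    event that n suffices. *)
Definition sort_config Y : seq E :=
  sort_upto (xget 0%N [set n | config_empty (iter n remaining Y)]) Y.

Lemma sort_configE n Y : config_empty (iter n remaining Y) ->
  sort_config Y = sort_upto n Y.
Proof.
move=> nY; apply: sort_upto_stable => //.
by case: xgetP => // /(_ n).
Qed.

Lemma sort_configP Y : [set` sort_config Y] = points Y /\ uniq (sort_config Y).
Proof.
by have [n nY] := sort_upto_terminates Y; rewrite (sort_configE nY); exact: sort_uptoP.
Qed.

Lemma sort_config_mem Y x : (x \in sort_config Y) = `[< points Y x >].
Proof. by have [<- _] := sort_configP Y; rewrite asboolb. Qed.

Lemma sort_configK : cancel sort_config (config_seq B).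
Proof.
move=> Y; apply: config_eq; have [E _] := sort_configP Y.
rewrite points_config_seq ?E// => x; rewrite sort_config_mem => /asboolP.
exact: (@config_sub _ _ B Y).
Qed.

Lemma measurable_sort_config : measurable_fun setT sort_config.
Proof.
move=> _ A mA; rewrite setTI.
rewrite (_ : _ @^-1` _ = \bigcup_n ([set Y | config_empty (iter n remaining Y)] `&`
    sort_upto n @^-1` A)).
  apply: bigcupT_measurable => n; apply: measurableI.
    apply: measurable_bool_set.
    apply: (measurableT_comp measurable_config_empty).
    elim: n => [|n IH]; first exact: measurable_id.
    exact: (measurableT_comp measurable_remaining IH).
  by rewrite -[X in measurable X]setTI; exact: measurable_sort_upto.
apply/seteqP; split=> Y /=.
  have [n nY] := sort_upto_terminates Y => AY; exists n => //; split=> //.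
  by rewrite /= -(sort_configE nY).
by move=> [n _ [nY AY]]; rewrite (sort_configE nY).
Qed.

End sort_config.

(** * Poisson laws and partition functions on sequences *)

Section hard_core_seq.
Context {R : realType} {d : nat}.
Local Notation E := (d.-tuple R).
Variable r : R.
Implicit Types (x y : E) (s c u w : seq E).

Lemma dist_sym x y : dist x y = dist y x.
Proof. by congr Num.sqrt; apply: eq_bigr => i _; rewrite -sqrrN opprB. Qed.

Definition separated x y : bool := r < dist x y.

(** The test [x == y] makes repetitions in s harmless: as for [hard_core], only the sets of points
    matter. *)
Definition hard_coreb s c : bool :=
  all (fun x => all (fun y => (x == y) || separated x y) s) s &&
  all (fun y => all (fun x => separated x y) c) s.

Lemma hard_corebP s c : reflect (hard_core r [set` s] [set` c]) (hard_coreb s c).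
Proof.
apply: (iffP andP) => [[/allP H1 /allP H2]|[H1 H2]]; split.
- by move=> x y /= /H1 /allP + /[dup] ys => /(_ y ys) /predU1P[->|//]; rewrite eqxx.
- by move=> x y /= xc /H2 /allP; exact.
- apply/allP => x xs; apply/allP => y ys; have [//|xy] /= := eqVneq x y.
  exact: H1.
- by apply/allP => y ys; apply/allP => x xc; exact: H2.
Qed.

Lemma eq_hard_coreb s s' c c' : s =i s' -> c =i c' -> hard_coreb s c = hard_coreb s' c'.
Proof.
move=> ss' cc'; have E1 : [set` s] = [set` s'] by apply/seteqP; split=> x /=; rewrite ss'.
have E2 : [set` c] = [set` c'] by apply/seteqP; split=> x /=; rewrite cc'.
by apply/idP/idP => /hard_corebP H; apply/hard_corebP; [rewrite -E1 -E2|rewrite E1 E2].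
Qed.

(** A point of the configuration may be moved into the boundary condition. Were x in w, the
    right-hand side would ask x to be separated from itself. *)
Lemma hard_coreb_cons x w c : x \notin w ->
  hard_coreb (x :: w) c = hard_coreb [:: x] c && hard_coreb w (x :: c).
Proof.
move=> xw; apply/hard_corebP/andP => [[H1 H2]|[/hard_corebP[_ H2] /hard_corebP[H3 H4]]].
  split; apply/hard_corebP; split.
  - by move=> y z /=; rewrite !inE => /eqP -> /eqP ->; rewrite eqxx.
  - by move=> y z yc /=; rewrite inE => /eqP ->; apply: H2 => //=; rewrite mem_head.
  - by move=> y z /= yw zw; apply: H1 => /=; rewrite inE ?yw ?zw orbT.
  - move=> y z /=; rewrite inE => /predU1P[->|yc] zw.
      apply: H1 => /=; rewrite ?mem_head ?inE ?zw ?orbT//.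
      by apply: contraNneq xw => ->.
    by apply: H2 => //=; rewrite inE zw orbT.
split=> [y z|y z yc] /=.
  rewrite !inE => /predU1P[->|yw] /predU1P[->|zw]; rewrite ?eqxx// => yz.
  - by apply: H4 => //=; rewrite mem_head.
  - by rewrite dist_sym; apply: H4 => //=; rewrite mem_head.
  - exact: H3.
rewrite inE => /predU1P[->|zw]; first by apply: H2 => //=; rewrite mem_head.
by apply: H4 => //=; rewrite inE yc orbT.
Qed.

Lemma hard_coreb_consr s x c : hard_coreb s (x :: c) -> hard_coreb s c.
Proof.
move=> /andP[h1 /allP h2]; apply/andP; split=> //; apply/allP => y ys.
by have /= /andP[] := h2 y ys.
Qed.

Lemma measurable_separated : measurable_fun setT (fun p : E * E => separated p.1 p.2).
Proof. by apply: measurable_fun_ltr => //; exact: measurable_dist. Qed.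

Lemma measurable_hard_coreb d' (X : measurableType d') (s c : X -> seq E) :
  measurable_fun setT s -> measurable_fun setT c ->
  measurable_fun setT (fun a => hard_coreb (s a) (c a)).
Proof.
move=> ms mc.
have msep d0 (Z : measurableType d0) (f g : Z -> E) : measurable_fun setT f ->
    measurable_fun setT g -> measurable_fun setT (fun a => separated (f a) (g a)).
  by move=> mf mg; exact: (measurableT_comp measurable_separated (measurable_fun_pair mf mg)).
apply: measurable_and.
  apply: (@measurable_seq_all _ E _ X
    (fun a x => all (fun y => (x == y) || separated x y) (s a))) => //.
  apply: (@measurable_seq_all _ E _ _ (fun q y => (q.2 == y) || separated q.2 y) (s \o fst)).
    apply: measurable_or; last by apply: msep => //; exact: measurableT_comp.
    apply: (measurableT_comp measurable_tuple_eq (g := fun q : X * E * E => (q.1.2, q.2))).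
    by apply: measurable_fun_pair => //; exact: measurableT_comp.
  exact: measurableT_comp.
apply: (@measurable_seq_all _ E _ X (fun a y => all (fun x => separated x y) (c a))) => //.
apply: (@measurable_seq_all _ E _ _ (fun q x => separated x q.2) (c \o fst)).
  by apply: msep => //; exact: measurableT_comp.
exact: measurableT_comp.
Qed.

End hard_core_seq.

Section poisson.
Context {R : realType} {d : nat}.
Local Notation E := (d.-tuple R).
Variables (r : R) (lam : {nonneg R}) (B : set E).
Hypothesis mB : measurable B.
(** Volume restricted to B by [muE]: [Lam] is a measure on all sequences for which those leaving B
    are null. *)
Variable mu : {finite_measure set E -> \bar R}.
Hypothesis muE : forall A, measurable A -> mu A = volume (A `&` B).
Local Notation Lam := (seq_measure lam mu).

Lemma mu_setC : mu [set x | x \notin B] = 0%E.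
Proof.
rewrite muE.
  rewrite (_ : _ `&` _ = set0) ?measure0//; apply/seteqP; split=> // x [/= xB Bx].
  by rewrite mem_set in xB.
by apply: measurable_bool_set; apply: measurable_neg; exact/measurable_setP.
Qed.

Lemma mu_set1 x : (0 < d)%N -> mu [set x] = 0%E.
Proof.
move=> d0; have m1 : measurable [set x].
  rewrite (_ : [set x] = [set y | y \in [:: x]]).
    exact: (measurable_mem_cst measurable_tuple_eq).
  by apply/seteqP; split=> y /=; rewrite inE => /eqP.
rewrite muE//; apply/eqP; rewrite eq_le measure_ge0 andbT -(volume_set1 x d0).
by apply: le_measure; rewrite ?inE//; exact: measurableI.
Qed.

Lemma config_tuplesE (D : set E) n (F : set (config D)) :
  config_tuples (n := n) F =
  [set t | (forall x, x \in tval t -> D x) /\ F (config_seq D (tval t))].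
Proof.
apply/seteqP; split=> t.
  move=> [Y FY YE]; have tD x : x \in tval t -> D x.
    by move=> xt; apply: (@config_sub _ _ D Y); rewrite YE.
  split=> //; rewrite (_ : config_seq D _ = Y)//.
  by apply: config_eq; rewrite points_config_seq// YE.
by move=> [tD FY]; exists (config_seq D t) => //; rewrite points_config_seq.
Qed.

(** The same [Lam] serves every D inside B, which makes the partition functions of all final
    segments comparable. F is arbitrary. *)
Lemma poisson_lawE (D : set E) (F : set (config D)) : measurable D -> D `<=` B ->
  poisson_law lam%:num F = ((expR (- (lam%:num * fine (mu D))))%:E *
   Lam [set s : seq E | (forall x, x \in s -> D x) /\ F (config_seq D s)])%E.
Proof.
move=> mD DB; rewrite /poisson_law seq_measureE -nneseriesZl; last first.
  by move=> n _; rewrite mule_ge0// lee_fin.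
rewrite lebesgueE; apply: eq_eseriesr => n _.
have -> : volume D = mu D by rewrite muE// setIidl.
rewrite muleA -EFinM -mulrA; congr (_ * _)%E.
rewrite power_measureE config_tuplesE; apply/esym.
apply: (@tuple_measure_mrestr _ _ _ volume mu B).
  by move=> A mA AB; have := muE mA; rewrite (setIidl AB).
by move=> t [tD _] x /tD/DB.
Qed.

Definition inside (D : set E) s c : bool := all (fun x => x \in D) s && hard_coreb r s c.

Lemma measurable_inside (D : set E) c : measurable D -> measurable [set s | inside D s c].
Proof.
move=> mD; apply: measurable_bool_set; apply: measurable_and; last exact: measurable_hard_coreb.
apply: (@measurable_seq_all _ E _ (seq E) (fun _ x => x \in D) id) => //.
by apply: (measurableT_comp (f := fun x => x \in D)) => //; exact/measurable_setP.
Qed.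

(** The factor exp(lambda |D|) cancels the normalisation of the Poisson law, leaving a plain
    mass. *)
Lemma partition_functionE (D : set E) (c : seq E) : measurable D -> D `<=` B ->
  partition_function r lam%:num D [set` c] = fine (Lam [set s | inside D s c]).
Proof.
move=> mD DB; rewrite /partition_function poisson_lawE// lebesgueE.
have -> : volume D = mu D by rewrite muE// setIidl.
rewrite (_ : [set s | _] = [set s | inside D s c]); last first.
  apply/seteqP; split=> s /=.
    move=> [sD]; rewrite /hard_core_event /= points_config_seq// => /hard_corebP hs.
    by apply/andP; split=> //; apply/allP => x /sD/mem_set.
  move=> /andP[/allP sD /hard_corebP hs]; have sD' x : x \in s -> D x by move=> /sD/set_mem.
  by split=> //; rewrite /hard_core_event /= points_config_seq.
rewrite fineM//; last by apply: fin_num_measure; exact: measurable_inside.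
by rewrite mulrA /= -expRD subrr expR0 mul1r.
Qed.

Lemma poisson_integral (G : config B -> \bar R) : (forall Y, 0 <= G Y)%E ->
  measurable_fun setT G ->
  (\int[@poisson_law R d lam%:num B]_Y G Y =
   (expR (- (lam%:num * fine (mu B))))%:E * \int[Lam]_s G (config_seq B s))%E.
Proof.
move=> G0 mG.
have mall : measurable [set s : seq E | all (fun x => x \in B) s].
  apply: measurable_bool_set.
  apply: (@measurable_seq_all _ E _ (seq E) (fun _ x => x \in B) id) => //.
  by apply: (measurableT_comp (f := fun x => x \in B)) => //; exact/measurable_setP.
have mc := measurable_config_seq mB.
have e0 : 0 <= expR (- (lam%:num * fine (mu B))) by exact: expR_ge0.
(* The integral is taken against a bare set function; it can be rewritten as one against a measure
   because the two agree on every set. *)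
have -> : @poisson_law R d lam%:num B =
    mscale (NngNum e0) (pushforward (mrestr Lam mall) (config_seq B)) :> (set (config B) -> \bar R).
  move=> m; apply/funext => F; rewrite poisson_lawE// /mscale/= /pushforward /mrestr.
  congr (_ * Lam _)%E; apply/seteqP; split=> s [h1 h2]; split=> //.
    by apply/allP => x /h1/mem_set.
  by move=> x xs; apply/set_mem; exact: (allP h2).
rewrite ge0_integral_mscale//=; congr *%E.
rewrite ge0_integral_pushforward//.
apply: eq_measure_integral => A mA _; rewrite /mrestr.
have N0 : Lam (~` [set s : seq E | all (fun x => x \in B) s]) = 0%E.
  have := @seq_measure_not_all _ E R lam mu (fun x => x \in B) _ mu_setC.
  rewrite (_ : [set s | ~~ _] = ~` [set s : seq E | all (fun x => x \in B) s]).
    by apply; exact/measurable_setP.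
  by apply/seteqP; split=> s /= /negP.
set D := [set s : seq E | _] in mall N0 *.
transitivity (Lam (A `\` D) + Lam (A `&` D))%E; last exact/esym/measureDI.
rewrite [X in (X + _)%E](_ : _ = 0%E) ?add0e//.
apply: subset_measure0 N0; [exact: measurableD|exact: measurableC|exact: subIsetr].
Qed.

End poisson.

(** * Partition functions of final segments *)

Section picks_min.
Context {T : eqType} {R : realType}.
Variable b : T -> R.
Implicit Types (s w : seq T).

Definition is_first (p : T * seq T) : bool := all (fun y => b p.1 < b y) p.2.

Lemma ex_first s : uniq s -> {in s &, injective b} -> s != [::] ->
  exists2 p, p \in picks s & is_first p.
Proof.
elim: s => // x s IH /= /andP[xs us] binj _.
have [->|s0] := eqVneq s [::]; first by exists (x, [::]); rewrite ?mem_head.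
have [|p ps pf] := IH us _ s0.
  by move=> y z ys zs; apply: binj; rewrite inE ?ys ?zs orbT.
have psE := perm_mem (perm_picks ps).
have p1s : p.1 \in s by rewrite -psE mem_head.
have [xp|px] := ltP (b x) (b p.1).
  exists (x, s); first exact: mem_head.
  apply/allP => y /=; rewrite -psE inE => /predU1P[->//|yp].
  exact: lt_trans xp (allP pf _ yp).
exists (p.1, x :: p.2); first by rewrite inE map_f ?orbT.
rewrite /is_first /= -/(is_first p) pf andbT lt_neqAle px andbT.
apply: contraNneq xs => bpx; rewrite -(binj p.1 x)//; last exact: mem_head.
by rewrite inE p1s orbT.
Qed.

(** Exactly one pick selects the first point: of two such picks with different points, each would
    precede the other. *)
Lemma sum_picks_first s (F : T * seq T -> \bar R) : uniq s -> {in s &, injective b} ->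
  s != [::] -> (forall p, ~~ is_first p -> F p = 0%E) ->
  exists2 p, p \in picks s & is_first p /\ (\sum_(p <- picks s) F p)%E = F p.
Proof.
move=> us binj s0 F0; have [p ps pf] := ex_first us binj s0; exists p => //; split=> //.
have up : uniq (picks s) by apply: (@map_uniq _ _ fst); rewrite map_fst_picks.
rewrite (bigD1_seq p)//= big1_seq ?adde0// => q /andP[qp qs]; apply: F0.
apply/negP => qf; have psE := perm_mem (perm_picks ps); have qsE := perm_mem (perm_picks qs).
have pq1 : p.1 != q.1.
  apply: contraNneq qp => pq; apply/eqP.
  have : nth q (picks s) (index q (picks s)) = nth q (picks s) (index p (picks s)).
    have := map_fst_picks s => E; move: us; rewrite -{1}E => us.
    congr nth; apply/eqP; rewrite -(nth_uniq q.1 _ _ us) ?size_map ?index_mem//.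
    by rewrite !(nth_map q) ?index_mem// !nth_index// pq.
  by rewrite !nth_index.
have p1q : p.1 \in q.2.
  have : p.1 \in s by rewrite -psE mem_head.
  by rewrite -qsE inE (negbTE pq1).
have q1p : q.1 \in p.2.
  have : q.1 \in s by rewrite -qsE mem_head.
  by rewrite -psE inE eq_sym (negbTE pq1).
by have := lt_trans (allP pf _ q1p) (allP qf _ p1q); rewrite ltxx.
Qed.

End picks_min.

Section first_point.
Local Open Scope ereal_scope.
Context {disp : measure_display} {T : measurableType disp} {R : realType}.
Variables (lam : {nonneg R}) (mu : {finite_measure set T -> \bar R}).
Local Notation Lam := (seq_measure lam mu).
Hypothesis measurable_eq : measurable_fun setT (fun p : T * T => p.1 == p.2).
Hypothesis mu_atomless : forall x, mu [set x] = 0.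
Variables (B : set T) (b : T -> R).
Hypotheses (mB : measurable B) (muB : mu [set x | x \notin B] = 0).
Hypotheses (mb : measurable_fun setT b).
Hypothesis b_inj : forall x y, B x -> B y -> b x = b y -> x = y.

Lemma integral_seq_nil (a : \bar R) : 0 <= a ->
  \int[Lam]_s (if s is [::] then a else 0) = a.
Proof.
move=> a0.
have mf : measurable_fun setT (fun s : seq T => if s is [::] then a else 0).
  rewrite (_ : (fun _ => _) = fun s : seq T => if size s == 0%N then a else 0).
    apply: measurable_fun_ifT => //.
    apply: (measurableT_comp (f := fun n : nat => n == 0%N)) => //.
    exact: measurable_size.
  by apply/funext => -[].
rewrite integral_seq_measure//; last by case.
rewrite (nneseries_split 0 1)//; last first.
  by move=> k _; rewrite mule_ge0 ?lee_fin// integral_ge0// => t _; case: (tval t).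
rewrite add0n [X in _ + X]eseries0 ?adde0; last first.
  by move=> [|k]// _ _; rewrite integral0_eq ?mule0// => -[[]].
rewrite big_mkord big_ord1 integral_tuple_measure0//=.
- by rewrite expr0 divr1 mul1e.
- by move=> t; case: (tval t).
- exact: (measurableT_comp mf (@measurable_tval _ T 0)).
Qed.

Lemma measurable_is_first : measurable_fun setT (is_first b).
Proof.
apply: (@measurable_seq_all _ T _ (T * seq T)%type (fun p y => b p.1 < b y)%R snd) => //.
apply: measurable_fun_ltr; last exact: measurableT_comp.
by apply: (measurableT_comp mb); exact: measurableT_comp.
Qed.

(** On a nonempty sequence of distinct points of B, summing over the picks that select the first
    point gives [Psi] once, by symmetry. Mecke then extracts that point; the empty sequence is the
    separate term. *)
Lemma first_point_decomposition (Psi : seq T -> \bar R) :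
  (forall s, 0 <= Psi s) -> measurable_fun setT Psi ->
  (forall s s', perm_eq s s' -> Psi s = Psi s') ->
  \int[Lam]_s Psi s = Psi [::] + lam%:num%:E *
    \int[mu]_x \int[Lam]_w (((is_first b (x, w))%:R : R)%:E * Psi (x :: w)).
Proof.
move=> Psi0 mPsi permPsi.
pose g (p : T * seq T) := ((is_first b p)%:R : R)%:E * Psi (p.1 :: p.2).
have g0 p : 0 <= g p by rewrite mule_ge0// lee_fin.
have mg : measurable_fun setT g.
  apply: emeasurable_funM; first exact: measurable_b2e measurable_is_first.
  by apply: (measurableT_comp mPsi); exact: measurable_seq_cons.
rewrite -(integral_seq_nil (Psi0 [::])) -(@mecke _ _ _ lam mu g)//.
have mnil : measurable_fun setT (fun s : seq T => if s is [::] then Psi [::] else 0).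
  rewrite (_ : (fun _ => _) = fun s : seq T => if size s == 0%N then Psi [::] else 0).
    apply: measurable_fun_ifT => //.
    apply: (measurableT_comp (f := fun n : nat => n == 0%N)) => //.
    exact: measurable_size.
  by apply/funext => -[].
have mpick : measurable_fun setT (fun s => \sum_(p <- picks s) g p).
  exact: measurable_sum_picks.
rewrite -ge0_integralD//=; last 2 first.
- by move=> s _; case: s.
- by move=> s _; exact: sume_ge0.
apply: (@seq_measure_ae_eq _ _ _ lam mu measurable_eq mu_atomless (fun x => x \in B)) => //.
- exact/measurable_setP.
- by move=> s; rewrite adde_ge0//; [case: s|exact: sume_ge0].
- exact: emeasurable_funD.
move=> s us /allP sB; have [->|s0] := eqVneq s [::]; first by rewrite /= big_nil adde0.
rewrite (_ : (if s is [::] then _ else _) = 0) ?add0e; last by case: s s0 {us sB}.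
have binj : {in s &, injective b}.
  by move=> x y xs ys; apply: b_inj; apply/set_mem; exact: sB.
have [|p ps [pf ->]] := @sum_picks_first _ _ b s g us binj s0.
  by move=> p /negbTE pf; rewrite /g pf mul0e.
by rewrite /g pf mul1e; apply: permPsi; rewrite perm_sym perm_picks.
Qed.

End first_point.

Section partition.
Context {R : realType} {d : nat}.
Local Notation E := (d.-tuple R).
Variables (r : R) (lam : {nonneg R}) (B : set E) (b : E -> R).
Variable mu : {finite_measure set E -> \bar R}.
Hypotheses (d_gt0 : (0 < d)%N) (mB : measurable B) (mb : measurable_fun setT b).
Hypothesis muE : forall A, measurable A -> mu A = volume (A `&` B).
Hypothesis b_inj : forall x y, B x -> B y -> b x = b y -> x = y.
Local Notation Lam := (seq_measure lam mu).
Implicit Types (x y : E) (s c u w : seq E) (t : R).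

Definition above t : set E := [set y | B y /\ t < b y].

(* Z(]t, oo[, c) and the retention probability of x when c lists the boundary condition
   together with the points retained before x. *)
Definition partition_above t c : R := fine (Lam [set s | inside r (above t) s c]).

Definition retain x c : R :=
  (hard_coreb r [:: x] c)%:R * (partition_above (b x) (x :: c) / partition_above (b x) c).

Lemma in_above t x : (x \in above t) = (x \in B) && (t < b x).
Proof.
apply/idP/andP => [/set_mem[Bx tx]|[/set_mem Bx tx]]; first by split=> //; exact/mem_set.
exact/mem_set.
Qed.

Let measurable_in_above d' (X : measurableType d') (t : X -> R) (x : X -> E) :
  measurable_fun setT t -> measurable_fun setT x ->
  measurable_fun setT (fun a => x a \in above (t a)).
Proof.
move=> mt mx; under eq_fun do rewrite in_above.
apply: measurable_and; last by apply: measurable_fun_ltr => //; exact: measurableT_comp.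
by apply: (measurableT_comp (f := fun x => x \in B)) => //; exact/measurable_setP.
Qed.

Lemma measurable_above t : measurable (above t).
Proof.
by apply/measurable_setP; apply: measurable_in_above => //; exact: measurable_cst.
Qed.

Lemma measurable_inside_above d' (X : measurableType d') (t : X -> R) (s c : X -> seq E) :
  measurable_fun setT t -> measurable_fun setT s -> measurable_fun setT c ->
  measurable_fun setT (fun a => inside r (above (t a)) (s a) (c a)).
Proof.
move=> mt ms mc; apply: measurable_and; last exact: measurable_hard_coreb.
apply: (@measurable_seq_all _ E _ X (fun a x => x \in above (t a))) => //.
by apply: measurable_in_above => //; exact: measurableT_comp.
Qed.

Lemma measurable_partition_above d' (X : measurableType d') (t : X -> R) (c : X -> seq E) :
  measurable_fun setT t -> measurable_fun setT c ->
  measurable_fun setT (fun a => partition_above (t a) (c a)).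
Proof.
move=> mt mc; apply: measurableT_comp; first exact: fine_measurable.
pose A := [set p : X * seq E | inside r (above (t p.1)) p.2 (c p.1)].
have mA : measurable A.
  by apply: measurable_bool_set; apply: measurable_inside_above => //; exact: measurableT_comp.
have := @measurable_fun_xsection _ _ _ _ _ Lam A mA.
rewrite (_ : _ \o _ = fun a => Lam [set s | inside r (above (t a)) s (c a)])//.
apply/funext => a /=; congr (Lam _); apply/seteqP; split=> s /=.
  by move/xsectionP.
by move=> H; apply/xsectionP.
Qed.

Lemma inside_above_eq t s s' c c' : s =i s' -> c =i c' ->
  inside r (above t) s c = inside r (above t) s' c'.
Proof. by move=> ss cc; rewrite /inside (eq_all_r ss) (eq_hard_coreb _ ss cc). Qed.

Lemma eq_partition_above t c c' : c =i c' -> partition_above t c = partition_above t c'.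
Proof.
move=> cc; congr (fine (Lam _)); apply/seteqP; split=> s /=;
  by rewrite (@inside_above_eq t s s c c').
Qed.

Lemma eq_retain x c c' : c =i c' -> retain x c = retain x c'.
Proof.
move=> cc; rewrite /retain (eq_hard_coreb _ (fun=> erefl) cc) (eq_partition_above _ cc).
by congr (_ * (_ / _)); apply: eq_partition_above => y; rewrite !inE cc.
Qed.

Let measurable_inside1 t c : measurable [set s | inside r (above t) s c].
Proof.
apply: measurable_bool_set; apply: measurable_inside_above => //; exact: measurable_cst.
Qed.

Lemma partition_aboveE t c : Lam [set s | inside r (above t) s c] = (partition_above t c)%:E.
Proof. by rewrite /partition_above fineK// fin_num_measure. Qed.

Lemma partition_above_le_cons t x c : partition_above t (x :: c) <= partition_above t c.
Proof.
rewrite -lee_fin -!partition_aboveE; apply: le_measure; rewrite ?inE//.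
by move=> s /= /andP[h1 /hard_coreb_consr h2]; apply/andP.
Qed.

Lemma partition_above_le t c : partition_above t c <= expR (lam%:num * fine (mu setT)).
Proof.
rewrite -lee_fin -partition_aboveE -seq_measure_setT; apply: le_measure; rewrite ?inE//.
Qed.

Lemma partition_above_ge0 t c : 0 <= partition_above t c.
Proof. by rewrite fine_ge0. Qed.

(** Once x is the first point, the others lie above t exactly when they lie above x, and x joins
    their boundary condition. *)
Let partition_above_rec0 t c : (partition_above t c)%:E = (1 + lam%:num%:E *
  \int[mu]_x (((x \in above t) && hard_coreb r [:: x] c)%:R * partition_above (b x) (x :: c))%:E)%E.
Proof.
pose Psi s : \bar R := ((inside r (above t) s c)%:R : R)%:E.
have mPsi : measurable_fun setT Psi.
  by apply: measurable_b2e; apply: measurable_inside_above => //; exact: measurable_cst.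
have intE t' c' (k : R) : 0 <= k ->
    (\int[Lam]_w (k * (inside r (above t') w c')%:R)%:E = (k * partition_above t' c')%:E)%E.
  move=> k0; under eq_integral do rewrite EFinM.
  rewrite ge0_integralZl_EFin//; last first.
    by apply: measurable_b2e; apply: measurable_inside_above => //; exact: measurable_cst.
  rewrite EFinM -partition_aboveE; congr (_ * _)%E.
  rewrite -[in RHS](setIT [set s | inside r (above t') s c']) -integral_indic//.
  apply: eq_integral => s _; rewrite indicE; congr (nat_of_bool _)%:R%:E.
  by apply/idP/idP; rewrite inE.
have -> : (partition_above t c)%:E = (\int[Lam]_s Psi s)%E.
  rewrite -[partition_above t c]mul1r -intE//; apply: eq_integral => s _.
  by rewrite mul1r.
have mu1 x : mu [set x] = 0%E by exact: mu_set1 mB _ muE _ d_gt0.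
have muC : mu [set x | x \notin B] = 0%E by exact: mu_setC mB _ muE.
rewrite (first_point_decomposition lam measurable_tuple_eq mu1 mB muC mb b_inj)//; last 2 first.
- by move=> s; rewrite lee_fin.
- by move=> s s' /perm_mem ss'; rewrite /Psi (inside_above_eq t ss' (fun=> erefl)).
congr (_ + _ * _)%E.
apply: eq_integral => x _; rewrite -intE//; apply: eq_integral => w _.
rewrite /Psi -EFinM; congr EFin; rewrite -!natrM !mulnb; congr (_%:R).
congr nat_of_bool.
have [bxw|] := boolP (is_first b (x, w)); last first.
  move=> nbx; rewrite /=; case: (boolP (x \in above t)) => //= xt; apply/esym/negP.
  move=> /andP[_ /andP[/allP H _]]; move/negP: nbx; apply; apply/allP => y /H.
  by rewrite in_above => /andP[].
have xw : x \notin w by apply/negP => /(allP bxw) /=; rewrite ltxx.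
rewrite /inside /= hard_coreb_cons// [LHS]/=; case: (boolP (x \in above t)) => //=.
rewrite in_above => /andP[_ tx].
rewrite (@eq_in_all _ _ (fun y => y \in above (b x)) w); last first.
  move=> y yw; rewrite !in_above (allP bxw)// (lt_trans tx) ?(allP bxw)//.
by rewrite andbCA.
Qed.

(** The empty sequence alone contributes 1, so the quotients defining the retention probabilities
    are genuine. *)
Lemma partition_above_ge1 t c : 1 <= partition_above t c.
Proof.
rewrite -lee_fin partition_above_rec0 leeDl// mule_ge0 ?lee_fin// integral_ge0// => x _.
by rewrite lee_fin mulr_ge0// partition_above_ge0.
Qed.

Lemma partition_above_gt0 t c : 0 < partition_above t c.
Proof. exact: lt_le_trans ltr01 (partition_above_ge1 t c). Qed.

Lemma retain_ge0 x c : 0 <= retain x c.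
Proof. by rewrite mulr_ge0// divr_ge0// partition_above_ge0. Qed.

Lemma retain_le1 x c : retain x c <= 1.
Proof.
rewrite /retain; case: (hard_coreb _ _ _); rewrite ?mul0r// mul1r.
by rewrite ler_pdivrMr ?partition_above_gt0// mul1r partition_above_le_cons.
Qed.

Lemma measurable_retain d' (X : measurableType d') (x : X -> E) (c : X -> seq E) :
  measurable_fun setT x -> measurable_fun setT c ->
  measurable_fun setT (fun a => retain (x a) (c a)).
Proof.
move=> mx mc; have mbx : measurable_fun setT (fun a => b (x a)) by exact: measurableT_comp.
apply: measurable_funM.
  apply: measurable_b2r; apply: measurable_hard_coreb => //.
  by apply: measurable_seq_cons => //; exact: measurable_cst.
apply: measurable_funM; first by apply: measurable_partition_above => //; exact: measurable_seq_cons.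
rewrite (_ : (fun _ => _) = fun a => expR (- ln (partition_above (b (x a)) (c a)))).
  apply: (measurableT_comp (@measurable_expR R)); apply: measurable_funN.
  by apply: (measurableT_comp (@measurable_ln R)); exact: measurable_partition_above.
by apply/funext => a; rewrite expRN lnK// posrE partition_above_gt0.
Qed.

(** By its definition, [retain x c] trades the partition function with boundary [x :: c] for the one
    with boundary c. This yields a closed linear equation in which c stays fixed. *)
Lemma partition_above_rec t c : (partition_above t c)%:E = (1 + lam%:num%:E *
  \int[mu]_x ((x \in above t)%:R * retain x c * partition_above (b x) c)%:E)%E.
Proof.
rewrite partition_above_rec0; congr (_ + _ * _)%E; apply: eq_integral => x _; congr EFin.
by rewrite /retain -mulrA -mulrA divfK ?gt_eqF ?partition_above_gt0// -mulnb natrM mulrA.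
Qed.

End partition.

(** * A linear integral equation and its exponential solution *)

Section picard.
Import numFieldNormedType.Exports.
Local Open Scope ereal_scope.
Context {disp : measure_display} {T : measurableType disp} {R : realType}.
Variables (lam : {nonneg R}) (mu : {finite_measure set T -> \bar R}).
Local Notation Lam := (seq_measure lam mu).
Hypothesis measurable_eq : measurable_fun setT (fun p : T * T => p.1 == p.2).
Hypothesis mu_atomless : forall x, mu [set x] = 0.
Variables (B : set T) (b : T -> R).
Hypotheses (mB : measurable B) (muB : mu [set x | x \notin B] = 0).
Hypotheses (mb : measurable_fun setT b).
Hypothesis b_inj : forall x y, B x -> B y -> b x = b y -> x = y.

Lemma integral_seq_measure_size n (f : seq T -> \bar R) :
  (forall s, 0 <= f s) -> measurable_fun setT f ->
  \int[Lam]_s (if size s == n then f s else 0) =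
  (poisson_weight lam n)%:num%:E * \int[tuple_measure mu n]_t f t.
Proof.
move=> f0 mf.
have mg : measurable_fun setT (fun s => if size s == n then f s else 0).
  apply: measurable_fun_ifT => //.
  apply: (measurableT_comp (f := fun k : nat => k == n)) => //.
  exact: measurable_size.
have g0 s : 0 <= if size s == n then f s else 0 by case: ifP.
rewrite integral_seq_measure// (nneseries_split 0 n.+1)//; last first.
  by move=> k _; rewrite mule_ge0 ?lee_fin// integral_ge0.
have z k : k != n -> \int[tuple_measure mu k]_t (if size t == n then f t else 0) = 0.
  by move=> kn; rewrite integral0_eq// => t _; rewrite size_tuple (negbTE kn).
rewrite add0n [X in _ + X]eseries0 ?adde0; last first.
  by move=> k kn _; rewrite z ?mule0// gtn_eqF.
rewrite big_mkord big_ord_recr/= big1 ?add0e.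
  by congr (_ * _); apply: eq_integral => t _; rewrite size_tuple eqxx.
by move=> k _; rewrite z ?mule0// ltn_eqF.
Qed.

Variables (q : T -> R) (Z : R -> R) (M : R).
Hypotheses (q0 : forall x, (0 <= q x)%R) (q1 : forall x, (q x <= 1)%R).
Hypothesis mq : measurable_fun setT q.
Hypotheses (Z0 : forall t, (0 <= Z t)%R) (ZM : forall t, (Z t <= M)%R).
Hypothesis mZ : measurable_fun setT Z.

Definition above_part (t : R) (x : T) : R := ((t < b x)%R%:R * q x)%R.

Local Notation h := above_part.

Hypothesis ZE : forall t, (Z t)%:E = 1 + lam%:num%:E * \int[mu]_x (h t x * Z (b x))%:E.

Lemma above_part_ge0 t x : (0 <= h t x)%R.
Proof. by rewrite mulr_ge0. Qed.

Let mh d' (X : measurableType d') (t : X -> R) (x : X -> T) :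
  measurable_fun setT t -> measurable_fun setT x ->
  measurable_fun setT (fun a => h (t a) (x a)).
Proof.
move=> mt mx; apply: measurable_funM; last exact: measurableT_comp.
by apply: measurable_b2r; apply: measurable_fun_ltr => //; exact: measurableT_comp.
Qed.

Let mh1 t : measurable_fun setT (h t).
Proof. by apply: mh => //; exact: measurable_cst. Qed.

Definition above_integral (t : R) : R := fine (\int[mu]_x (h t x)%:E).

Local Notation I := above_integral.

Lemma above_integralE t : \int[mu]_x (h t x)%:E = (I t)%:E.
Proof.
rewrite fineK// ge0_fin_numE; last first.
  by apply: integral_ge0 => x _; rewrite lee_fin above_part_ge0.
apply: (@le_lt_trans _ _ (\int[mu]_x (cst 1 x))).
  apply: ge0_le_integral => //.
  - by move=> x _; rewrite lee_fin above_part_ge0.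
  - by apply/measurable_EFinP; exact: mh1.
  - move=> x _; rewrite lee_fin /h; case: (_ < _)%R; rewrite ?mul0r ?mul1r//.
rewrite integral_cst// mul1e ltey_eq.
by rewrite fin_num_measure.
Qed.

Let a n t : \bar R := ((lam%:num * I t) ^+ n / n`!%:R)%:E.

Let I0 t : (0 <= I t)%R.
Proof.
by apply: fine_ge0; apply: integral_ge0 => x _; rewrite lee_fin above_part_ge0.
Qed.

Let a_ge0 n t : 0 <= a n t.
Proof. by rewrite lee_fin divr_ge0// exprn_ge0// mulr_ge0. Qed.

Let mprod t : measurable_fun setT (fun s : seq T => (\prod_(x <- s) h t x)%:E).
Proof.
apply/measurable_EFinP; apply: (@measurable_seq_prod _ T _ _ R (fun=> h t) id) => //.
exact: measurableT_comp.
Qed.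

Let prod_ge0 t (s : seq T) : 0 <= (\prod_(x <- s) h t x)%:E.
Proof. by rewrite lee_fin prodr_ge0// => x _; exact: above_part_ge0. Qed.

Let aE n t :
  \int[Lam]_s (if size s == n then (\prod_(x <- s) h t x)%:E else 0) = a n t.
Proof.
rewrite integral_seq_measure_size//.
rewrite (integral_tuple_measure_prod _ _ (mh1 t) (above_integralE t)); last first.
  by move=> x; exact: above_part_ge0.
by rewrite -EFinM /a /= exprMn mulrAC.
Qed.

(** This replaces differentiating a power of I: [a n] is the product functional on sequences of
    length n, and the decomposition at the first point removes one of them. *)
Let a_rec n t : a n.+1 t = lam%:num%:E * \int[mu]_x ((h t x)%:E * a n (b x)).
Proof.
pose Psi (s : seq T) := if size s == n.+1 then (\prod_(x <- s) h t x)%:E else 0.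
have mif k t' : measurable_fun setT
    (fun s : seq T => if size s == k then (\prod_(x <- s) h t' x)%:E else 0).
  apply: measurable_fun_ifT => //.
  apply: (measurableT_comp (f := fun j : nat => j == k)) => //.
  exact: measurable_size.
rewrite -aE -/(Psi _).
rewrite (first_point_decomposition lam measurable_eq mu_atomless mB muB mb b_inj (Psi := Psi))//.
- rewrite /Psi/= add0e; congr (_ * _); apply: eq_integral => x _.
  rewrite -aE -ge0_integralZl_EFin//; last 2 first.
  + by move=> s _; case: ifP.
  + exact: above_part_ge0.
  apply: eq_integral => w _; rewrite eqSS; case: ifP => _; last by rewrite !mule0.
  rewrite big_cons -!EFinM; congr EFin.
  have [tx|tx] := boolP (t < b x)%R; last by rewrite /h (negbTE tx) !mul0r mulr0.
  rewrite mulrCA; congr (_ * _)%R.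
  have [bxw|/allPn[y yw nxy]] := boolP (is_first b (x, w)).
    rewrite mul1r; apply: eq_big_seq => y /(allP bxw) /= xy.
    by rewrite /h xy (lt_trans tx xy).
  by rewrite mul0r (big_rem y)//= /h (negbTE nxy) !mul0r.
- by move=> s; rewrite /Psi; case: ifP.
- exact: mif.
- move=> s s' ss'; rewrite /Psi (perm_size ss'); case: ifP => // _.
  by rewrite (perm_big _ ss').
Qed.

(** The n-th iterate of the integral operator on Z, which is the remainder after n terms. *)
Let D := fix D n (t : R) : \bar R :=
  if n is m.+1 then lam%:num%:E * \int[mu]_x ((h t x)%:E * D m (b x))
  else (Z t)%:E.

Let hD_ge0 n : (forall t, 0 <= D n t) -> forall t x, 0 <= (h t x)%:E * D n (b x).
Proof. by move=> D0 t x; rewrite mule_ge0// lee_fin above_part_ge0. Qed.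

Let D_ge0 n t : 0 <= D n t.
Proof.
elim: n t => [|n IH] t /=; first by rewrite lee_fin.
by rewrite mule_ge0 ?lee_fin// integral_ge0// => x _; exact: hD_ge0.
Qed.

Let measurable_D n : measurable_fun setT (D n).
Proof.
elim: n => [|n IH]; first exact/measurable_EFinP.
apply: measurable_funeM.
have H := @measurable_fun_fubini_tonelli_F _ _ _ _ _ mu
  (fun p : R * T => (h p.1 p.2)%:E * D n (b p.2)).
apply: H => [|[t x]]; last exact: hD_ge0.
apply: emeasurable_funM; first by apply/measurable_EFinP; exact: mh.
by apply: (measurableT_comp IH); exact: measurableT_comp.
Qed.

Let mhb (f : R -> \bar R) t : measurable_fun setT f ->
  measurable_fun setT (fun x => (h t x)%:E * f (b x)).
Proof.
move=> mf; apply: emeasurable_funM; first by apply/measurable_EFinP; exact: mh1.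
exact: measurableT_comp.
Qed.

Let measurable_a n : measurable_fun setT (a n).
Proof.
apply/measurable_EFinP; apply: measurable_funM => //; apply: measurable_funX.
apply: measurable_funM => //; apply: measurableT_comp; first exact: fine_measurable.
have H := @measurable_fun_fubini_tonelli_F _ _ _ _ _ mu (fun p : R * T => (h p.1 p.2)%:E).
apply: H => [|[t x]]; last by rewrite lee_fin above_part_ge0.
by apply/measurable_EFinP; exact: mh.
Qed.

Let D_split n t : D n t = a n t + D n.+1 t.
Proof.
elim: n t => [|n IH] t.
  by rewrite /= ZE /a expr0 divr1; congr (1 + _ * _).
have -> : D n.+2 t = lam%:num%:E * \int[mu]_x ((h t x)%:E * D n.+1 (b x)) by [].
have -> : D n.+1 t = lam%:num%:E * \int[mu]_x ((h t x)%:E * D n (b x)) by [].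
rewrite a_rec.
rewrite -ge0_muleDr; last 2 first.
- by apply: integral_ge0 => x _; rewrite mule_ge0// lee_fin above_part_ge0.
- by apply: integral_ge0 => x _; exact: hD_ge0.
congr (_ * _); rewrite -ge0_integralD//; last 4 first.
- by move=> x _; rewrite mule_ge0// lee_fin above_part_ge0.
- exact: mhb.
- by move=> x _; exact: hD_ge0.
- exact: mhb.
by apply: eq_integral => x _; rewrite IH ge0_muleDr.
Qed.

(** The operator is monotone and linear, Z is at most M, and the n-th iterate of 1 is [a n]. *)
Let D_le n t : D n t <= M%:E * a n t.
Proof.
have M0 : (0 <= M)%R := le_trans (Z0 0) (ZM 0).
elim: n t => [|n IH] t; first by rewrite /a expr0 divr1 mule1 lee_fin.
rewrite [D _ _]/= a_rec muleCA lee_wpmul2l ?lee_fin//.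
rewrite -ge0_integralZl//; last 2 first.
- exact: mhb.
- by move=> x _; rewrite mule_ge0// lee_fin above_part_ge0.
apply: ge0_le_integral => //.
- by move=> x _; exact: hD_ge0.
- exact: mhb.
- by apply: measurable_funeM; exact: mhb.
- by move=> x _; rewrite muleCA lee_wpmul2l// lee_fin above_part_ge0.
Qed.

Let Z_partial n t : (Z t)%:E = \sum_(k < n) a k t + D n t.
Proof.
elim: n => [|n IH]; first by rewrite big_ord0 add0e.
by rewrite big_ord_recr/= -addeA -[_ + lam%:num%:E * _]D_split.
Qed.

(* Iterating the integral equation for [Z] produces the partial sums of the exponential
   series, with a remainder at most [M] times the next term. *)
Lemma picard_exponential t : Z t = expR (lam%:num * I t).
Proof.
set x := (lam%:num * I t)%R.
have lo n : (series (exp_coeff x) n <= Z t)%R.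
  rewrite -lee_fin (Z_partial n) /series/= big_mkord -sumEFin leeDl//.
have hi n : (Z t <= series (exp_coeff x) n + M * exp_coeff x n)%R.
  rewrite -lee_fin (Z_partial n) EFinD /series/= big_mkord -sumEFin EFinM.
  exact: leeD2l.
have cs := @is_cvg_series_exp_coeff R x.
have c0 := cvg_series_cvg_0 cs.
apply/eqP; rewrite eq_le; apply/andP; split.
  rewrite -[expR x]addr0 -(mulr0 M).
  have : (series (exp_coeff x) n + M * exp_coeff x n)%R @[n --> \oo] --> (expR x + M * 0)%R.
    by apply: cvgD; [exact: cs|exact: (cvgM (cvg_cst M) c0)].
  by move/cvgr_to_ge; apply; apply: nearW.
by move/cvgr_to_le : cs; apply; apply: nearW.
Qed.

End picard.

(** * Weights of the thinning *)

Section weights.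
Context {R : realType} {d : nat}.
Local Notation E := (d.-tuple R).
Variables (r : R) (lam : {nonneg R}) (B : set E) (b : E -> R).
Variable mu : {finite_measure set E -> \bar R}.
Hypotheses (d_gt0 : (0 < d)%N) (mB : measurable B) (mb : measurable_fun setT b).
Hypothesis muE : forall A, measurable A -> mu A = volume (A `&` B).
Hypothesis b_inj : forall x y, B x -> B y -> b x = b y -> x = y.
Local Notation Lam := (seq_measure lam mu).
Local Notation above := (above B b).
Local Notation partition_above := (partition_above r lam B b mu).
Local Notation retain := (retain r lam B b mu).
Implicit Types (x y : E) (s c u w : seq E) (t : R).

Definition retain_given c u x : R := retain x (c ++ [seq y <- u | b y < b x]).

Definition split_weight c u w : R :=
  \prod_(x <- u) retain_given c u x * \prod_(x <- w) (1 - retain_given c u x).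

Lemma retain_given_ge0 c u x : 0 <= retain_given c u x.
Proof. exact: retain_ge0. Qed.

Lemma retain_given_le1 c u x : retain_given c u x <= 1.
Proof. exact: (retain_le1 r lam d_gt0 mB mb muE b_inj). Qed.

Lemma split_weight_ge0 c u w : 0 <= split_weight c u w.
Proof.
rewrite mulr_ge0// prodr_ge0// => x _; first exact: retain_given_ge0.
by rewrite subr_ge0 retain_given_le1.
Qed.

Lemma measurable_retain_given d' (X : measurableType d') (c u : X -> seq E) (x : X -> E) :
  measurable_fun setT c -> measurable_fun setT u -> measurable_fun setT x ->
  measurable_fun setT (fun a => retain_given (c a) (u a) (x a)).
Proof.
move=> mc mu' mx; apply: (measurable_retain r lam d_gt0 mB mb muE b_inj) => //.
apply: measurable_seq_cat => //.
apply: (@measurable_seq_filter _ E _ X (fun a y => b y < b (x a))) => //.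
by apply: measurable_fun_ltr; apply: measurableT_comp => //; exact: measurableT_comp.
Qed.

Lemma measurable_split_weight d' (X : measurableType d') (c u w : X -> seq E) :
  measurable_fun setT c -> measurable_fun setT u -> measurable_fun setT w ->
  measurable_fun setT (fun a => split_weight (c a) (u a) (w a)).
Proof.
move=> mc mu' mw; apply: measurable_funM.
  apply: (@measurable_seq_prod _ E _ X R (fun a x => retain_given (c a) (u a) x)) => //.
  by apply: measurable_retain_given => //; exact: measurableT_comp.
apply: (@measurable_seq_prod _ E _ X R (fun a x => 1 - retain_given (c a) (u a) x)) => //.
by apply: measurable_funB => //; apply: measurable_retain_given => //; exact: measurableT_comp.
Qed.

Lemma eq_retain_given c u u' x : u =i u' -> retain_given c u x = retain_given c u' x.
Proof. by move=> uu'; apply: eq_retain => y; rewrite !mem_cat !mem_filter uu'. Qed.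

(* With the points in decreasing order, the head of s influences no other factor, and its own
   two factors add up to 1. *)
Lemma sum_split_weight_sorted c s : pairwise (fun x y => b y < b x) s ->
  \sum_(p <- splits s) split_weight c p.1 p.2 = 1.
Proof.
elim: s => [|x s IH]; first by rewrite /= big_seq1 /split_weight !big_nil mulr1.
rewrite pairwise_cons => /andP[/allP xs sorted_s].
rewrite sum_splits_cons -big_split/= -(IH sorted_s).
apply: eq_big_seq => p /perm_splits/perm_mem ps.
have filt y : y \in s -> [seq z <- x :: p.1 | b z < b y] = [seq z <- p.1 | b z < b y].
  by move=> /xs yx; rewrite /= ltNge (ltW yx).
have filtx : [seq z <- x :: p.1 | b z < b x] = [seq z <- p.1 | b z < b x].
  by rewrite /= ltxx.
have p1s y : y \in p.1 -> y \in s by rewrite -ps mem_cat => ->.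
have p2s y : y \in p.2 -> y \in s by rewrite -ps mem_cat orbC => ->.
rewrite /split_weight !big_cons.
have -> : retain_given c (x :: p.1) x = retain_given c p.1 x by rewrite /retain_given filtx.
rewrite (eq_big_seq (retain_given c p.1)); last by move=> y /p1s ys; rewrite /retain_given filt.
rewrite [X in _ * _ * X + _](eq_big_seq (fun y => 1 - retain_given c p.1 y)); last first.
  by move=> y /p2s ys; rewrite /retain_given filt.
by ring.
Qed.

Definition real_integral (f : E -> R) : R := fine (\int[mu]_x (f x)%:E).

Section real_integral.
Variables f g : E -> R.
Hypotheses (mf : measurable_fun setT f) (mg : measurable_fun setT g).
Hypotheses (f0 : forall x, 0 <= f x) (g0 : forall x, 0 <= g x).
Hypotheses (f1 : forall x, f x <= 1) (g1 : forall x, g x <= 1).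

Lemma real_integralE (k : E -> R) : measurable_fun setT k -> (forall x, 0 <= k x) ->
  (forall x, k x <= 1) -> (\int[mu]_x (k x)%:E = (real_integral k)%:E)%E.
Proof.
move=> mk k0 k1; rewrite fineK// ge0_fin_numE; last first.
  by apply: integral_ge0 => x _; rewrite lee_fin.
apply: (@le_lt_trans _ _ (\int[mu]_x (cst 1 x))%E).
  apply: ge0_le_integral => //; first by move=> x _; rewrite lee_fin.
    exact/measurable_EFinP.
  by move=> x _; rewrite lee_fin.
by rewrite integral_cst// mul1e ltey_eq fin_num_measure.
Qed.

Lemma real_integralD : real_integral (fun x => f x + g x) = real_integral f + real_integral g.
Proof.
rewrite {1}/real_integral (_ : (\int[mu]_x _)%E = (real_integral f)%:E + (real_integral g)%:E)%E//.
rewrite -!real_integralE// -ge0_integralD//=;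
  try by [move=> x _; rewrite lee_fin|exact/measurable_EFinP].
Qed.

End real_integral.

Let ind_pr t c u x : R := (x \in above t)%:R * retain_given c u x.

Let measurable_ind t : measurable_fun setT (fun x => (x \in above t)%:R : R).
Proof. by apply: measurable_b2r; apply/measurable_setP; exact: measurable_above. Qed.

Let measurable_pr1 c u : measurable_fun setT (retain_given c u).
Proof. by apply: measurable_retain_given => //; exact: measurable_cst. Qed.

Lemma partition_above_exp t c :
  partition_above t c = expR (lam%:num * real_integral (fun x => (x \in above t)%:R * retain x c)).
Proof.
pose q x := (x \in B)%:R * retain x c.
have mq : measurable_fun setT q.
  apply: measurable_funM; first by apply: measurable_b2r; exact/measurable_setP.
  by apply: (measurable_retain r lam d_gt0 mB mb muE b_inj) => //; exact: measurable_cst.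
have q0 x : 0 <= q x by rewrite mulr_ge0// retain_ge0.
have q1 x : q x <= 1.
  rewrite /q; case: (x \in B); rewrite ?mul0r ?mul1r//.
  exact: (retain_le1 r lam d_gt0 mB mb muE b_inj).
have mu1 x : mu [set x] = 0%E by exact: mu_set1 mB _ muE _ d_gt0.
have muC : mu [set x | x \notin B] = 0%E by exact: mu_setC mB _ muE.
(* The uniform bound on the partition functions is the total mass of [Lam]. *)
rewrite (@picard_exponential _ _ _ lam mu measurable_tuple_eq mu1 B b mB muC mb b_inj
  q (partition_above ^~ c) (expR (lam%:num * fine (mu setT))))//.
- congr (expR (_ * fine _)); apply: eq_integral => x _; congr EFin.
  by rewrite /above_part /q in_above andbC -mulnb natrM mulrA.
- by move=> t'; exact: partition_above_ge0.
- by move=> t'; exact: partition_above_le.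
- by apply: measurable_partition_above => //; exact: measurable_cst.
- move=> t'; rewrite (partition_above_rec r lam d_gt0 mB mb muE b_inj); congr (_ + _ * _)%E.
  apply: eq_integral => x _; congr EFin.
  by rewrite /above_part /q in_above andbC -mulnb natrM !mulrA.
Qed.

(* By induction on u: its first point x is retained given c alone, the other points see
   [x :: c], and the points between t and x contribute a quotient of partition functions
   to the exponential. *)
Lemma prod_retain_given_exp t c u : pairwise (fun x y => b x < b y) u -> all (fun x => t < b x) u ->
  \prod_(x <- u) retain_given c u x * expR (- (lam%:num * real_integral (ind_pr t c u))) =
  (hard_coreb r u c)%:R / partition_above t c.
Proof.
have indE t' y : (y \in above t')%:R = (y \in B)%:R * (t' < b y)%R%:R :> R.
  by rewrite in_above -mulnb natrM.
have bnd (b1 : bool) (z : R) : 0 <= z -> z <= 1 -> 0 <= b1%:R * z <= 1.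
  by case: b1; rewrite ?mul0r ?mul1r => *; apply/andP.
elim: u t c => [|x u IH] t c.
  move=> _ _; rewrite big_nil !mul1r partition_above_exp expRN; congr (expR (_ * fine _))^-1.
  by apply: eq_integral => x _; rewrite /ind_pr /retain_given cats0.
rewrite pairwise_cons => /andP[/allP xu sorted_u] /= /andP[tx /allP tu].
have xNu : x \notin u by apply/negP => /xu; rewrite ltxx.
have filtlow y : b y <= b x -> [seq z <- x :: u | b z < b y] = [::].
  move=> yx; rewrite /= ltNge yx /=; apply/eqP; rewrite -[_ == _]negbK -has_filter.
  apply/hasPn => z /xu xz; rewrite -leNgt; exact: le_trans yx (ltW xz).
have prlow y : b y <= b x -> retain_given c (x :: u) y = retain y c.
  by move=> yx; rewrite /retain_given filtlow// cats0.
have prhigh y : b x < b y -> retain_given c (x :: u) y = retain_given (x :: c) u y.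
  move=> xy; rewrite /retain_given /= xy; apply: eq_retain => z.
  by rewrite /= !(inE, mem_cat) orbCA.
rewrite big_cons prlow// (eq_big_seq (retain_given (x :: c) u)); last first.
  by move=> y /xu; exact: prhigh.
(* Points up to x see only c, with or without x retained, so [mid] is common to both integrals
   below. Beyond x, [hi] ignores x; it enters only to express the exponential of [mid] as a
   quotient. *)
pose mid y := ((y \in above t) && (b y <= b x))%:R * retain y c.
pose hi y := (y \in above (b x))%:R * retain y c.
have mret : measurable_fun setT (retain^~ c).
  by apply: (measurable_retain r lam d_gt0 mB mb muE b_inj) => //; exact: measurable_cst.
have mle : measurable_fun setT (fun y => b y <= b x).
  by apply: measurable_fun_ler => //; exact: measurable_cst.
have mmid : measurable_fun setT mid.
  apply: measurable_funM => //; apply: measurable_b2r; apply: measurable_and => //.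
  by apply/measurable_setP; exact: measurable_above.
have ret0 y c' : 0 <= retain y c' by exact: retain_ge0.
have ret1 y c' : retain y c' <= 1 by exact: (retain_le1 r lam d_gt0 mB mb muE b_inj).
have mid01 y : 0 <= mid y <= 1 by apply: bnd.
have hi01 y : 0 <= hi y <= 1 by apply: bnd.
have ind01 t' c' u' y : 0 <= ind_pr t' c' u' y <= 1.
  by apply: bnd; [exact: retain_given_ge0|exact: retain_given_le1].
have J1 : real_integral (ind_pr t c (x :: u)) =
    real_integral mid + real_integral (ind_pr (b x) (x :: c) u).
  rewrite -real_integralD//; [|exact: measurable_funM|by move=> y; case/andP: (mid01 y)|
    by move=> y; case/andP: (ind01 (b x) (x :: c) u y)|by move=> y; case/andP: (mid01 y)|
    by move=> y; case/andP: (ind01 (b x) (x :: c) u y)].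
  congr (fine _); apply: eq_integral => y _; congr EFin; rewrite /ind_pr /mid !in_above.
  case: (leP (b y) (b x)) => yx; last first.
    by rewrite prhigh// (lt_trans tx yx) !andbT andbF mul0r add0r.
  by rewrite prlow// andbF mul0r addr0 andbT.
have J2 : real_integral (fun y => (y \in above t)%:R * retain y c) =
    real_integral mid + real_integral hi.
  rewrite -real_integralD//; [|exact: measurable_funM|by move=> y; case/andP: (mid01 y)|
    by move=> y; case/andP: (hi01 y)|by move=> y; case/andP: (mid01 y)|
    by move=> y; case/andP: (hi01 y)].
  congr (fine _); apply: eq_integral => y _; congr EFin; rewrite /mid /hi !in_above.
  case: (leP (b y) (b x)) => yx; last first.
    by rewrite (lt_trans tx yx) !andbT andbF mul0r add0r.
  by rewrite andbF mul0r addr0 andbT.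
have E2 : expR (- (lam%:num * real_integral mid)) = partition_above (b x) c / partition_above t c.
  rewrite !partition_above_exp J2 mulrDr expRD invfM mulrCA divff ?mulr1 ?expRN//.
  by rewrite gt_eqF ?expR_gt0.
have xu' : all (fun y => b x < b y) u by apply/allP.
have {}IH := IH (b x) (x :: c) sorted_u xu'.
rewrite J1 mulrDr opprD expRD E2 -mulrA (mulrCA _ (partition_above (b x) c / partition_above t c)) IH.
rewrite hard_coreb_cons// -mulnb natrM /retain.
have z0 t' c' : partition_above t' c' != 0.
  by rewrite gt_eqF// (partition_above_gt0 r lam d_gt0 mB mb muE b_inj).
by field; rewrite !z0.
Qed.

End weights.

(** * The thinning law *)

(** Without repetitions a split is determined by the set of points on its left, so splits correspond
    to subconfigurations. *)
Lemma splits_filter (T : eqType) (s : seq T) p : uniq s -> p \in splits s ->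
  p = ([seq x <- s | x \in p.1], [seq x <- s | x \notin p.1]).
Proof.
move=> us ps; have us12 : uniq (p.1 ++ p.2) by rewrite (perm_uniq (perm_splits ps)).
elim: s p us ps us12 => [|x s IH] p /=; first by rewrite inE => _ /eqP ->.
move=> /andP[xs us]; rewrite mem_cat => /orP[] /mapP[q qs ->] /=.
  have xq : forall y, y \in s -> (y \in x :: q.1) = (y \in q.1).
    by move=> y ys; rewrite inE; case: eqP => // yx; rewrite -yx ys in xs.
  move=> /andP[_ uq]; rewrite mem_head /=; congr (_ :: _, _).
    by rewrite {1}(IH q us qs uq) /=; apply: eq_in_filter => y /xq ->.
  by rewrite {1}(IH q us qs uq) /=; apply: eq_in_filter => y /xq ->.
rewrite cat_uniq /= negb_or => /and3P[uq1 /andP[xq1 q12] /andP[xq2 uq2]].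
have uq : uniq (q.1 ++ q.2) by rewrite cat_uniq uq1 q12.
rewrite (negbTE xq1) /=; congr (_, _ :: _); first by rewrite {1}(IH q us qs uq).
by rewrite {1}(IH q us qs uq).
Qed.

Section thin_law_seq.
Context {R : realType} {d : nat}.
Local Notation E := (d.-tuple R).
Variables (r : R) (lam : {nonneg R}) (B : set E) (v : E).
Variable mu : {finite_measure set E -> \bar R}.
Hypotheses (d_gt0 : (0 < d)%N) (mB : measurable B).
Hypothesis muE : forall A, measurable A -> mu A = volume (A `&` B).
Hypothesis Bv : forall x, B x -> forall i : 'I_d, tnth v i <= tnth x i.
Local Notation Lam := (seq_measure lam mu).
Implicit Types (x y : E) (s c u w : seq E) (F : set (config B * config B)).

Definition level x : R := interleave (translate v x).

Lemma measurable_level : measurable_fun setT level.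
Proof.
apply: (measurableT_comp measurable_interleave).
apply/measurable_fun_tnthP => i.
rewrite (_ : _ \o _ = fun x => tnth x i - tnth v i).
  by apply: measurable_funB => //; exact: measurable_tnth.
by apply/funext => x /=; rewrite tnth_mktuple.
Qed.

Lemma level_inj x y : B x -> B y -> level x = level y -> x = y.
Proof.
move=> Bx By /interleave_inj H; have : translate v x = translate v y.
  by apply: H => // i; rewrite tnth_mktuple subr_ge0 Bv.
move=> E0; apply: eq_from_tnth => i.
have := congr1 (fun t : E => tnth t i) E0; rewrite !tnth_mktuple.
exact: addIr.
Qed.

Let mb := measurable_level.
Let b_inj := level_inj.
Local Notation retain := (retain r lam B level mu).
Local Notation retain_given := (retain_given r lam B level mu).
Local Notation split_weight := (split_weight r lam B level mu).

Lemma retentionE C Y c x : C `|` Y = [set` c] ->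
  retention r lam%:num v B C Y x = retain x c.
Proof.
move=> CY; rewrite /retention CY /retain.
have -> : [set` c] `|` [set x] = [set` x :: c].
  apply/seteqP; split=> y /=; rewrite inE.
    by move=> [->|->]; rewrite ?eqxx ?orbT.
  by move=> /predU1P[]; [right|left].
have mA := measurable_above mB mb (level x).
have AB : after v B x `<=` B by move=> y [].
rewrite !(partition_functionE r lam muE)//; congr (_%:R * _).
congr nat_of_bool; apply/asboolP/hard_corebP.
  by rewrite (_ : [set` [:: x]] = [set x])//; apply/seteqP; split=> y /=; rewrite inE => /eqP.
by rewrite (_ : [set` [:: x]] = [set x])//; apply/seteqP; split=> y /=; rewrite inE => /eqP.
Qed.

Lemma retention_givenE c u x : (forall y, y \in u -> B y) ->
  retention_given r lam%:num v B [set` c] [set` u] x = retain_given c u x.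
Proof.
move=> uB; apply: retentionE; apply/seteqP; split=> y /=; rewrite mem_cat mem_filter.
  by move=> [->//|[yu [_ yx]]]; rewrite yu /level yx orbT.
by move=> /orP[|/andP[yx yu]]; [left|right; split=> //; split=> //; exact: uB].
Qed.

(* [q.1] lists the retained points and [q.2] the deleted ones. *)
Definition split_kernel F c (q : seq E * seq E) : R :=
  \1_F (config_seq B q.1, config_seq B (q.1 ++ q.2)) * split_weight c q.1 q.2.

Lemma split_kernel_ge0 F c q : 0 <= split_kernel F c q.
Proof. by rewrite mulr_ge0// (split_weight_ge0 r lam d_gt0 mB mb muE b_inj). Qed.

Lemma measurable_split_kernel d' (X : measurableType d') F (c u w : X -> seq E) :
  measurable F -> measurable_fun setT c -> measurable_fun setT u ->
  measurable_fun setT w -> measurable_fun setT (fun a => split_kernel F (c a) (u a, w a)).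
Proof.
move=> mF mc mu' mw; apply: measurable_funM; last first.
  exact: (measurable_split_weight r lam d_gt0 mB mb muE b_inj).
have mconf := measurable_config_seq mB.
apply: (measurableT_comp (measurable_indic mF)
  (g := fun a => (config_seq B (u a), config_seq B (u a ++ w a)))).
apply: measurable_fun_pair; apply: (measurableT_comp mconf) => //.
exact: measurable_seq_cat.
Qed.

Lemma config_seq_eq s s' : s =i s' -> config_seq B s = config_seq B s'.
Proof.
by move=> ss'; congr config_of; apply/seteqP; split=> x /=; rewrite ss'.
Qed.

Definition thin_sum C F (Y2 : config B) : \bar R :=
  (\esum_(Y1 in [set Y1 : config B | points Y1 `<=` points Y2])
    (\1_F (Y1, Y2) *
     \big[*%R/1]_(x \in points Y2) thin_weight r lam%:num v B C (points Y1) x)%:E)%E.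

(** Subconfigurations are reindexed by splits. Nothing is asked of the order of s, so any listing of
    the points may be chosen. *)
Lemma thin_sumE F c s : uniq s -> (forall x, x \in s -> B x) ->
  thin_sum [set` c] F (config_seq B s) =
  (\sum_(p <- splits s) (split_kernel F c p)%:E)%E.
Proof.
move=> us sB; rewrite /thin_sum points_config_seq//.
have p1B p : p \in splits s -> forall x, x \in p.1 -> B x.
  by move=> /splits_subseq/mem_subseq H x /H/sB.
rewrite (reindex_esum [set` splits s] _ (fun p => config_seq B p.1)); last first.
  split=> [p /= ps|p q /set_mem/= ps /set_mem/= qs E0|Y Ys /=].
  - rewrite points_config_seq; last exact: p1B.
    by move=> x /=; exact: (mem_subseq (splits_subseq ps)).
  - have pq : p.1 =i q.1.
      move=> x; have := congr1 (@points R d B) E0.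
      rewrite !points_config_seq; [|exact: p1B|exact: p1B].
      by move=> /seteqP[h1 h2]; apply/idP/idP; [exact: h1|exact: h2].
    rewrite (splits_filter us ps) (splits_filter us qs).
    by congr (_, _); apply: eq_filter => x; rewrite pq.
  - exists ([seq x <- s | `[< points Y x >]], [seq x <- s | ~~ `[< points Y x >]]).
      exact: filter_in_splits.
    apply: config_eq; rewrite points_config_seq /= => [|x]; last first.
      by rewrite mem_filter => /andP[_ /sB].
    apply/seteqP; split=> x /=; rewrite mem_filter; first by move=> /andP[/asboolP].
    by move=> Yx; rewrite Ys// andbT; exact/asboolP.
have kE p : p \in splits s -> \1_F (config_seq B p.1, config_seq B s) *
    \big[*%R/1]_(x \in [set` s]) thin_weight r lam%:num v B [set` c] (points (config_seq B p.1)) x =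
    split_kernel F c p.
  move=> ps; rewrite /split_kernel; congr (\1_F (_, _) * _).
    by apply: config_seq_eq; apply/perm_mem; rewrite perm_sym perm_splits.
  have up : uniq (p.1 ++ p.2) by rewrite (perm_uniq (perm_splits ps)).
  rewrite points_config_seq; last exact: p1B.
  rewrite -fsbig_seq// -(perm_big _ (perm_splits ps)) big_cat/= /split_weight; congr (_ * _).
    apply: eq_big_seq => x xp; rewrite /thin_weight asboolT// retention_givenE//.
    exact: p1B.
  apply: eq_big_seq => x xp; rewrite /thin_weight asboolF; last first.
    by move=> /= xp1; move: up; rewrite cat_uniq => /and3P[_ /hasPn/(_ _ xp)/negP + _]; apply.
  by rewrite retention_givenE//; exact: p1B.
rewrite (eq_esum (b := fun p => (split_kernel F c p)%:E)); last by move=> p /= /kE ->.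
rewrite esum_fset; [|exact: finite_seq|by move=> p _; rewrite lee_fin split_kernel_ge0].
by rewrite -fsbig_seq//; exact: uniq_splits.
Qed.

End thin_law_seq.

Section thin_law_integral.
Context {R : realType} {d : nat}.
Local Notation E := (d.-tuple R).
Variables (r : R) (lam : {nonneg R}) (B : set E) (v : E).
Variable mu : {finite_measure set E -> \bar R}.
Hypotheses (d_gt0 : (0 < d)%N) (mB : measurable B) (bB : bounded B).
Hypothesis muE : forall A, measurable A -> mu A = volume (A `&` B).
Hypothesis Bv : forall x, B x -> forall i : 'I_d, tnth v i <= tnth x i.
Local Notation Lam := (seq_measure lam mu).
Local Notation split_kernel := (split_kernel r lam (B := B) v mu).
Local Notation split_weight := (split_weight r lam B (level v) mu).
Local Notation void_prob := (expR (- (lam%:num * fine (mu B)))).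
Implicit Types (s c u w : seq E) (F : set (config B * config B)) (Y : config B).

Let mb := measurable_level v.
Let b_inj := level_inj d_gt0 Bv.
Let msort := measurable_sort_config mB bB mb b_inj.

Lemma sort_config_in Y x : x \in sort_config (level v) Y -> B x.
Proof. by rewrite (sort_config_mem _ bB) => /asboolP; exact: (@config_sub _ _ B Y). Qed.

Lemma seq_measure_eq_on (f g : seq E -> \bar R) : (forall s, 0 <= f s)%E ->
  (forall s, 0 <= g s)%E -> measurable_fun setT f -> measurable_fun setT g ->
  (forall s, uniq s -> (forall x, x \in s -> B x) -> f s = g s) ->
  (\int[Lam]_s f s = \int[Lam]_s g s)%E.
Proof.
move=> f0 g0 mf mg fg.
have mu1 x : mu [set x] = 0%R := mu_set1 mB muE x d_gt0.
apply: (@seq_measure_ae_eq _ _ _ lam mu (@measurable_tuple_eq R d) mu1 (fun x => x \in B)) => //.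
- exact/measurable_setP.
- exact: (mu_setC mB muE).
- by move=> s us /allP sB; apply: fg => // x /sB/set_mem.
Qed.

Let K c F s : \bar R := (\sum_(p <- splits s) (split_kernel F c p)%:E)%E.

Let K_ge0 c F s : (0 <= K c F s)%E.
Proof.
by apply: sume_ge0 => p _; rewrite lee_fin (split_kernel_ge0 r lam d_gt0 mB muE Bv).
Qed.

Lemma measurable_split_kernel_pair c F : measurable F ->
  measurable_fun setT (fun q => (split_kernel F c q)%:E).
Proof.
move=> mF; apply/measurable_EFinP.
rewrite (_ : split_kernel F c = fun q => split_kernel F c (q.1, q.2)); last by apply/funext => -[].
by apply: (measurable_split_kernel r lam d_gt0 mB muE Bv).
Qed.

Let measurable_K c F : measurable F -> measurable_fun setT (K c F).
Proof.
move=> mF; have mk : measurable_fun setT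
    (fun q : seq E * (seq E * seq E) => (split_kernel F c q.2)%:E).
  by apply: (measurableT_comp (measurable_split_kernel_pair c mF)).
apply: (measurableT_comp (measurable_sum_splits mk) (g := fun s => (s, s))).
exact: measurable_fun_pair.
Qed.

Lemma thin_sum_sorted c F Y :
  thin_sum r lam v [set` c] F Y = K c F (sort_config (level v) Y).
Proof.
rewrite -{1}(sort_configK (level v) bB Y) (thin_sumE r lam d_gt0 mB muE Bv)//.
  by have [] := sort_configP (level v) bB Y.
exact: sort_config_in.
Qed.

Lemma thin_lawE c F : measurable F -> thin_law r lam%:num v [set` c] F =
  (void_prob%:E * \int[Lam]_u \int[Lam]_w (split_kernel F c (u, w))%:E)%E.
Proof.
move=> mF; transitivity (void_prob%:E * \int[Lam]_s K c F s)%E; last first.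
  congr (_ * _)%E; apply: (superposition lam mu (f := fun q => (split_kernel F c q)%:E)).
    by move=> q; rewrite lee_fin (split_kernel_ge0 r lam d_gt0 mB muE Bv).
  exact: measurable_split_kernel_pair.
transitivity (\int[@poisson_law R d lam%:num B]_Y (thin_sum r lam v [set` c] F) Y)%E => //.
have mKs : measurable_fun setT (fun Y => K c F (sort_config (level v) Y)).
  exact: (measurableT_comp (measurable_K c mF) msort).
rewrite (_ : thin_sum _ _ _ _ _ = fun Y => K c F (sort_config (level v) Y)); last first.
  by apply/funext => Y; exact: thin_sum_sorted.
rewrite (poisson_integral lam mB muE)//; congr (_ * _)%E.
(* The sorted listing of [config_seq B s] and s itself list the same configuration, hence give the
   same sum whenever s has distinct points in B. *)
apply: seq_measure_eq_on => //; [|exact: measurable_K|].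
  exact: (measurableT_comp mKs (measurable_config_seq mB)).
by move=> s us sB; rewrite -thin_sum_sorted (thin_sumE r lam d_gt0 mB muE Bv).
Qed.

Let split_configs (q : seq E * seq E) := (config_seq B q.1, config_seq B (q.1 ++ q.2)).

Let measurable_split_configs : measurable_fun setT split_configs.
Proof.
have mconf := measurable_config_seq mB.
apply: measurable_fun_pair; apply: (measurableT_comp mconf) => //.
exact: measurable_seq_cat.
Qed.

(** The probability is built as the image, under the map to pairs of configurations, of the measure
    with density [split_weight] against [Lam \x Lam]. It is compared with [thin_law] on measurable
    sets only. *)
Lemma thin_law_prob c :
  (void_prob%:E * \int[Lam]_u \int[Lam]_w (split_kernel setT c (u, w))%:E = 1)%E ->
  exists P : probability (config B * config B)%type R,
    forall F, measurable F -> P F = thin_law r lam%:num v [set` c] F.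
Proof.
move=> total.
pose f (q : seq E * seq E) : \bar R := (split_weight c q.1 q.2)%:E.
have f0 q : (0 <= f q)%E by rewrite lee_fin (split_weight_ge0 r lam d_gt0 mB mb muE b_inj).
have mf : measurable_fun setT f.
  apply/measurable_EFinP; apply: (measurable_split_weight r lam d_gt0 mB mb muE b_inj) => //.
pose m F : \bar R := (void_prob%:E * \int[Lam \x Lam]_(q in split_configs @^-1` F) f q)%E.
have mE F : measurable F -> m F = thin_law r lam%:num v [set` c] F.
  move=> mF; rewrite thin_lawE//; congr (_ * _)%E.
  have mk := measurable_split_kernel_pair c mF.
  rewrite [RHS](_ : _ = \int[Lam \x Lam]_q (split_kernel F c q)%:E)%E; last first.
    rewrite (fubini_tonelli1 (m1 := Lam) (m2 := Lam))// => q.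
    by rewrite lee_fin (split_kernel_ge0 r lam d_gt0 mB muE Bv).
  rewrite integral_mkcond; apply: eq_integral => q _.
  rewrite patchE /split_kernel indicE /f; have [qF|qF] := boolP (q \in _).
    by rewrite mem_set ?mul1r//; exact: (set_mem qF).
  rewrite memNset ?mul0r// => qF'; move/negP: qF; apply; exact/mem_set.
have mpre F : measurable F -> measurable (split_configs @^-1` F).
  by move=> mF; rewrite -[X in measurable X]setTI; exact: measurable_split_configs.
have m0 : m set0 = 0%E by rewrite /m preimage_set0 integral_set0 mule0.
have mge0 F : (0 <= m F)%E by rewrite mule_ge0 ?lee_fin ?expR_ge0// integral_ge0.
have msa : semi_sigma_additive m.
  move=> A mA tA mUA.
  have -> : m (\bigcup_n A n) = (\sum_(0 <= n <oo) m (A n))%E.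
    rewrite /m preimage_bigcup ge0_integral_bigcup//=.
    - by rewrite nneseriesZl// => n _; exact: integral_ge0.
    - by move=> n; exact: mpre.
    - exact: measurable_funTS.
    - by move=> i j _ _ [q [qi qj]]; apply: (tA i j) => //; exists (split_configs q).
  by apply: is_cvg_nneseries.
pose m' : {measure set (config B * config B)%type -> \bar R} :=
  HB.pack m (isMeasure.Build _ _ _ m m0 mge0 msa).
have m1 : m' setT = 1%E by rewrite /= mE// thin_lawE.
pose P : probability (config B * config B)%type R :=
  HB.pack m (isMeasure.Build _ _ _ m m0 mge0 msa) (Measure_isProbability.Build _ _ _ m' m1).
by exists P.
Qed.

End thin_law_integral.

Lemma sort_increasing (T : eqType) (R : realType) (b : T -> R) (s : seq T) :
  uniq s -> {in s &, injective b} ->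
  exists2 s', perm_eq s' s & pairwise (fun x y => b x < b y) s'.
Proof.
move=> us binj; pose le_b x y := b x <= b y.
have tle : total le_b by move=> x y; exact: le_total.
have trle : transitive le_b by move=> y x z; exact: le_trans.
exists (sort le_b s); first by rewrite perm_sort.
have := sort_sorted tle s; rewrite (sorted_pairwise trle) => h1.
have : uniq (sort le_b s) by rewrite sort_uniq.
rewrite uniq_pairwise => h2.
apply: (@sub_in_pairwise _ (mem s) [rel x y | le_b x y && (x != y)]).
- move=> x y xs ys /= /andP[xy]; apply: contra_neqT; rewrite -leNgt => yx.
  by apply: binj => //; apply/eqP; rewrite eq_le yx andbT.
- by apply/allP => x; rewrite mem_sort.
- by rewrite pairwise_relI h1.
Qed.

(** * The two marginals *)

Section marginals.
Context {R : realType} {d : nat}.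
Local Notation E := (d.-tuple R).
Variables (r : R) (lam : {nonneg R}) (B : set E) (v : E).
Variable mu : {finite_measure set E -> \bar R}.
Hypotheses (d_gt0 : (0 < d)%N) (mB : measurable B) (bB : bounded B).
Hypothesis muE : forall A, measurable A -> mu A = volume (A `&` B).
Hypothesis Bv : forall x, B x -> forall i : 'I_d, tnth v i <= tnth x i.
Local Notation Lam := (seq_measure lam mu).
Local Notation split_kernel := (split_kernel r lam (B := B) v mu).
Local Notation split_weight := (split_weight r lam B (level v) mu).
Local Notation retain_given := (retain_given r lam B (level v) mu).
Local Notation partition_above := (partition_above r lam B (level v) mu).
Local Notation void_prob := (expR (- (lam%:num * fine (mu B)))).
Implicit Types (s c u w : seq E) (G : set (config B)) (Y : config B).

Let mb := measurable_level v.
Let b_inj := level_inj d_gt0 Bv.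

Let mu_setT : mu setT = mu B.
Proof. by rewrite !muE// setTI setIid. Qed.

Lemma thin_sum_snd c G Y :
  thin_sum r lam v [set` c] (snd @^-1` G) Y = (\1_G Y)%:E.
Proof.
have [sY us0] := sort_configP (level v) bB Y.
have ss0B := sort_config_in (v := v) bB (Y := Y).
(* The weights are summed along a decreasing listing, obtained by sorting with the opposite
   level. *)
have [s ss0 sorted_s] : exists2 s, perm_eq s (sort_config (level v) Y) &
    pairwise (fun x y => - level v x < - level v y) s.
  by apply: sort_increasing => // x y /ss0B Bx /ss0B By /oppr_inj; exact: b_inj.
have us : uniq s by rewrite (perm_uniq ss0).
have sB x : x \in s -> B x by rewrite (perm_mem ss0); exact: ss0B.
have -> : Y = config_seq B s.
  by rewrite -{1}(sort_configK (level v) bB Y); apply: config_seq_eq => x; rewrite (perm_mem ss0).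
rewrite (thin_sumE r lam d_gt0 mB muE Bv)// sumEFin; congr EFin.
rewrite (eq_big_seq (fun p => \1_G (config_seq B s) * split_weight c p.1 p.2)).
  rewrite -mulr_sumr sum_split_weight_sorted ?mulr1//.
  by apply: sub_pairwise sorted_s => x y; rewrite ltrN2.
move=> p /perm_splits/perm_mem ps; rewrite /split_kernel/=.
by rewrite (config_seq_eq B ps) !indicE.
Qed.

Lemma measurable_config_seq_in G : measurable G ->
  measurable [set s : seq E | (forall x, x \in s -> B x) /\ G (config_seq B s)].
Proof.
move=> mG; rewrite (_ : [set s | _] =
    [set s : seq E | all (fun x => x \in B) s] `&` config_seq B @^-1` G).
  apply: measurableI.
    apply: measurable_bool_set.
    apply: (@measurable_seq_all _ E _ (seq E) (fun _ x => x \in B) id) => //.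
    by apply: (measurableT_comp (f := fun x => x \in B)) => //; exact/measurable_setP.
  by rewrite -[X in measurable X]setTI; exact: measurable_config_seq.
apply/seteqP; split=> s /= [sB Gs]; split=> //.
  by apply/allP => x /sB/mem_set.
by move=> x xs; apply: set_mem; exact: (allP sB).
Qed.

Lemma thin_law_snd c G : measurable G ->
  thin_law r lam%:num v [set` c] (snd @^-1` G) = poisson_law lam%:num G.
Proof.
move=> mG.
transitivity (\int[@poisson_law R d lam%:num B]_Y
    (thin_sum r lam v [set` c] (snd @^-1` G)) Y)%E => //.
have -> : thin_sum r lam v [set` c] (snd @^-1` G) = fun Y => (\1_G Y)%:E.
  by apply/funext => Y; exact: thin_sum_snd.
have m1 : measurable_fun setT (fun Y => (\1_G Y)%:E : \bar R).
  by apply/measurable_EFinP; exact: measurable_indic.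
rewrite (poisson_integral lam mB muE)//.
rewrite (poisson_lawE lam muE G mB)//; congr (_ * _)%E.
have mA := measurable_config_seq_in mG.
transitivity
    (\int[Lam]_s (\1_[set s : seq E | (forall x, x \in s -> B x) /\ G (config_seq B s)] s)%:E)%E.
  apply: (seq_measure_eq_on lam d_gt0 mB muE).
  - by move=> s; rewrite lee_fin.
  - by move=> s; rewrite lee_fin.
  - exact: (measurableT_comp m1 (measurable_config_seq mB)).
  - by apply/measurable_EFinP; exact: measurable_indic.
  - move=> s us sB; rewrite !indicE; congr (_%:R)%:E; congr nat_of_bool.
    by apply/idP/idP => [/set_mem Gs|/set_mem[_ Gs]]; exact/mem_set.
by rewrite integral_indic// setIT.
Qed.

Lemma thin_law_setT c :
  thin_law r lam%:num v [set` c] [set: config B * config B] = 1%E.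
Proof.
rewrite -(preimage_setT (@snd (config B) (config B))) thin_law_snd//
  (poisson_lawE lam muE setT mB)//.
pose A := [set s : seq E | (forall x, x \in s -> B x) /\ setT (config_seq B s)].
have mA : measurable A by exact: measurable_config_seq_in.
transitivity (void_prob%:E * \int[Lam]_s (\1_A s)%:E)%E.
  by rewrite integral_indic// setIT.
rewrite (_ : (\int[Lam]_s _)%E = \int[Lam]_s (cst 1%E) s)%E; last first.
  apply: (seq_measure_eq_on lam d_gt0 mB muE) => //.
  - by apply/measurable_EFinP; exact: measurable_indic.
  - by move=> s us sB; rewrite indicE mem_set.
rewrite integral_cst// mul1e; transitivity (void_prob%:E * (expR (lam%:num * fine (mu setT)))%:E)%E.
  by congr (_ * _)%E; exact: seq_measure_setT.
by rewrite mu_setT -EFinM -expRD addNr expR0.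
Qed.

Lemma thin_law_subset C :
  thin_law r lam%:num v C [set w : config B * config B | points w.1 `<=` points w.2] =
  thin_law r lam%:num v C [set: config B * config B].
Proof.
congr (integral _ _ _); apply/funext => Y2; apply: eq_esum => Y1 /= Y12.
by rewrite !indicE !mem_set.
Qed.

(** Levels are nonnegative, so -1 is a threshold below all of B; outside B the measure vanishes. *)
Let J1 c u : real_integral mu (fun x => 1 - retain_given c u x) =
  fine (mu B) - real_integral mu (fun x => (x \in above B (level v) (-1))%:R * retain_given c u x).
Proof.
have mpr : measurable_fun setT (retain_given c u).
  by apply: (measurable_retain_given r lam d_gt0 mB mb muE b_inj).
have pr0 x : 0 <= retain_given c u x by exact: retain_given_ge0.
have pr1 x : retain_given c u x <= 1 by exact: (retain_given_le1 r lam d_gt0 mB mb muE b_inj).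
have JB :
    real_integral mu (fun x => (x \in above B (level v) (-1))%:R * retain_given c u x) =
    real_integral mu (retain_given c u).
  congr fine; apply: ae_eq_integral => //.
    apply/measurable_EFinP; apply: measurable_funM => //.
    by apply: measurable_b2r; apply/measurable_setP; exact: (measurable_above mB mb).
    exact/measurable_EFinP.
  exists [set x | x \notin B]; split.
  - by apply: measurable_bool_set; apply: measurable_neg; exact/measurable_setP.
  - exact: (mu_setC mB muE).
  - move=> x /= H; apply/negP => xB; apply: H => _; congr EFin.
    rewrite in_above xB (lt_le_trans (ltrN10 _))// ?mul1r//.
    by apply: interleave_ge0.
rewrite JB; apply/eqP; rewrite eq_sym subr_eq; apply/eqP.
rewrite -(real_integralD mu (f := fun x => 1 - retain_given c u x))//.
- rewrite /real_integral; under eq_integral do rewrite subrK.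
  by rewrite integral_cst// mul1e; congr fine; exact/esym/mu_setT.
- exact: measurable_funB.
- by move=> x; rewrite subr_ge0.
- by move=> x; rewrite lerBlDr lerDl.
Qed.

Let prod_exp c u : uniq u -> (forall x, x \in u -> B x) ->
  \prod_(x <- u) retain_given c u x *
    expR (- (lam%:num *
      real_integral mu (fun x => (x \in above B (level v) (-1))%:R * retain_given c u x))) =
  (hard_coreb r u c)%:R / partition_above (-1) c.
Proof.
move=> uu uB; have [s su sorted_s] : exists2 s, perm_eq s u &
    pairwise (fun x y => level v x < level v y) s.
  by apply: sort_increasing => // x y /uB Bx /uB By; exact: b_inj.
have prE : retain_given c u = retain_given c s.
  by apply/funext => x; apply: eq_retain_given => y; rewrite (perm_mem su).
rewrite (eq_hard_coreb r (fun x => esym (perm_mem su x)) (fun=> erefl)) prE -(perm_big _ su).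
apply: (prod_retain_given_exp r lam d_gt0 mB mb muE b_inj) => //.
apply/allP => x _; rewrite (lt_le_trans (ltrN10 _))//.
exact: interleave_ge0.
Qed.

Lemma thin_law_fst c G : measurable G ->
  thin_law r lam%:num v [set` c] (fst @^-1` G) = hard_sphere_law r lam%:num [set` c] G.
Proof.
move=> mG; have mF : measurable (fst @^-1` G : set (config B * config B)).
  by rewrite -[X in measurable X]setTI; exact: measurable_fst.
rewrite (thin_lawE r lam d_gt0 mB bB muE Bv)//.
have mpr u : measurable_fun setT (retain_given c u).
  by apply: (measurable_retain_given r lam d_gt0 mB mb muE b_inj).
have pr0 u x : 0 <= retain_given c u x by exact: retain_given_ge0.
have pr1 u x : retain_given c u x <= 1 by exact: (retain_given_le1 r lam d_gt0 mB mb muE b_inj).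
pose A := [set s : seq E | ((forall x, x \in s -> B x) /\ G (config_seq B s)) /\ hard_coreb r s c].
have mA : measurable A.
  apply: measurableI; first exact: measurable_config_seq_in.
  by apply: measurable_bool_set; exact: measurable_hard_coreb.
(* The retention probabilities depend on u alone, so w enters only through a product and the
   generating functional applies. *)
have inner u : (\int[Lam]_w (split_kernel (fst @^-1` G) c (u, w))%:E =
    (\1_G (config_seq B u) * \prod_(x <- u) retain_given c u x *
     expR (lam%:num * real_integral mu (fun x => 1 - retain_given c u x)))%:E)%E.
  have iE Y : \1_(fst @^-1` G) (config_seq B u, Y) = \1_G (config_seq B u) :> R.
    by rewrite !indicE.
  rewrite /split_kernel /split_weight /=; under eq_integral do rewrite iE mulrA EFinM.
  rewrite ge0_integralZl//.
  - rewrite (@integral_seq_measure_prod _ _ _ lam mu (fun x => 1 - retain_given c u x)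
      (real_integral mu (fun x => 1 - retain_given c u x)))//.
    + by move=> x; rewrite subr_ge0.
    + exact: measurable_funB.
    + apply: real_integralE => //; first exact: measurable_funB.
        by move=> x; rewrite subr_ge0.
      by move=> x; rewrite lerBlDr lerDl.
  - apply/measurable_EFinP;
    apply: (@measurable_seq_prod _ E _ (seq E) R (fun _ x => 1 - retain_given c u x)) => //.
    by apply: measurable_funB => //; apply: (measurableT_comp (mpr u)).
  - by move=> w _; rewrite lee_fin prodr_ge0// => x _; rewrite subr_ge0.
  - by rewrite lee_fin mulr_ge0// prodr_ge0.
(* The factor exp(lambda |B|) from the deleted points cancels [void_prob]; what remains is the
   telescoped product. *)
have eA u : uniq u -> (forall x, x \in u -> B x) ->
    (void_prob%:E * \int[Lam]_w (split_kernel (fst @^-1` G) c (u, w))%:E =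
    ((partition_above (-1) c)^-1)%:E * (\1_A u)%:E)%E.
  move=> uu uB; rewrite inner J1 -!EFinM; congr EFin.
  have -> : \1_A u = \1_G (config_seq B u) * (hard_coreb r u c)%:R :> R.
    rewrite !indicE -natrM mulnb; congr (_%:R); congr nat_of_bool.
    by apply/idP/andP => [/set_mem[[_ Gu] hu]|[/set_mem Gu hu]];
      [split=> //; exact/mem_set|exact/mem_set].
  have := prod_exp c uu uB; rewrite mulrBr expRD.
  set P := \prod_(_ <- _) _; set Q := expR (- (_ * real_integral _ _)) => PQ.
  transitivity ((void_prob * expR (lam%:num * fine (mu B))) *
    \1_G (config_seq B u) * (P * Q)); first by ring.
  by rewrite PQ -expRD addNr expR0; ring.
pose I u := (\int[Lam]_w (split_kernel (fst @^-1` G) c (u, w))%:E)%E.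
have k0 q : (0 <= (split_kernel (fst @^-1` G) c q)%:E)%E.
  by rewrite lee_fin (split_kernel_ge0 r lam d_gt0 mB muE Bv).
have I0 u : (0 <= I u)%E by exact: integral_ge0.
have mI : measurable_fun setT I.
  apply: (@measurable_fun_fubini_tonelli_F _ _ _ _ _ Lam
    (fun q => (split_kernel (fst @^-1` G) c q)%:E)) => //.
  exact: (measurable_split_kernel_pair r lam d_gt0 mB muE Bv).
rewrite -(ge0_integralZl _ measurableT mI)//.
have zf0 : 0 < partition_above (-1) c by exact: (partition_above_gt0 r lam d_gt0 mB mb muE b_inj).
rewrite (_ : (\int[Lam]_u _)%E =
    \int[Lam]_u (((partition_above (-1) c)^-1)%:E * (\1_A u)%:E))%E; last first.
  apply: (seq_measure_eq_on lam d_gt0 mB muE) => //.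
  - by move=> s; rewrite mule_ge0// lee_fin expR_ge0.
  - by move=> s; rewrite mule_ge0// lee_fin invr_ge0 ltW.
  - exact: measurable_funeM.
  - by apply: measurable_funeM; apply/measurable_EFinP; exact: measurable_indic.
rewrite ge0_integralZl//; [|by apply/measurable_EFinP; exact: measurable_indic|
  by rewrite lee_fin invr_ge0 ltW].
rewrite integral_indic// setIT /hard_sphere_law !(poisson_lawE lam muE _ mB)//.
have aboveB x : B x -> x \in above B (level v) (-1).
  by move=> Bx; rewrite in_above mem_set//= (lt_le_trans (ltrN10 _))//; exact: interleave_ge0.
have -> : [set s : seq E | (forall x, x \in s -> B x) /\
    hard_core_event r B [set` c] (config_seq B s)] =
    [set s | inside r (above B (level v) (-1)) s c].
  apply/seteqP; split=> s /=.
    move=> [sB]; rewrite /hard_core_event/= points_config_seq// => /hard_corebP hs.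
    by apply/andP; split=> //; apply/allP => x /sB; exact: aboveB.
  move=> /andP[/allP sB hs]; have sB' x : x \in s -> B x.
    by move=> /sB; rewrite in_above => /andP[/set_mem].
  by split=> //; rewrite /hard_core_event/= points_config_seq//; exact/hard_corebP.
have -> : [set s : seq E | (forall x, x \in s -> B x) /\
    (G `&` hard_core_event r B [set` c]) (config_seq B s)] = A.
  apply/seteqP; split=> s /= [sB].
    by move=> [Gs]; rewrite /hard_core_event/= points_config_seq//; split=> //; exact/hard_corebP.
  case: sB => sB Gs hs; split=> //; split=> //; rewrite /hard_core_event/= points_config_seq//.
  exact/hard_corebP.
have LA : Lam A = (fine (Lam A))%:E by rewrite fineK// fin_num_measure.
rewrite (partition_aboveE r lam mu mB mb); move: (fine _) LA => a LA.
rewrite [X in (_ * X)%E = _](_ : _ = a%:E); last exact: LA.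
rewrite [X in fine (_ * X) / _](_ : _ = a%:E); last exact: LA.
rewrite -!EFinM/=; congr (_%:E).
by rewrite invfM mulrACA divff ?mul1r 1?mulrC// gt_eqF// expR_gt0.
Qed.

End marginals.

(** * Dependence on the boundary condition *)

Section locality.
Context {R : realType} {d : nat}.
Local Notation E := (d.-tuple R).
Variables (r lambda : R) (v : E) (B : set E).
Implicit Types (x y : E) (Y C : set E).

Definition agree C C' := forall x, sphere_union r B x -> C x <-> C' x.

Lemma agreeU C C' Y : agree C C' -> agree (C `|` Y) (C' `|` Y).
Proof. by move=> CC' x /CC' H; split=> -[/H|]; [left|right|left|right]. Qed.

Lemma agree_sym C C' : agree C C' -> agree C' C.
Proof. by move=> CC' x /CC' H; split=> /H. Qed.

(** A boundary point outside [sphere_union r B] is farther than r from every point of B, so it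
    imposes nothing. *)
Lemma hard_core_local Y C C' : Y `<=` B -> agree C C' ->
  hard_core r Y C = hard_core r Y C'.
Proof.
have sub D D' : Y `<=` B -> agree D D' -> hard_core r Y D -> hard_core r Y D'.
  move=> YB DD' [H1 H2]; split=> // x y D'x Yy.
  have [/DD' DE|Sx] := pselect (sphere_union r B x); first by apply: H2 => //; exact/DE.
  by rewrite ltNge; apply/negP => xy; apply: Sx; exists y; rewrite 1?dist_sym//; exact: YB.
by move=> YB CC'; apply/propext; split; apply: sub => //; exact: agree_sym.
Qed.

Lemma hard_core_event_local (D : set E) C C' : D `<=` B -> agree C C' ->
  hard_core_event r D C = hard_core_event r D C'.
Proof.
move=> DB CC'; apply/funext => Y; apply: hard_core_local => //.
by apply: subset_trans DB; exact: (@config_sub _ _ D Y).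
Qed.

Lemma retention_local C C' Y x : B x -> agree C C' ->
  retention r lambda v B C Y x = retention r lambda v B C' Y x.
Proof.
move=> Bx CC'; have CY := agreeU Y CC'.
have AB : after v B x `<=` B by move=> y [].
rewrite /retention /hard_coreR /partition_function.
rewrite (hard_core_local _ CY); last by move=> y ->.
by rewrite (hard_core_event_local AB CY) (hard_core_event_local AB (agreeU [set x] CY)).
Qed.

Lemma thin_law_local C C' (F : set (config B * config B)) : agree C C' ->
  thin_law r lambda v C F = thin_law r lambda v C' F :> \bar R.
Proof.
move=> CC'; congr (integral _ _ _); apply/funext => Y2; apply: eq_esum => Y1 _.
congr (_ * _)%:E; apply: eq_fsbigr => x /set_mem Y2x.
have Bx := @config_sub _ _ B Y2 x Y2x.
by rewrite /thin_weight /retention_given (retention_local _ Bx CC').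
Qed.

Lemma hard_sphere_law_local C C' (F : set (config B)) : agree C C' ->
  hard_sphere_law r lambda C F = hard_sphere_law r lambda C' F.
Proof. by move=> CC'; rewrite /hard_sphere_law (hard_core_event_local _ CC'). Qed.

Lemma agree_collar (C : config (~` B)) : agree (points C) (points C `&` collar r B).
Proof.
move=> x Sx; split=> [Cx|[]//]; split=> //; split=> //.
exact: (@config_sub _ _ (~` B) C).
Qed.

End locality.

Section boundary_sequence.
Context {R : realType} {d : nat}.
Local Notation E := (d.-tuple R).
Variables (r : R) (B : set E).
Hypotheses (d_gt0 : (0 < d)%N) (mB : measurable B) (bB : bounded B).

Lemma bounding_box : exists (K : set E) (v : E), [/\ measurable K, bounded K,
  sphere_union r B `<=` K & forall x, K x -> forall i : 'I_d, tnth v i <= tnth x i].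
Proof.
(* A point within r of B differs from a by at most M + r in each coordinate. The lower corner of the
   resulting cube serves as origin for the order. *)
have [a [M BM]] := bB; pose L := M + r.
exists [set y | all (fun i => `|tnth a i - tnth y i| <= L) (enum 'I_d)],
  [tuple tnth a i - L | i < d].
have boxP y i : all (fun i => `|tnth a i - tnth y i| <= L) (enum 'I_d) ->
    `|tnth a i - tnth y i| <= L.
  by move=> /allP; apply; rewrite mem_enum.
split.
- apply: measurable_bool_set; elim: (enum 'I_d) => [|i s IH]; first exact: measurable_cst.
  apply: measurable_and => //; apply: measurable_fun_ler => //.
  by apply: measurableT_comp => //; apply: measurable_funB => //; exact: measurable_tnth.
- exists a, (Num.sqrt (\sum_(i < d) L ^+ 2)); move=> y /boxP yL.
  apply: ler_wsqrtr; apply: ler_sum => i _.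
  by rewrite -[leLHS]real_normK ?num_real// ler_pXn2r ?nnegrE// (le_trans _ (yL i)).
- move=> y [x Bx xy] /=; apply/allP => i _.
  rewrite (_ : _ - _ = (tnth a i - tnth x i) + (tnth x i - tnth y i)).
    apply: (le_trans (ler_normD _ _)); apply: lerD.
      exact: le_trans (dist_ge_coord _ _ _) (BM _ Bx).
    exact: le_trans (dist_ge_coord _ _ _) xy.
  by rewrite addrA subrK.
- move=> y /boxP yL i; rewrite tnth_mktuple lerBlDr -lerBlDl.
  exact: le_trans (ler_norm _) (yL i).
Qed.

Lemma boundary_sequence : exists2 c : config (~` B) -> seq E,
  measurable_fun setT c & forall C, agree r B (points C) [set` c C].
Proof.
have [K [v [mK bK SK vK]]] := bounding_box.
have mD : measurable (K `\` B) by exact: measurableD.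
have bD : bounded (K `\` B).
  by have [a [M KM]] := bK; exists a, M; move=> y [/KM].
have vD x : (K `\` B) x -> forall i : 'I_d, tnth v i <= tnth x i by move=> [/vK].
pose res (C : config (~` B)) : config (K `\` B) := config_of (K `\` B) (points C `&` K).
have resE C : points (res C) = points C `&` K.
  rewrite points_config_of//.
    by move=> x [Cx Kx]; split=> //; exact: (@config_sub _ _ (~` B) C).
  by apply: locally_finite_finite; exact: (@config_locally_finite _ _ _ C).
have mres : measurable_fun setT res.
  apply: measurable_config_fun => A mA AD.
  rewrite (_ : [set _ | _] = void_event (~` B) A).
    by apply: measurable_void_event => // x /AD[].
  apply/seteqP; split=> C; rewrite /void_event/= resE -setIA (_ : K `&` A = A)//;
  by apply: setIidr => x /AD[].
exists (fun C => sort_config (level v) (res C)).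
  exact: (measurableT_comp (measurable_sort_config mD bD (measurable_level v)
    (level_inj d_gt0 vD)) mres).
move=> C x Sx; have [-> _] := sort_configP (level v) bD (res C).
by rewrite resE; split=> [Cx|[]//]; split=> //; exact: SK.
Qed.

End boundary_sequence.

(** The double integral has a kernel jointly measurable in c, u and w, so Tonelli applied twice
    leaves a measurable function of c. *)
Lemma measurable_thin_law_seq {R : realType} {d : nat} (r : R) (lam : {nonneg R})
    (B : set (d.-tuple R)) (v : d.-tuple R)
    (mu : {finite_measure set (d.-tuple R) -> \bar R}) (F : set (config B * config B)) :
  (0 < d)%N -> measurable B -> bounded B ->
  (forall A, measurable A -> mu A = volume (A `&` B)) ->
  (forall x, B x -> forall i : 'I_d, tnth v i <= tnth x i) ->
  measurable F ->
  measurable_fun setT (fun c : seq (d.-tuple R) => thin_law r lam%:num v [set` c] F).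
Proof.
move=> d_gt0 mB bB muE Bv mF; pose Lam := seq_measure lam mu.
under eq_fun do rewrite (thin_lawE r lam d_gt0 mB bB muE Bv)//.
apply: measurable_funeM.
pose f (q : seq (d.-tuple R) * seq (d.-tuple R) * seq (d.-tuple R)) : \bar R :=
  (split_kernel r lam v mu F q.1.1 (q.1.2, q.2))%:E.
have f0 q : (0 <= f q)%E by rewrite lee_fin (split_kernel_ge0 r lam d_gt0 mB muE Bv).
have mf : measurable_fun setT f.
  apply/measurable_EFinP; apply: (measurable_split_kernel r lam d_gt0 mB muE Bv) => //.
  - exact: measurableT_comp.
  - exact: measurableT_comp.
have mg := @measurable_fun_fubini_tonelli_F _ _ _ _ _ Lam f mf f0.
apply: (@measurable_fun_fubini_tonelli_F _ _ _ _ _ Lam _ mg) => q.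
exact: integral_ge0.
Qed.

Unset Implicit Arguments.

Theorem theorem5p3 (R : realType) (d : nat) (r lambda : R)
    (B : set (d.-tuple R)) (v : d.-tuple R)
    (d_ge1 : (1 <= d)%N) (r_ge0 : 0 <= r) (lambda_ge0 : 0 <= lambda)
    (mB : measurable B) (bB : bounded B)
    (Bv : forall x, B x -> forall i : 'I_d, tnth v i <= tnth x i) :
  [/\ forall C : config (~` B),
        exists P : probability (config B * config B)%type R,
        [/\ forall F, measurable F -> P F = thin_law r lambda v C F,
            forall F : set (config B), measurable F ->
              pushforward P fst F = hard_sphere_law r lambda (points C) F,
            forall F : set (config B), measurable F ->
              pushforward P snd F = poisson_law lambda F,
            measurable [set w : config B * config B | points w.1 `<=` points w.2] &
            P [set w : config B * config B | points w.1 `<=` points w.2] = 1%E],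
      forall (C : config (~` B)) (F : set (config B * config B)), measurable F ->
        thin_law r lambda v (points C) F =
        thin_law r lambda v (points C `&` collar r B) F &
      forall F : set (config B * config B), measurable F ->
        measurable_fun [set: config (~` B)]
          (fun C => thin_law r lambda v (points C) F)].
Proof.
have Boo : (volume B < +oo)%E by rewrite -lebesgueE; exact: lebesgue_bounded.
pose mu : {finite_measure set (d.-tuple R) -> \bar R} := mfrestr mB Boo.
have muE A : measurable A -> mu A = volume (A `&` B) by [].
pose lam : {nonneg R} := NngNum lambda_ge0.
(* From here on C is replaced by the finite list [c C], which agrees with it wherever the laws can
   see it. *)
have [c mc Cc] := boundary_sequence r d_ge1 mB bB.
have thinE C (F : set (config B * config B)) :
    thin_law r lambda v (points C) F = thin_law r lam%:num v [set` c C] F.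
  by apply: (thin_law_local lambda v F (Cc C)).
(* Inclusion is measurable because it becomes a membership test between the two sorted lists. *)
have msub : measurable [set w : config B * config B | points w.1 `<=` points w.2].
  have msort := measurable_sort_config mB bB (measurable_level v) (level_inj d_ge1 Bv).
  rewrite (_ : [set w | _] = [set w : config B * config B |
    all (fun x => x \in sort_config (level v) w.2) (sort_config (level v) w.1)]).
    apply: measurable_bool_set.
    apply: (@measurable_seq_all _ _ _ _ (fun w x => x \in sort_config (level v) w.2)).
      apply: (measurable_mem_seq (@measurable_tuple_eq R d)) => //.
      by apply: (measurableT_comp msort); exact: (measurableT_comp measurable_snd).
    exact: (measurableT_comp msort).
  apply/seteqP; split=> -[Y1 Y2] /=.
    move=> Y12; apply/allP => x; rewrite !(sort_config_mem _ bB).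
    by move=> /asboolP/Y12 ?; exact/asboolP.
  move=> /allP Y12 x Y1x; have := Y12 x; rewrite !(sort_config_mem _ bB).
  by move=> H; apply/asboolP/H/asboolP.
split.
- move=> C.
  have [P PE] : exists P : probability (config B * config B)%type R,
      forall F, measurable F -> P F = thin_law r lam%:num v [set` c C] F.
    apply: (thin_law_prob d_ge1 mB bB muE Bv).
    rewrite -(thin_lawE r lam d_ge1 mB bB muE Bv)//.
    exact: (thin_law_setT r lam d_ge1 mB bB muE Bv).
  exists P; split; [..|exact: msub|].
  + by move=> F mF; rewrite thinE PE.
  + move=> F mF; rewrite (hard_sphere_law_local _ _ (Cc C)).
    rewrite -(thin_law_fst r lam d_ge1 mB bB muE Bv)// -PE//.
    by rewrite -[X in measurable X]setTI; exact: measurable_fst.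
  + move=> F mF; rewrite -(thin_law_snd r lam d_ge1 mB bB muE Bv (c C))// -PE//.
    by rewrite -[X in measurable X]setTI; exact: measurable_snd.
  + rewrite PE// thin_law_subset.
    exact: (thin_law_setT r lam d_ge1 mB bB muE Bv).
- by move=> C F mF; apply: thin_law_local; exact: agree_collar.
- move=> F mF; under eq_fun do rewrite thinE.
  exact: (measurableT_comp (measurable_thin_law_seq r lam d_ge1 mB bB muE Bv mF) mc).
Qed.
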